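(* Let $(X,d,\mu)$ be a complete, doubling metric measure space supporting a $(1,1)$-Poincaré inequality. Let $0<\theta<1$ and $1\le q\le Q_d/(Q_d-\theta)$, where $Q_d>1$ is the relative lower mass bound exponent of $\mu$. Then there exist constants $C\ge 1$ and $\tau\ge 1$, depending only on the doubling constant and the constants of the $(1,1)$-Poincaré inequality, such that for all balls $B=B(x_0,r)\subset X$ and all $u\in L^1_{\mathrm{loc}}(X)$, $$\left(\frac{1}{\mu(B)}\int_{B}|u-u_{B}|^q\,d\mu\right)^{1/q}\le C(1-\theta)\,r^\theta\,\frac{1}{\mu(\tau B)}\int_{\tau B}\int_{\tau B}\frac{|u(x)-u(y)|}{d(x,y)^\theta\,\mu(B(x,d(x,y)))}\,d\mu(y)\,d\mu(x).$$
   Context: A metric measure space $(X,d,\mu)$ is a metric space with a Borel regular outer measure $\mu$. Balls $B(x,r)=\{y\in X:d(x,y)<r\}$ are open and come with a prescribed center and radius; for $B=B(x,r)$, $\lambda B:=B(x,\lambda r)$ and $\mathrm{rad}(B):=r$. The measure $\mu$ is doubling with constant $C_\mu\ge1$ if $0<\mu(B(x,2r))\le C_\mu\,\mu(B(x,r))<\infty$ for all $x\in X$, $r>0$. We write $u_B=\frac1{\mu(B)}\int_B u\,d\mu$. $L^1_{\mathrm{loc}}(X)$ consists of the functions integrable on every open set with compact closure (complete doubling spaces are proper, so equivalently on every ball). Relative lower mass bound exponent: if $\mu$ is doubling there exist $C_0\ge1$ and $Q_d>1$, depending only on $C_\mu$, such that $\frac{\mu(B(y,r))}{\mu(B(x,R))}\ge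 C_0^{-1}\left(\frac rR\right)^{Q_d}$ for all $x\in X$, $0<r\le R<\infty$, $y\in B(x,R)$; $Q_d$ denotes this (fixed) exponent. A Borel function $g:X\to[0,\infty]$ is an upper gradient of $u:X\to[-\infty,\infty]$ if $|u(\gamma(b))-u(\gamma(a))|\le\int_\gamma g\,ds$ for all non-constant compact rectifiable curves $\gamma:[a,b]\to X$ (with $\int_\gamma g\,ds=\infty$ required if $u(\gamma(a))$ or $u(\gamma(b))$ is not finite). $(X,d,\mu)$ supports a $(1,1)$-Poincaré inequality if there are constants $C_P,\tau_P\ge1$ such that $\frac1{\mu(B)}\int_B|u-u_B|\,d\mu\le C_P\,\mathrm{rad}(B)\,\frac1{\mu(\tau_PB)}\int_{\tau_PB}g\,d\mu$ for every ball $B$, every $u\in L^1_{\mathrm{loc}}(X)$ and every upper gradient $g$ of $u$. The integrand of the double integral is read as $0$ on the diagonal $x=y$. *)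

(* Defs.v *)
From HB Require Import structures.
From mathcomp Require Import all_boot all_order all_algebra.
From mathcomp Require Import all_classical all_reals all_analysis.
From mathcomp Require Import measurable_realfun.

Set Implicit Arguments.
Unset Strict Implicit.
Unset Printing Implicit Defensive.

Import Order.TTheory GRing.Theory Num.Theory.
Import numFieldNormedType.Exports.

Local Open Scope classical_set_scope.
Local Open Scope ring_scope.

#[short(type="completeMetricType")]
HB.structure Definition CompleteMetric (K : numDomainType) :=
  {T of Metric K T & Complete T}.

Section curves.
Context {R : realType} {T : metricType R}.
Implicit Types (gamma : R -> T) (a b : R).

Definition chord_sum gamma a b (s : seq R) : R :=
  \sum_(0 <= i < size s)
    mdist (gamma (nth b (a :: s) i)) (gamma (nth b (a :: s) i.+1)).

Definition curve_length gamma a b : \bar R :=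
  ereal_sup [set (chord_sum gamma a b s)%:E | s in itv_partition a b].

Definition rectifiable_curve gamma a b : Prop :=
  [/\ a <= b, {within `[a, b], continuous gamma}
    & (curve_length gamma a b < +oo)%E].

Definition nonconstant_curve gamma a b : Prop :=
  exists s t, [/\ s \in `[a, b], t \in `[a, b] & gamma s <> gamma t].

(* The value at t is gamma(s) for any parameter s at which the length run
   through since a equals t; two such s give the same point since gamma does
   not move between them. *)
Definition arclength_param gamma a b (t : R) : T :=
  gamma (xget a [set s | s \in `[a, b] /\ curve_length gamma a s = t%:E]).

Definition line_integral gamma a b (g : T -> \bar R) : \bar R :=
  (\int[@lebesgue_measure R]_(t in `[0%R, fine (curve_length gamma a b)])
     g (arclength_param gamma a b t))%E.

End curves.

Section metric_measure_space.
Context {R : realType} {T : completeMetricType R}.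
Implicit Types (mu : {outer_measure set T -> \bar R}) (A : set T).
Implicit Types (u g : T -> \bar R).
Local Open Scope ereal_scope.

Definition borel_set A : Prop := <<s @open T >> A.

Definition borel_fun g : Prop :=
  @measurable_fun _ _ (g_sigma_algebraType (@open T)) (\bar R) setT g.

Definition borel_regular mu : Prop :=
  (forall A, borel_set A -> mu.-cara.-measurable A) /\
  (forall A, exists B, [/\ borel_set B, A `<=` B & mu B = mu A]).

Definition doubling mu (Cmu : R) : Prop :=
  forall (x : T) (r : R), (0 < r)%R ->
    [/\ 0 < mu (ball x (2 * r)%R),
        mu (ball x (2 * r)%R) <= Cmu%:E * mu (ball x r)
      & Cmu%:E * mu (ball x r) < +oo].

Definition lower_mass_bound mu (C0 Qd : R) : Prop :=
  forall (x y : T) (r r' : R), (0 < r)%R -> (r <= r')%R -> ball x r' y ->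
    (C0^-1 * (r / r') `^ Qd)%:E <= mu (ball y r) / mu (ball x r').

(* All integrals against the outer measure mu are taken over its
   Caratheodory sigma-algebra. *)
Definition mu_integral mu A u : \bar R :=
  \int[(mu : set (caratheodory_type mu) -> \bar R)]_(x in A) u x.

Definition mean mu A u : \bar R := (mu A)^-1 * mu_integral mu A u.

Definition L1loc mu u : Prop :=
  forall U : set T, open U -> compact (closure U) ->
    (mu : set (caratheodory_type mu) -> \bar R).-integrable U u.

Definition upper_gradient g u : Prop :=
  [/\ borel_fun g, forall x, 0 <= g x
    & forall (gamma : R -> T) (a b : R),
        rectifiable_curve gamma a b -> nonconstant_curve gamma a b ->
        if (u (gamma a) \is a fin_num) && (u (gamma b) \is a fin_num)
        then (`|u (gamma b) - u (gamma a)| <= line_integral gamma a b g) : Prop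
        else line_integral gamma a b g = +oo].

Definition poincare11 mu (CP tauP : R) : Prop :=
  forall (x0 : T) (r : R), (0 < r)%R ->
  forall u g, L1loc mu u -> upper_gradient g u ->
    let B := ball x0 r in
    mean mu B (fun x => `|u x - mean mu B u|) <=
      (CP * r)%:E * mean mu (ball x0 (tauP * r)%R) g.

Definition fractional_integrand mu (theta : R) u (x y : T) : \bar R :=
  if x == y then 0
  else `|u x - u y| /
       ((mdist x y `^ theta)%:E * mu (ball x (mdist x y))).

End metric_measure_space.

(* Main.v *)
(* Write F(u) for the double integral and F(E) for that of the indicator of E.
   Integration over levels turns F(u) into the integral of F({u > t}) dt, while the
   L^q norm of the part of u above a median is at most four times the integral of
   mu({u > t})^(1/q) dt; so it suffices to bound sets by their energy F(E).

   In a ball B of radius rho, smoothing E at a scale s <= rho and applying the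
   (1,1)-Poincare inequality bounds min(mu(B meet E), mu(B minus E)) by the energy of
   E for the kernel (rho / s) 1_{d(x,y) < 12 s} / mu(B(x,s)). Adding up about
   1 / (1 - theta) dyadic scales s yields the fractional kernel and the factor 1 - theta.

   If E fills at most half of B, every point of E selects the first dyadic radius at
   which E has substantial density. In the selected ball neither E nor its complement
   is small, so the volume of that ball is bounded by the energy near it. A Vitali
   selection, the lower mass bound and the subadditivity of t -> t^(1 - theta / Q),
   where 1 - theta / Q <= 1 / q, add these local bounds up. *)
Require Import Defs.
From HB Require Import structures.
From mathcomp Require Import all_boot all_order all_algebra.
From mathcomp Require Import all_classical all_reals all_analysis.
From mathcomp Require Import measurable_realfun.
From mathcomp Require Import ring lra.

Set Implicit Arguments.
Unset Strict Implicit.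
Unset Printing Implicit Defensive.

Import Order.TTheory GRing.Theory Num.Theory.
Import numFieldNormedType.Exports.

Local Open Scope classical_set_scope.
Local Open Scope ring_scope.


(** * Arc-length parametrization of rectifiable curves *)

Section curve_length_theory.
Context {R : realType} {T : metricType R}.
Implicit Types (gamma : R -> T) (a b c x y t : R) (s : seq R).

Lemma chord_sum_cons gamma a b y s :
  chord_sum gamma a b (y :: s) =
  mdist (gamma a) (gamma y) + chord_sum gamma y b s.
Proof.
by rewrite /chord_sum /= big_nat_recl.
Qed.

Lemma chord_sum_nil gamma a b : chord_sum gamma a b [::] = 0.
Proof. by rewrite /chord_sum big_nat_cond big_pred0. Qed.

Lemma itv_partition_cons a b y s :
  itv_partition a b (y :: s) <-> a < y /\ itv_partition y b s.
Proof.
rewrite /itv_partition /=; split; first by move=> [/andP[-> ->] ->].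
by move=> [-> [-> ->]].
Qed.

Lemma itv_partition_leq a b s : itv_partition a b s -> a <= b.
Proof.
elim: s a => [|y s IH] a; first by move=> [_ /= /eqP ->].
by move=> /itv_partition_cons[ay /IH]; apply: le_trans; exact: ltW.
Qed.

Lemma chord_sum_cat gamma a b c s1 s2 : itv_partition a c s1 ->
  chord_sum gamma a b (s1 ++ s2) =
  chord_sum gamma a c s1 + chord_sum gamma c b s2.
Proof.
elim: s1 a => [|y s1 IH] a; first by move=> [_ /= /eqP ->]; rewrite chord_sum_nil add0r.
move=> /itv_partition_cons[ay ys] /=.
by rewrite !chord_sum_cons (IH y)// addrA.
Qed.

Lemma chord_le_length gamma a b : a <= b ->
  ((mdist (gamma a) (gamma b))%:E <= curve_length gamma a b)%E.
Proof.
rewrite le_eqVlt => /predU1P[->|ab].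
  apply: ereal_sup_ubound; exists [::]; first by split => /=.
  by rewrite chord_sum_nil mdistxx.
apply: ereal_sup_ubound; exists [:: b].
  by split => /=; rewrite ?ab.
by rewrite chord_sum_cons chord_sum_nil addr0.
Qed.

Lemma curve_length_ge0 gamma a b : a <= b -> (0 <= curve_length gamma a b)%E.
Proof.
by move=> ab; apply: le_trans (chord_le_length gamma ab); rewrite lee_fin mdist_ge0.
Qed.

Lemma curve_length_xx gamma a : curve_length gamma a a = 0%E.
Proof.
apply/eqP; rewrite eq_le curve_length_ge0// andbT.
apply: ge_ereal_sup => _ [[|y s]] /= + <-; first by rewrite chord_sum_nil.
by move=> /itv_partition_cons[ay /itv_partition_leq ya]; move: (lt_le_trans ay ya); rewrite ltxx.
Qed.

Lemma curve_length_ge_cat gamma a b c : a <= c -> c <= b ->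
  (curve_length gamma a c + curve_length gamma c b <= curve_length gamma a b)%E.
Proof.
move=> ac cb.
have fin s x y : ((chord_sum gamma x y s)%:E != -oo)%E by [].
have step s : itv_partition a c s ->
    ((chord_sum gamma a c s)%:E + curve_length gamma c b <= curve_length gamma a b)%E.
  move=> acs; rewrite addeC -leeBrDr//; apply: ge_ereal_sup => _ [s2 cbs2 <-].
  rewrite leeBrDr// -EFinD addrC -chord_sum_cat//.
  apply: ereal_sup_ubound; exists (s ++ s2) => //.
  case: acs => p1 /eqP l1; case: cbs2 => p2 l2.
  by split; rewrite ?cat_path ?last_cat l1 ?p1.
have [cbfin|] := boolP (curve_length gamma c b \is a fin_num).
  rewrite -leeBrDr//; apply: ge_ereal_sup => _ [s acs <-].
  by rewrite leeBrDr// step.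
rewrite ge0_fin_numE ?curve_length_ge0// -leNgt leye_eq => /eqP cboo.
move: (ac); rewrite le_eqVlt => /predU1P[->|ac'].
  by rewrite curve_length_xx add0e.
have := step [:: c]; rewrite cboo addey// leye_eq => /(_ _)/eqP -> //; rewrite ?leey//.
by split; rewrite /= ?ac'.
Qed.

Lemma curve_length_le_cat gamma a b c : a <= c -> c <= b ->
  (curve_length gamma a b <= curve_length gamma a c + curve_length gamma c b)%E.
Proof.
move=> ac cb; apply: ge_ereal_sup => _ [s + <-].
elim: s a ac => [|y s IH] a ac.
  by move=> _; rewrite chord_sum_nil adde_ge0 ?curve_length_ge0.
move=> /itv_partition_cons[ay yb]; rewrite chord_sum_cons EFinD.
have [yc|cy] := leP y c.
  apply: le_trans (leeD2r _ (curve_length_ge_cat gamma (ltW ay) yc)).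
  by rewrite -addeA; apply: leeD (IH _ yc yb); exact/chord_le_length/ltW.
have yb' := itv_partition_leq yb.
apply: le_trans (leeD2l _ (curve_length_ge_cat gamma (ltW cy) yb')).
rewrite addeA; apply: leeD; last by apply: ereal_sup_ubound; exists s.
apply: le_trans (leeD (chord_le_length gamma ac) (chord_le_length gamma (ltW cy))).
by rewrite -EFinD lee_fin metric_triangle.
Qed.

Lemma curve_lengthD gamma a b c : a <= c -> c <= b ->
  (curve_length gamma a b = curve_length gamma a c + curve_length gamma c b)%E.
Proof.
by move=> ac cb; apply/eqP; rewrite eq_le curve_length_le_cat// curve_length_ge_cat.
Qed.

Lemma curve_length_le gamma a b c : a <= c -> c <= b ->
  (curve_length gamma a c <= curve_length gamma a b)%E.
Proof.
by move=> ac cb; rewrite (curve_lengthD gamma ac cb) leeDl// curve_length_ge0.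
Qed.

Lemma chord_sum_last gamma a x s : a < x -> itv_partition a x s ->
  exists2 p, a <= p < x &
    ((chord_sum gamma a x s)%:E <=
     curve_length gamma a p + (mdist (gamma p) (gamma x))%:E)%E.
Proof.
elim: s a => [|y s IH] a ax; first by move=> [_ /= /eqP ax']; rewrite ax' ltxx in ax.
move=> /itv_partition_cons[ay yx]; rewrite chord_sum_cons EFinD.
have := itv_partition_leq yx; rewrite le_eqVlt => /predU1P[yx'|yx'].
  exists a; first by rewrite lexx.
  rewrite curve_length_xx add0e yx'; move: yx; rewrite yx'.
  case: s {IH} => [|z s]; first by rewrite chord_sum_nil adde0.
  move=> /itv_partition_cons[xz /itv_partition_leq zx].
  by move: (lt_le_trans xz zx); rewrite ltxx.
have [p /andP[yp px] H] := IH _ yx' yx; exists p.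
  by rewrite px (le_trans (ltW ay)).
apply: (le_trans (leeD2l _ H)).
rewrite addeA leeD2r// (curve_lengthD gamma (ltW ay) yp) leeD2r//.
exact/chord_le_length/ltW.
Qed.

Lemma within_itv_continuousP gamma a b : {within `[a, b], continuous gamma} ->
  forall x, a <= x <= b -> forall e, 0 < e -> exists2 dl, 0 < dl &
    forall y, a <= y <= b -> `|x - y| < dl -> mdist (gamma x) (gamma y) < e.
Proof.
move=> /subspace_continuousP gc x xab e e0.
have /gc : `[a, b]%classic x by rewrite /= in_itv.
move=> /(_ (ball (gamma x) e)); rewrite /= => H.
have : nbhs (gamma x) (ball (gamma x) e) by exact: nbhsx_ballx.
move=> /H; rewrite /nbhs /= => -[dl /= dl0 sub].
exists dl => // y yab xy; have := sub y xy.
by rewrite ballEmdist /= in_itv /= yab; exact.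
Qed.

Lemma curve_length_left_lsc gamma a b x t :
  {within `[a, b], continuous gamma} -> a < x -> x <= b ->
  (forall y, a <= y < x -> (curve_length gamma a y <= t%:E)%E) ->
  (curve_length gamma a x <= t%:E)%E.
Proof.
move=> gc ax xb H; apply: ge_ereal_sup => _ [s /(chord_sum_last gamma ax)[p /andP[ap px] Hp] <-].
apply: (le_trans Hp).
apply/lee_addgt0Pr => e e0.
have xab : a <= x <= b by rewrite (ltW ax).
have [dl dl0 Hd] := within_itv_continuousP gc xab e0.
pose y := Num.max p (x - dl / 2).
have yx : y < x by rewrite gt_max px /=; lra.
have py : p <= y by rewrite le_max lexx.
have ydl : x - dl / 2 <= y by rewrite le_max lexx orbT.
have ay : a <= y by exact: le_trans py.
have /Hd -/(_ _) xy : a <= y <= b by rewrite ay (le_trans (ltW yx)).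
have {}xy : mdist (gamma x) (gamma y) < e.
  by apply: xy; rewrite ger0_norm ?subr_ge0 ?(ltW yx)//; lra.
apply: (@le_trans _ _ (curve_length gamma a p + (mdist (gamma p) (gamma y))%:E + e%:E)%E).
  rewrite -addeA leeD2l// -EFinD lee_fin.
  apply: (le_trans (metric_triangle _ (gamma y) _)).
  by rewrite lerD2l metric_sym ltW.
rewrite leeD2r//; apply: le_trans (H y _); last by rewrite ay.
by rewrite (curve_lengthD gamma ap py) leeD2l// chord_le_length.
Qed.

Lemma curve_length_right_lsc gamma a b x t :
  {within `[a, b], continuous gamma} -> a <= x -> x < b ->
  (forall y, x < y <= b -> (curve_length gamma y b <= t%:E)%E) ->
  (curve_length gamma x b <= t%:E)%E.
Proof.
move=> gc ax xb H; apply: ge_ereal_sup => _ [[|p s]] + <-.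
  by move=> [_ /= /eqP xb']; rewrite xb' ltxx in xb.
move=> /itv_partition_cons[xp pb]; rewrite chord_sum_cons.
have pb' := itv_partition_leq pb.
apply: (@le_trans _ _ ((mdist (gamma x) (gamma p))%:E + curve_length gamma p b)%E).
  by rewrite EFinD leeD2l//; apply: ereal_sup_ubound; exists s.
apply/lee_addgt0Pr => e e0.
have xab : a <= x <= b by rewrite ax ltW.
have [dl dl0 Hd] := within_itv_continuousP gc xab e0.
pose y := Num.min p (x + dl / 2).
have yx : x < y by rewrite lt_min xp /=; lra.
have py : y <= p by rewrite ge_min lexx.
have ydl : y <= x + dl / 2 by rewrite ge_min lexx orbT.
have yb : y <= b by exact: le_trans pb'.
have /Hd -/(_ _) xy : a <= y <= b by rewrite yb (le_trans ax (ltW yx)).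
have {}xy : mdist (gamma x) (gamma y) < e.
  by apply: xy; rewrite distrC ger0_norm ?subr_ge0 ?(ltW yx)//; lra.
apply: (@le_trans _ _ (((mdist (gamma y) (gamma p))%:E + curve_length gamma p b) + e%:E)%E).
  rewrite [leRHS]addeAC leeD2r// -EFinD lee_fin addrC.
  apply: (le_trans (metric_triangle _ (gamma y) _)).
  by rewrite lerD2r ltW.
rewrite leeD2r//; apply: le_trans (H y _); last by rewrite yx.
by rewrite (curve_lengthD gamma py pb') leeD2r// chord_le_length.
Qed.

Lemma curve_length_IVT gamma a b t : rectifiable_curve gamma a b ->
  0 <= t -> (t%:E <= curve_length gamma a b)%E ->
  exists2 x, a <= x <= b & curve_length gamma a x = t%:E.
Proof.
move=> [ab gc len] t0 tlen.
pose S := [set x | a <= x <= b /\ (curve_length gamma a x <= t%:E)%E].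
have Sa : S a by split; rewrite ?lexx// curve_length_xx lee_fin.
have Sb : ubound S b by move=> x [/andP[]].
have supS : has_sup S by split; [exists a|exists b].
pose x := sup S.
have ax : a <= x by apply: ub_le_sup => //; exists b.
have xb : x <= b by apply: ge_sup => //; exists a.
have Hx : (curve_length gamma a x <= t%:E)%E.
  have [->|ax'] := eqVneq x a; first by rewrite curve_length_xx lee_fin.
  have {}ax' : a < x by rewrite lt_neqAle eq_sym ax' ax.
  apply: (curve_length_left_lsc gc ax' xb) => y /andP[ay yx].
  have [z [/andP[az zb] zt] yz] := sup_gt (proj1 supS) yx.
  by apply: le_trans zt; apply: curve_length_le => //; exact: ltW.
exists x; first by rewrite ax.
apply/eqP; rewrite eq_le Hx /=.
have [->//|xb'] := eqVneq x b.
have {xb'}xb : x < b by rewrite lt_neqAle xb' xb.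
pose L := fine (curve_length gamma a b).
have LE : curve_length gamma a b = L%:E.
  by rewrite fineK// ge0_fin_numE// curve_length_ge0.
have : (curve_length gamma x b <= (L - t)%:E)%E.
  apply: (curve_length_right_lsc gc ax xb) => y /andP[xy yb].
  have ay : a <= y by rewrite (le_trans ax)// ltW.
  have : (t%:E < curve_length gamma a y)%E.
    rewrite ltNge; apply/negP => yt.
    have : y <= x by apply: ub_le_sup; [exists b|split; rewrite // ay].
    by rewrite leNgt xy.
  have := curve_lengthD gamma ay yb; rewrite LE.
  have : (curve_length gamma a y < +oo)%E by apply: le_lt_trans len; exact: curve_length_le.
  have : (curve_length gamma y b < +oo)%E.
    by apply: le_lt_trans len; rewrite (curve_lengthD gamma ay yb) leeDr// curve_length_ge0.
  have := curve_length_ge0 gamma ay; have := curve_length_ge0 gamma yb.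
  case: (curve_length gamma y b) => // p _; case: (curve_length gamma a y) => // q _ _ _.
  by rewrite -EFinD => -[?]; rewrite lte_fin lee_fin => ?; lra.
have := curve_lengthD gamma ax (ltW xb); rewrite LE.
have := curve_length_ge0 gamma ax; have := curve_length_ge0 gamma (ltW xb).
move: Hx; case: (curve_length gamma x b) => // p; rewrite ?leye_eq//; case: (curve_length gamma a x) => // q.
by rewrite -EFinD !lee_fin => ? ? ? [?] ?; lra.
Qed.

Lemma arclength_paramP gamma a b t : rectifiable_curve gamma a b ->
  t \in `[0, fine (curve_length gamma a b)] ->
  exists x, [/\ a <= x, x <= b, curve_length gamma a x = t%:E
                & arclength_param gamma a b t = gamma x].
Proof.
move=> rc; rewrite in_itv /= => /andP[t0 tL].
have [ab _ len] := rc.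
have [|x xab xt] := curve_length_IVT rc t0.
  by rewrite -[leRHS]fineK ?lee_fin// ge0_fin_numE// curve_length_ge0.
rewrite /arclength_param; set A := [set _ | _].
have [] : A (xget a A) by apply: (@xgetI _ a A x); split => //; rewrite in_itv.
rewrite in_itv /= => /andP[? ?] ?; by exists (xget a A).
Qed.

Lemma arclength_param_lip gamma a b (s t : R) : rectifiable_curve gamma a b ->
  s \in `[0, fine (curve_length gamma a b)] ->
  t \in `[0, fine (curve_length gamma a b)] ->
  mdist (arclength_param gamma a b s) (arclength_param gamma a b t) <= `|s - t|.
Proof.
move=> rc sL tL.
wlog : s t sL tL / s <= t.
  move=> H; have [st|ts] := leP s t; first exact: H.
  by rewrite metric_sym distrC H// ltW.
move=> st; rewrite distrC (ger0_norm (_ : 0 <= t - s)) ?subr_ge0//.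
have [x [ax xb xs ->]] := arclength_paramP rc sL.
have [y [ay yb yt ->]] := arclength_paramP rc tL.
have [xy|yx] := leP x y.
  rewrite -lee_fin; apply: (le_trans (chord_le_length gamma xy)).
  have := curve_lengthD gamma ax xy; rewrite xs yt.
  have := curve_length_ge0 gamma xy.
  by case: (curve_length gamma x y) => // p _; rewrite -EFinD => -[?]; rewrite lee_fin; lra.
rewrite metric_sym -lee_fin; apply: (le_trans (chord_le_length gamma (ltW yx))).
have := curve_lengthD gamma ay (ltW yx); rewrite xs yt.
have := curve_length_ge0 gamma (ltW yx).
by case: (curve_length gamma y x) => // p; rewrite -EFinD lee_fin => p0 [?]; rewrite lee_fin; lra.
Qed.

Lemma arclength_param0 gamma a b : rectifiable_curve gamma a b ->
  arclength_param gamma a b 0 = gamma a.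
Proof.
move=> rc; have [ab _ len] := rc.
have [|x [ax xb x0 ->]] := @arclength_paramP gamma a b 0 rc.
  by rewrite in_itv /= lexx fine_ge0// curve_length_ge0.
apply/esym/mdist_positivity/eqP; rewrite eq_le mdist_ge0 andbT.
by rewrite -lee_fin (le_trans (chord_le_length gamma ax))// x0.
Qed.

Lemma arclength_paramL gamma a b : rectifiable_curve gamma a b ->
  arclength_param gamma a b (fine (curve_length gamma a b)) = gamma b.
Proof.
move=> rc; have [ab _ len] := rc.
have fin : curve_length gamma a b \is a fin_num.
  by rewrite ge0_fin_numE// curve_length_ge0.
have [|x [ax xb xL ->]] := @arclength_paramP gamma a b (fine (curve_length gamma a b)) rc.
  by rewrite in_itv /= lexx fine_ge0// curve_length_ge0.
apply/mdist_positivity/eqP; rewrite eq_le mdist_ge0 andbT.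
rewrite -lee_fin (le_trans (chord_le_length gamma xb))//.
have := curve_lengthD gamma ax xb; rewrite xL fineK//.
have := curve_length_ge0 gamma xb; move: fin.
by case: (curve_length gamma a b) => // p _; case: (curve_length gamma x b) => // q; rewrite -EFinD lee_fin => q0 [?]; rewrite lee_fin; lra.
Qed.

End curve_length_theory.

Section nonmeasurable_monotonicity.
Local Open Scope ereal_scope.

(* The integral of a nonnegative function is a supremum over the simple functions
   below it, so monotonicity needs no measurability. *)
Lemma ge0_le_integral_nomeas d (T : measurableType d) (R : realType)
    (m : {measure set T -> \bar R}) (D : set T) (f g : T -> \bar R) :
  (forall x, D x -> 0 <= f x) -> (forall x, D x -> f x <= g x) ->
  \int[m]_(x in D) f x <= \int[m]_(x in D) g x.
Proof.
move=> f0 fg; have g0 x : D x -> 0 <= g x by move=> Dx; exact: le_trans (f0 _ Dx) (fg _ Dx).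
rewrite !ge0_integralE//.
apply: le_ereal_sup => _ [h hf <-]; exists h => // x.
apply: (le_trans (hf x)); rewrite /patch; case: ifPn => // /[1!inE]; exact: fg.
Qed.

End nonmeasurable_monotonicity.

Section upper_gradient_criterion.
Context {R : realType} {T : completeMetricType R}.

Lemma line_integral_ge (gamma : R -> T) (a b s : R) (u : T -> R) (g : T -> \bar R) :
  rectifiable_curve gamma a b -> 0 < s -> (forall x, 0 <= g x)%E ->
  (forall x y, mdist x y < s -> (`|u x - u y|%:E <= (mdist x y)%:E * g x)%E) ->
  (`|u (gamma b) - u (gamma a)|%:E <= line_integral gamma a b g)%E.
Proof.
move=> rc s0 g0 ug; have [ab _ len] := rc.
set L := fine (curve_length gamma a b).
have L0 : 0 <= L by rewrite fine_ge0// curve_length_ge0.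
rewrite -(arclength_param0 rc) -(arclength_paramL rc) -/L /line_integral -/L.
set p := arclength_param gamma a b.
have [L00|Lneq] := eqVneq L 0.
  by rewrite L00 subrr normr0 integral_ge0.
have {Lneq} Lgt0 : 0 < L by rewrite lt_neqAle eq_sym Lneq.
have plip x y : 0 <= x <= L -> 0 <= y <= L -> mdist (p x) (p y) <= `|x - y|.
  by move=> xL yL; apply: arclength_param_lip; rewrite // in_itv.
pose n := (Num.truncn (L / s)).+1.
have n0 : 0 < n%:R :> R by rewrite ltr0n.
pose dl := L / n%:R.
have dl0 : 0 < dl by rewrite divr_gt0.
have dls : dl < s.
  rewrite ltr_pdivrMr// mulrC -ltr_pdivrMr//.
  by have /andP[] := truncn_itv (divr_ge0 L0 (ltW s0)).
have dlL : n%:R * dl = L by rewrite mulrC divfK// gt_eqF.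
pose t i := i%:R * dl.
have tS i : t i.+1 = t i + dl by rewrite /t -natr1 mulrDl mul1r.
have t0 i : 0 <= t i by rewrite mulr_ge0// ltW.
have tle i j : (i <= j)%N -> t i <= t j by move=> ij; rewrite ler_wpM2r ?ler_nat// ltW.
have tL i : (i <= n)%N -> t i <= L by move=> ?; rewrite -dlL; exact: tle.
pose k i := `|u (p (t i.+1)) - u (p (t i))|.
have kg i x : (i < n)%N -> t i <= x < t i.+1 -> ((k i / dl)%:E <= g (p x))%E.
  move=> ilt /andP[tx xt].
  have ti : 0 <= t i <= L by rewrite t0 tL// ltnW.
  have ti1 : 0 <= t i.+1 <= L by rewrite t0 tL.
  have x0 : 0 <= x <= L by rewrite (le_trans (t0 i))//= (le_trans (ltW xt))// tL.
  have [gx|] := boolP (g (p x) \is a fin_num); last first.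
    by rewrite ge0_fin_numE// -leNgt leye_eq => /eqP ->; rewrite leey.
  rewrite -(fineK gx) lee_fin ler_pdivrMr//.
  have d1 : mdist (p x) (p (t i.+1)) <= t i.+1 - x.
    by apply: (le_trans (plip _ _ x0 ti1)); rewrite distrC ger0_norm// subr_ge0 ltW.
  have d2 : mdist (p x) (p (t i)) <= x - t i.
    by apply: (le_trans (plip _ _ x0 ti)); rewrite ger0_norm// subr_ge0.
  have := ug (p x) (p (t i.+1)); have := ug (p x) (p (t i)).
  have S1 : t i.+1 - x < s by rewrite tS in xt *; lra.
  have S2 : x - t i < s by rewrite tS in xt; lra.
  move=> /(_ (le_lt_trans d2 S2)) + /(_ (le_lt_trans d1 S1)).
  rewrite -(fineK gx) -!EFinM !lee_fin => u2 u1.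
  have gx0 : 0 <= fine (g (p x)) by rewrite fine_ge0.
  have : k i <= `|u (p x) - u (p (t i.+1))| + `|u (p x) - u (p (t i))|.
    rewrite /k (_ : u (p (t i.+1)) - u (p (t i)) =
      - (u (p x) - u (p (t i.+1))) + (u (p x) - u (p (t i)))); last by ring.
    by rewrite (le_trans (ler_normD _ _))// normrN.
  move=> /le_trans; apply; apply: (le_trans (lerD u1 u2)).
  rewrite -mulrDl mulrC ler_wpM2l//.
  by rewrite (le_trans (lerD d1 d2))// tS; lra.
pose I i := `[t i, t i.+1[%classic.
have mI i : measurable (I i : set (measurableTypeR R)) by exact: measurable_itv.
apply: (@le_trans _ _ (\int[@lebesgue_measure R]_(x in `[0%R, L])
    (\sum_(0 <= i < n) ((k i / dl)%:E * (\1_(I i) x)%:E)))%E); last first.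
  apply: ge0_le_integral_nomeas => x.
    by move=> _; apply: sume_ge0 => i _; rewrite -EFinM lee_fin mulr_ge0 ?divr_ge0 ?(ltW dl0) ?normr_ge0// indicE.
  rewrite /= in_itv /= => /andP[x0 xL].
  have [[j [jn Ij]]|nI] := pselect (exists j, (j < n)%N /\ I j x); last first.
    rewrite big_nat big1 ?g0// => i /andP[_ ilt].
    by rewrite indicE memNset ?mule0// => Ii; apply: nI; exists i.
  rewrite big_mkord (bigD1 (Ordinal jn))//= big1 ?adde0; last first.
    move=> i /eqP ij; rewrite indicE memNset ?mule0//.
    move: Ij; rewrite /I /= !in_itv /= => /andP[jx xj] /andP[ix xi].
    case: (ltnP i j) => [ltij|]; first by have := tle _ _ ltij; lra.
    rewrite leq_eqVlt => /orP[/eqP ji|ltji]; last by have := tle _ _ ltji; lra.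
    by apply: ij; apply/val_inj.
  have Ijx : t j <= x < t j.+1 by move: Ij; rewrite /I /= in_itv.
  rewrite indicE mem_set// mule1; exact: kg.
rewrite ge0_integral_sum//; last 2 first.
- move=> i; apply/measurable_EFinP; apply: measurable_funM; first exact: measurable_cst.
  exact: measurable_indic.
- by move=> i x _; rewrite -EFinM lee_fin mulr_ge0 ?divr_ge0 ?(ltW dl0) ?normr_ge0// indicE.
have intI i : (i < n)%N -> (\int[@lebesgue_measure R]_(x in `[0%R, L])
    ((k i / dl)%:E * (\1_(I i) x)%:E) = (k i)%:E)%E.
  move=> ilt; rewrite ge0_integralZl//; last 2 first.
  - by apply/measurable_EFinP/measurable_indic.
  - by rewrite lee_fin divr_ge0 ?(ltW dl0) ?normr_ge0.
  rewrite integral_indic// setIidl; last first.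
    move=> x; rewrite /I /= !in_itv /= => /andP[tx xt].
    by rewrite (le_trans (t0 i))//= (le_trans (ltW xt))// tL.
  rewrite [X in (_ * X)%E](_ : _ = dl%:E); last first.
    transitivity (lebesgue_measure (I i)) => //.
    rewrite /I lebesgue_measure_itv /= lte_fin tS ltrDl dl0 -EFinB.
    by rewrite addrAC subrr add0r.
  by rewrite -EFinM divfK// gt_eqF.
rewrite (eq_big_nat _ _ (F2 := fun i => (k i)%:E)); last by move=> i /andP[_]; exact: intI.
rewrite sumEFin lee_fin.
have -> : u (p L) - u (p 0) = \sum_(0 <= j < n) (u (p (t j.+1)) - u (p (t j))).
  by rewrite (telescope_sumr (fun j => u (p (t j))))// /t dlL mul0r.
exact: ler_norm_sum.
Qed.

Lemma upper_gradient_of_local (s : R) (u : T -> R) (g : T -> \bar R) :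
  0 < s -> borel_fun g -> (forall x, 0 <= g x)%E ->
  (forall x y, mdist x y < s -> (`|u x - u y|%:E <= (mdist x y)%:E * g x)%E) ->
  upper_gradient g (EFin \o u).
Proof.
move=> s0 bg g0 ug; split => // gamma a b rc _ /=.
exact: (line_integral_ge rc s0 g0 ug).
Qed.

End upper_gradient_criterion.

(** * Volumes, packing and compactness in doubling spaces *)

Lemma open_ball_metric (R : realType) (T : metricType R) (x : T) (s : R) : open (ball x s).
Proof.
rewrite openE => y; rewrite ballEmdist /= => xy.
rewrite /interior -nbhs_ballE; exists (s - mdist x y); first by rewrite /= subr_gt0.
move=> z; rewrite !ballEmdist /= => yz.
by apply: (le_lt_trans (metric_triangle _ y _)); rewrite addrC -ltrBrDr.
Qed.

Section doubling_basics.
Context {R : realType} {T : completeMetricType R}.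
Variables (mu : {outer_measure set T -> \bar R}) (c : R).
Hypotheses (hreg : borel_regular mu) (hdbl : doubling mu c).

Definition vol (x : T) (s : R) : R := fine (mu (ball x s)).

Lemma borel_open (U : set T) : open U -> borel_set U.
Proof. by move=> oU; exact: sub_gen_smallest. Qed.

Lemma open_cara (U : set T) : open U -> mu.-cara.-measurable U.
Proof. by move=> oU; apply: hreg.1; exact: borel_open. Qed.

Lemma ball_cara x s : mu.-cara.-measurable (ball x s).
Proof. exact/open_cara/open_ball_metric. Qed.

Lemma ball_lty x s : (mu (ball x s) < +oo)%E.
Proof.
have [s0|s0] := ltP 0 s.
  have s20 : 0 < s / 2 by rewrite divr_gt0.
  have [+ + +] := hdbl x s20.
  rewrite mulrC divfK// => _ H fin; exact: le_lt_trans H fin.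
rewrite (_ : ball x s = set0) ?outer_measure0 ?ltry//.
rewrite -subset0 => y; rewrite ballEmdist /= => xy.
by have := le_lt_trans (mdist_ge0 x y) xy; rewrite ltNge s0.
Qed.

Lemma ball_fin x s : mu (ball x s) \is a fin_num.
Proof. by rewrite ge0_fin_numE ?ball_lty// outer_measure_ge0. Qed.

Lemma volE x s : mu (ball x s) = (vol x s)%:E.
Proof. by rewrite fineK// ball_fin. Qed.

Lemma vol_ge0 x s : 0 <= vol x s.
Proof. by rewrite fine_ge0// outer_measure_ge0. Qed.

Lemma vol_gt0 x s : 0 < s -> 0 < vol x s.
Proof.
move=> s0; rewrite -lte_fin -volE.
have s20 : 0 < s / 2 by rewrite divr_gt0.
have [+ _ _] := hdbl x s20.
by rewrite mulrC divfK.
Qed.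

Lemma vol_double x s : 0 < s -> vol x (2 * s) <= c * vol x s.
Proof.
by move=> s0; have [_ + _] := hdbl x s0; rewrite !volE -EFinM lee_fin.
Qed.

Lemma doubling_ge0 (x : T) : 0 <= c.
Proof.
have := vol_double x ltr01; have := vol_gt0 x ltr01.
have := vol_gt0 x (mulr_gt0 (ltr0n R 2) (@ltr01 R)) => v2 v1 H.
by rewrite -(pmulr_lge0 _ v1) (le_trans _ H)// ltW.
Qed.

Lemma fine_mu_le (A B : set T) : A `<=` B -> (mu B < +oo)%E -> fine (mu A) <= fine (mu B).
Proof.
move=> AB Boo; have AleB := le_outer_measure mu _ _ AB.
by apply: fine_le => //; rewrite ge0_fin_numE ?outer_measure_ge0// (le_lt_trans AleB).
Qed.

Lemma subset_ball_lty A x s : A `<=` ball x s -> (mu A < +oo)%E.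
Proof. by move=> AB; apply: (le_lt_trans (le_outer_measure mu _ _ AB)); exact: ball_lty. Qed.

Lemma ball_subset (x y : T) (s t : R) : (mdist x y : R) + s <= t -> ball y s `<=` ball x t.
Proof.
move=> H z; rewrite !ballEmdist /= => yz.
by apply: (le_lt_trans (metric_triangle _ y _)); apply: lt_le_trans H; rewrite ltrD2l.
Qed.

Lemma vol_le (x y : T) (s t : R) : (mdist x y : R) + s <= t -> vol y s <= vol x t.
Proof. by move=> H; apply: fine_mu_le (ball_lty _ _); exact: ball_subset. Qed.

Lemma vol_double_iter x s n : 0 < s -> vol x (2 ^+ n * s) <= c ^+ n * vol x s.
Proof.
move=> s0; elim: n => [|n IH]; first by rewrite !expr0 !mul1r.
rewrite !exprS -!mulrA (le_trans (vol_double _ _))// ?mulr_gt0 ?exprn_gt0//.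
by rewrite ler_wpM2l// (doubling_ge0 x).
Qed.

Lemma vol_compare n x y s t : 0 < s -> (mdist x y : R) + t <= 2 ^+ n * s ->
  vol y t <= c ^+ n * vol x s.
Proof. by move=> s0 H; apply: (le_trans (vol_le H)); exact: vol_double_iter. Qed.

End doubling_basics.

Arguments vol {R T} mu x s.

Section disjoint_balls.
Context {R : realType} {T : completeMetricType R}.
Variables (mu : {outer_measure set T -> \bar R}) (c : R).
Hypotheses (hreg : borel_regular mu) (hdbl : doubling mu c).

Definition disjoint_rel (I : eqType) (F : I -> set T) : rel I :=
  fun i j => `[< F i `&` F j = set0 >].

Lemma pairwise_disjoint_indic (I : eqType) (F : I -> set T) (A : set T) (s : seq I) x :
  pairwise (disjoint_rel F) s -> (forall i, i \in s -> F i `<=` A) ->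
  \sum_(i <- s) (\1_(F i) x : R) <= \1_A x.
Proof.
elim: s => [|i s IH]; first by rewrite big_nil indicE.
rewrite /= big_cons => /andP[/allP dis pw] sub.
have {}IH : \sum_(j <- s) (\1_(F j) x : R) <= \1_A x.
  by apply: IH => // j js; apply: sub; rewrite inE js orbT.
have [Fx|nFx] := pselect (F i x); last by rewrite indicE memNset// add0r.
rewrite big_seq big1 ?addr0; last first.
  move=> j js; rewrite indicE memNset// => Fjx.
  by have /asboolP := dis j js; rewrite -subset0 => /(_ x); apply.
by rewrite !indicE !mem_set//; apply: (sub i) => //; rewrite mem_head.
Qed.

Lemma pairwise_disjoint_measure (I : eqType) (F : I -> set T) (A : set T) (s : seq I) :
  (forall i, mu.-cara.-measurable (F i)) -> mu.-cara.-measurable A ->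
  pairwise (disjoint_rel F) s -> (forall i, i \in s -> F i `<=` A) ->
  (\sum_(i <- s) mu (F i) <= mu A)%E.
Proof.
move=> mF mA pw sub.
pose m : {measure set (caratheodory_type mu) -> \bar R} := mu.
have E (B : set (caratheodory_type mu)) : measurable B -> mu B = (\int[m]_x (\1_B x)%:E)%E.
  by move=> mB; rewrite integral_indic// setIT.
rewrite E// (eq_bigr (fun i => \int[m]_x (\1_(F i) x)%:E)%E); last by move=> i _; exact: E.
rewrite -ge0_integral_sum//.
  apply: ge0_le_integral_nomeas => x _.
    by apply: sume_ge0 => i _; rewrite lee_fin indicE.
  by rewrite sumEFin lee_fin; exact: pairwise_disjoint_indic.
by move=> i; apply/measurable_EFinP; exact: measurable_indic.
Qed.

End disjoint_balls.

Section packing.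
Context {R : realType} {T : completeMetricType R}.
Variables (mu : {outer_measure set T -> \bar R}) (c : R).
Hypotheses (hreg : borel_regular mu) (hdbl : doubling mu c).

Lemma exists_exp2_ge (K : R) : exists n : nat, K <= 2 ^+ n.
Proof.
exists (Num.truncn K).+1.
have [K0|K0] := leP 0 K; last by rewrite (le_trans (ltW K0))// exprn_ge0.
have /andP[_ /ltW/le_trans] := truncn_itv K0; apply.
by rewrite -natrX ler_nat ltnW// ltn_expl.
Qed.

Lemma packing_bound (z : T) (r rho : R) : 0 < rho -> exists N : nat,
  forall (rad : T -> R) (s : seq T),
  (forall x, x \in s -> rho <= rad x) ->
  (forall x, x \in s -> ball x (rad x) `<=` ball z r) ->
  pairwise (disjoint_rel (fun x => ball x (rad x))) s -> (size s <= N)%N.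
Proof.
move=> rho0; have [n nP] := exists_exp2_ge ((r + r) / rho).
exists (Num.truncn (c ^+ n)) => rad s srho ssub pw.
have rle : r + r <= 2 ^+ n * rho by rewrite -ler_pdivrMr.
have cn0 : 0 <= c ^+ n by rewrite exprn_ge0// (doubling_ge0 hdbl z).
case: s srho ssub pw => [//|x0 s0]; set s := x0 :: s0 => srho ssub pw.
have dz x : x \in s -> mdist z x < r.
  move=> xs; have : ball x (rad x) x.
    by apply: ballxx; apply: lt_le_trans (srho x xs).
  by move/ssub => /(_ xs); rewrite ballEmdist.
have r0 : 0 < r by apply: le_lt_trans (dz x0 (mem_head _ _)); rewrite mdist_ge0.
have vz := vol_gt0 hdbl z r0.
have vx x : x \in s -> vol mu z r <= c ^+ n * vol mu x (rad x).
  move=> xs; have xz : mdist x z + r <= 2 ^+ n * rho.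
    by apply: le_trans rle; rewrite lerD2r metric_sym ltW// dz.
  apply: (le_trans (vol_compare hdbl rho0 xz)); rewrite ler_wpM2l//; apply: (vol_le hdbl); rewrite mdistxx add0r; exact: srho.
have := pairwise_disjoint_measure (fun x => ball_cara hreg x (rad x)) (ball_cara hreg z r) pw ssub.
under eq_bigr do rewrite (volE hdbl).
rewrite (volE hdbl) sumEFin lee_fin => sumle.
rewrite truncn_ge_nat// -(ler_pM2r vz).
apply: le_trans (ler_wpM2l cn0 sumle).
rewrite mulr_sumr (big_nth x0) big_mkord.
rewrite -[X in X%:R]card_ord mulr_natl -sumr_const; apply: ler_sum => i _.
by apply: vx; rewrite mem_nth.
Qed.

Lemma maximal_seq (I : Type) (P : seq I -> Prop) (N : nat) :
  P [::] -> (forall s, P s -> (size s <= N)%N) ->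
  exists s, P s /\ forall x, ~ P (x :: s).
Proof.
move=> P0 PN; apply: contrapT => H.
have ext n : exists s, P s /\ size s = n.
  elim: n => [|n [s [Ps sn]]]; first by exists [::].
  apply: contrapT => H'; apply: H; exists s; split => // x Px.
  by apply: H'; exists (x :: s); split => //=; rewrite sn.
by have [s [/PN + sN]] := ext N.+1; rewrite sN ltnn.
Qed.

Lemma ball_meet (x y : T) (s t : R) : ball x s `&` ball y t !=set0 -> mdist x y < s + t.
Proof.
move=> [p [/=]]; rewrite !ballEmdist /= => xp yp.
apply: (le_lt_trans (metric_triangle _ p _)).
by rewrite ltrD// metric_sym.
Qed.

Lemma finite_ball_cover (z : T) (r s : R) : 0 < s ->
  exists w : seq T, ball z r `<=` [set y | exists2 x, x \in w & ball x s y].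
Proof.
move=> s0; pose F (x : T) := ball x (s / 2).
have s20 : 0 < s / 2 by rewrite divr_gt0.
have [N HN] := packing_bound z (r + s) s20.
pose P w := pairwise (disjoint_rel F) w /\ forall x, x \in w -> ball z r x.
have [||w [[pw wz] wmax]] := @maximal_seq _ P N.
- by split.
- move=> w [pw wz]; apply: (HN (fun=> s / 2)) => // x /wz.
  rewrite ballEmdist /= => zx; apply: ball_subset; lra.
exists w => y zy; apply: contrapT => nex; apply: (wmax y); split; last first.
  by move=> x; rewrite inE => /predU1P[->//|/wz].
rewrite /= pw andbT; apply/allP => x xw; apply/asboolP; rewrite -subset0 => p [yp xp].
apply: nex; exists x => //; rewrite ballEmdist /=.
have : mdist x y < s / 2 + s / 2 by apply: ball_meet; exists p.
by rewrite -splitr.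
Qed.

Lemma compact_closure_ball (z : T) (r : R) : compact (closure (ball z r)).
Proof.
rewrite compact_ultra => F UF FB.
have Fc : cauchy F.
  apply: cauchy_exP => e e0.
  have [w wcov] := finite_ball_cover z (r + 1) e0.
  have : F [set y | exists2 x, x \in w & ball x e y].
    apply: filterS FB; apply: subset_trans wcov.
    move=> y /(_ (ball y 1) (nbhsx_ballx _ _ ltr01))[p [zp yp]].
    by apply: (ball_triangle zp); exact: ball_sym.
  elim: w {wcov} => [|x w IH].
    move=> H; exfalso; apply: (@filter_not_empty _ F _).
    by apply: filterS H => y [].
  move=> H; have [Fx|Fx] := in_ultra_setVsetC (ball x e) UF; first by exists x.
  apply: IH; apply: filterS (filterI H Fx) => y [[x']].
  by rewrite inE => /predU1P[->//|x'w] xy _; exists x'.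
have /cauchy_cvg Fcvg := Fc.
exists (lim F); split => //.
by apply: closed_closure => B /Fcvg FBn; exact: filter_ex (filterI FB FBn).
Qed.

Lemma compact_subset_ball (z : T) (K : set T) : compact K -> exists r, K `<=` ball z r.
Proof.
rewrite compact_cover => cK.
have [|x Kx|D _ Dcov] := cK nat [set: nat] (fun n => ball z n%:R).
- by move=> n _; exact: open_ball_metric.
- exists (Num.truncn (mdist z x)).+1 => //; rewrite ballEmdist /=.
  by have /andP[] := truncn_itv (mdist_ge0 z x).
exists (\sum_(n <- finmap.enum_fset D) n%:R) => x /Dcov[n /= nD].
rewrite !ballEmdist /= => /lt_le_trans; apply.
rewrite (big_rem n)//= lerDl; exact: sumr_ge0.
Qed.

(* Balls are selected level by level, so that a discarded ball meets a selected
   one of at least its own radius. *)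
Lemma vitali_levels (z : T) (r : R) (S : set T) (lev : T -> nat) (f : nat -> R) (J : nat) :
  (forall n, 0 < f n) -> {homo f : m n / (m <= n)%N >-> n <= m} ->
  (forall x, S x -> ball x (f (lev x)) `<=` ball z r) ->
  exists w : seq T, [/\ forall x, x \in w -> S x,
    pairwise (disjoint_rel (fun x => ball x (f (lev x)))) w &
    forall x, S x -> (lev x < J)%N ->
      exists2 y, y \in w & ball y (2 * f (lev y)) x].
Proof.
move=> f0 fle Sz.
pose F x := ball x (f (lev x)).
suff [w [wS wlev pw wmeet]] : exists w : seq T, [/\ forall x, x \in w -> S x,
    forall x, x \in w -> (lev x < J)%N, pairwise (disjoint_rel F) w &
    forall x, S x -> (lev x < J)%N ->
      exists2 y, y \in w & (lev y <= lev x)%N /\ F y `&` F x !=set0].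
  exists w; split => // x Sx xJ; have [y yw [yx meet]] := wmeet x Sx xJ.
  exists y => //; rewrite ballEmdist /=; apply: (lt_le_trans (ball_meet meet)).
  by rewrite mulr2n mulrDl mul1r lerD2l fle.
elim: J => [|J [w [wS wlev pw wmeet]]]; first by exists [::].
have [N HN] := packing_bound z r (f0 J).
pose P w' := pairwise (disjoint_rel F) (w' ++ w) /\
  forall x, x \in w' -> S x /\ lev x = J.
have [||w' [[pw' w'S] wmax]] := @maximal_seq _ P N.
- by split.
- move=> w' [pw' w'S]; apply: leq_trans (HN _ (w' ++ w) _ _ pw').
  + by rewrite size_cat leq_addr.
  + move=> x; rewrite mem_cat => /orP[/w'S[_ ->]//|/wlev xJ]; exact/fle/ltnW.
  + by move=> x; rewrite mem_cat => /orP[/w'S[/Sz]//|/wS/Sz].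
have mS x : x \in w' ++ w -> S x /\ (lev x <= J)%N.
  by rewrite mem_cat => /orP[/w'S[? ->]//|xw]; split; [exact: wS|exact/ltnW/wlev].
exists (w' ++ w); split => //.
- by move=> x /mS[].
- by move=> x /mS[]; rewrite ltnS.
move=> x Sx; rewrite ltnS leq_eqVlt => /orP[/eqP xJ|/(wmeet x Sx)[y yw H]]; last first.
  by exists y; rewrite // mem_cat yw orbT.
apply: contrapT => nex; apply: (wmax x); split; last first.
  by move=> y; rewrite inE => /predU1P[->//|/w'S].
rewrite /= pw' andbT; apply/allP => y yw; apply/asboolP.
apply/eqP/negP => /negP/set0P[p [xp yp]]; apply: nex; exists y => //.
by split; [rewrite xJ; have [] := mS y yw|exists p].
Qed.

End packing.

(** * Joint measurability and Tonelli *)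

Section sigma_finite_copy.
Context {d} {T : measurableType d} {R : realType}.
Variables (m : {measure set T -> \bar R}) (sm : sigma_finite setT m).

(* Tonelli's theorem wants sigma-finiteness as a canonical instance; the alias
   turns the hypothesis sm into one. *)
Definition sigma_finite_copy & sigma_finite setT m : set T -> \bar R := m.

Let copy := sigma_finite_copy sm.

Let copy0 : copy set0 = 0%E. Proof. exact: measure0. Qed.

Let copy_ge0 A : (0 <= copy A)%E. Proof. exact: measure_ge0. Qed.

Let copy_sigma_additive : semi_sigma_additive copy.
Proof. exact: measure_semi_sigma_additive. Qed.

HB.instance Definition _ := isMeasure.Build _ _ _ copy
  copy0 copy_ge0 copy_sigma_additive.

HB.instance Definition _ := Measure_isSigmaFinite.Build _ _ _ copy sm.

End sigma_finite_copy.

Section tonelli.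
Local Open Scope ereal_scope.
Context {d1 d2} {T1 : measurableType d1} {T2 : measurableType d2} {R : realType}.
Variables (m1 : {measure set T1 -> \bar R}) (m2 : {measure set T2 -> \bar R}).
Hypotheses (s1 : sigma_finite setT m1) (s2 : sigma_finite setT m2).
Variable f : T1 * T2 -> \bar R.
Hypotheses (mf : measurable_fun setT f) (f0 : forall z, 0 <= f z).

Lemma measurable_integral_section2 :
  measurable_fun setT (fun x => \int[m2]_y f (x, y)).
Proof.
pose m2' : {sigma_finite_measure set T2 -> \bar R} := sigma_finite_copy s2.
exact: (@measurable_fun_fubini_tonelli_F _ _ _ _ _ m2').
Qed.

Lemma tonelli_swap : \int[m1]_x \int[m2]_y f (x, y) = \int[m2]_y \int[m1]_x f (x, y).
Proof.
pose m1' : {sigma_finite_measure set T1 -> \bar R} := sigma_finite_copy s1.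
pose m2' : {sigma_finite_measure set T2 -> \bar R} := sigma_finite_copy s2.
exact: (@fubini_tonelli _ _ _ _ _ m1' m2').
Qed.

End tonelli.

Lemma measurable_superlevel d (T : measurableType d) (R : realType) (f : T -> R) :
  (forall a, measurable [set x | a < f x]) -> measurable_fun setT f.
Proof.
move=> H; apply: (measurability _ (RGenOInfty.measurableE R)) => //.
by move=> /= _ [_ [a ->] <-]; rewrite preimage_itvoy setTI.
Qed.

Section mms_measurability.
Context {R : realType} {T : completeMetricType R}.
Variables (mu : {outer_measure set T -> \bar R}) (c : R).
Hypotheses (hreg : borel_regular mu) (hdbl : doubling mu c).

Lemma sigma_finite_cara : sigma_finite setT (mu : set (caratheodory_type mu) -> \bar R).
Proof.
exists (fun n => ball (point : T) n%:R).
  apply/esym; rewrite -subTset => x _; exists (Num.truncn (mdist point x)).+1 => //.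
  by rewrite ballEmdist /=; have /andP[] := truncn_itv (mdist_ge0 (point : T) x).
by move=> n; split; [exact: (ball_cara hreg)|exact: (ball_lty hdbl)].
Qed.

Lemma open_prod_cara (O : set (T * T)) : open O ->
  measurable (O : set (caratheodory_type mu * caratheodory_type mu)).
Proof.
move=> oO; pose z : T := point.
pose e (n : nat) : R := n.+1%:R^-1.
have e0 n : 0 < e n by rewrite invr_gt0.
have /choice[w wcov] : forall n, exists w : seq T,
    ball z n%:R `<=` [set y | exists2 x, x \in w & ball x (e n) y].
  by move=> n; exact: (finite_ball_cover hreg hdbl z n%:R (e0 n)).
pose P n i j := ball (nth z (w n) i) (e n) `*` ball (nth z (w n) j) (e n).
pose A n i j := if `[< P n i j `<=` O >] then P n i j else set0.
rewrite (_ : O = \bigcup_n \bigcup_i \bigcup_j A n i j).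
  apply: bigcup_measurable => n _; apply: bigcup_measurable => i _.
  apply: bigcup_measurable => j _; rewrite /A; case: ifP => // _.
  by apply: measurableX; exact: (ball_cara hreg).
apply/seteqP; split=> [[x y] Oxy|p [n _ [i _ [j _]]]]; last first.
  by rewrite /A; case: ifPn => // /asboolP; exact.
have : nbhs (x, y) O by exact: open_nbhs_nbhs.
move=> [[U V] /= [Ux Vy] UVO].
move: Ux Vy; rewrite -!nbhs_ballE => -[r1 /= r10 xU] [r2 /= r20 yV].
pose r := Num.min r1 r2; have r0 : 0 < r by rewrite lt_min r10.
pose n := maxn (Num.truncn (2 / r)) (maxn (Num.truncn (mdist z x)).+1 (Num.truncn (mdist z y)).+1).
have en : 2 * e n < r.
  have H : 2 / r < n.+1%:R.
    have /andP[_ /lt_le_trans] := truncn_itv (ltW (divr_gt0 (ltr0n R 2) r0)); apply.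
    by rewrite ler_nat ltnS leq_maxl.
  by rewrite ltr_pdivrMr// mulrC -ltr_pdivrMr.
have zx : ball z n%:R x.
  rewrite ballEmdist /=.
  have /andP[_ /lt_le_trans] := truncn_itv (mdist_ge0 z x); apply.
  by rewrite ler_nat /n !leq_max leqnn orbT.
have zy : ball z n%:R y.
  rewrite ballEmdist /=.
  have /andP[_ /lt_le_trans] := truncn_itv (mdist_ge0 z y); apply.
  by rewrite ler_nat /n !leq_max leqnn !orbT.
have [a aw xa] := wcov n x zx; have [b bw yb] := wcov n y zy.
exists n => //; exists (index a (w n)) => //; exists (index b (w n)) => //.
have PE : P n (index a (w n)) (index b (w n)) = ball a (e n) `*` ball b (e n).
  by rewrite /P !nth_index.
rewrite /A PE; case: ifPn => [_|/asboolP]; first by split.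
case=> -[x' y'] [/= ax' by']; apply: UVO; split => /=.
- apply: xU => /=; apply: (@le_ball _ _ _ (e n + e n)).
    by rewrite -mulr2n -mulr_natl (le_trans (ltW en))// /r ge_min lexx.
  by apply: ball_triangle ax'; exact: ball_sym.
- apply: yV => /=; apply: (@le_ball _ _ _ (e n + e n)).
    by rewrite -mulr2n -mulr_natl (le_trans (ltW en))// /r ge_min lexx orbT.
  by apply: ball_triangle by'; exact: ball_sym.
Qed.

Lemma mu_inter_ball_lsc (A : set T) x s a : mu.-cara.-measurable A ->
  a < fine (mu (A `&` ball x s)) ->
  exists2 e, 0 < e & a < fine (mu (A `&` ball x (s - e))).
Proof.
move=> mA; pose F (n : nat) := A `&` ball x (s - n.+1%:R^-1).
have fin s' : mu (A `&` ball x s') \is a fin_num.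
  rewrite ge0_fin_numE ?outer_measure_ge0//.
  by apply: (subset_ball_lty hdbl); exact: subIsetr.
have mF n : mu.-cara.-measurable (F n).
  by apply: measurableI => //; exact: (ball_cara hreg).
have FE : \bigcup_n F n = A `&` ball x s.
  apply/seteqP; split => y.
    move=> [n _ [Ay]]; rewrite !ballEmdist /= => xy; split => //=.
    by rewrite (lt_le_trans xy)// gerBl invr_ge0.
  rewrite ballEmdist /= => -[Ay /= xy].
  exists (Num.truncn (s - mdist x y)^-1) => //; split => //=.
  rewrite ballEmdist /=.
  have sxy : 0 < s - mdist x y by rewrite subr_gt0.
  have i0 : 0 < (s - mdist x y)^-1 by rewrite invr_gt0.
  have /andP[_ H] := truncn_itv (ltW i0).
  by rewrite ltrBrDr addrC -ltrBrDr -[ltRHS]invrK ltf_pV2 ?posrE.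
have ndF : nondecreasing_seq F.
  move=> n k nk; apply/subsetPset => y [Ay]; rewrite ballEmdist /= => xy; split => //.
  rewrite ballEmdist /= (lt_le_trans xy)// lerD2l lerN2 lef_pV2 ?posrE//.
  by rewrite ler_nat.
pose m : {measure set (caratheodory_type mu) -> \bar R} := mu.
have cvgF : m \o F @ \oo --> m (\bigcup_n F n).
  apply: nondecreasing_cvg_mu => //; rewrite FE.
  by apply: measurableI => //; exact: (ball_cara hreg).
move=> alt; apply: contrapT => nex.
have : (mu (A `&` ball x s) <= a%:E)%E.
  rewrite -FE -(cvg_lim _ cvgF)//; apply: lime_le; first by apply/cvg_ex; eexists; exact: cvgF.
  apply: nearW => n /=; rewrite leNgt; apply/negP => aF; apply: nex.
  exists n.+1%:R^-1; first by rewrite invr_gt0.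
  by rewrite -lte_fin fineK.
by rewrite leNgt -[X in (_ < X)%E]fineK// lte_fin alt.
Qed.

Lemma measurable_mu_inter_ball (A : set T) (s : R) : mu.-cara.-measurable A ->
  @measurable_fun _ _ (caratheodory_type mu) R setT (fun x => fine (mu (A `&` ball x s))).
Proof.
move=> mA; apply: measurable_superlevel => a; apply: (open_cara hreg).
rewrite openE => x /= /(mu_inter_ball_lsc mA)[e e0 ae].
rewrite /interior -nbhs_ballE; exists e => // y; rewrite ballEmdist /= => xy.
apply: (lt_le_trans ae); apply: (fine_mu_le) => [p [Ap]|].
  rewrite ballEmdist /= => xp; split => //; rewrite ballEmdist /=.
  by apply: (le_lt_trans (metric_triangle _ x _)); rewrite metric_sym; lra.
by apply: (subset_ball_lty hdbl); exact: subIsetr.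
Qed.

(* It is 0 on the diagonal: the ball of radius 0 is empty and 0^-1 = 0. *)
Definition frac_kernel (theta : R) (x y : T) : R :=
  (mdist x y `^ theta * vol mu x (mdist x y))^-1.

Lemma frac_kernel_ge0 theta x y : 0 <= frac_kernel theta x y.
Proof. by rewrite invr_ge0 mulr_ge0 ?powR_ge0// vol_ge0. Qed.

Let Tc2 : measurableType _ := (caratheodory_type mu * caratheodory_type mu)%type.

Lemma measurable_mdist : @measurable_fun _ _ Tc2 R setT (fun p => mdist (p.1 : T) p.2).
Proof.
apply: measurable_superlevel => a; apply: (@open_prod_cara [set p | a < mdist p.1 p.2]).
rewrite openE => -[x y] /= xy.
have e0 : 0 < (mdist x y - a) / 2 by rewrite divr_gt0// subr_gt0.
exists (ball x ((mdist x y - a) / 2), ball y ((mdist x y - a) / 2)) => /=.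
  by split; exact: nbhsx_ballx.
move=> -[x' y'] [/=]; rewrite !ballEmdist /= => xx' yy'.
have := metric_triangle x x' y; have := metric_triangle x' y' y.
by rewrite (metric_sym y' y); lra.
Qed.

Lemma measurable_vol_mdist :
  @measurable_fun _ _ Tc2 R setT (fun p => vol mu (p.1 : T) (mdist (p.1 : T) p.2)).
Proof.
apply: measurable_superlevel => a.
apply: (@open_prod_cara [set p | a < vol mu p.1 (mdist p.1 p.2)]).
rewrite openE => -[x y] /=; rewrite /vol -(setTI (ball _ _)).
move=> /(mu_inter_ball_lsc (measurableT : mu.-cara.-measurable setT))[e e0 ae].
have e30 : 0 < e / 3 by rewrite divr_gt0.
exists (ball x (e / 3), ball y (e / 3)) => /=; first by split; exact: nbhsx_ballx.
move=> -[x' y'] [/= + +].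
rewrite (ballEmdist x) (ballEmdist y) /= => xx' yy'.
apply: (lt_le_trans ae); rewrite setTI; apply: (vol_le hdbl) => /=; rewrite (metric_sym x' x).
have := metric_triangle x x' y; have := metric_triangle x' y' y.
by rewrite (metric_sym y' y); lra.
Qed.

Lemma measurable_frac_kernel theta :
  @measurable_fun _ _ Tc2 R setT (fun p => frac_kernel theta p.1 p.2).
Proof.
pose h (p : Tc2) := mdist (p.1 : T) p.2 `^ theta * vol mu (p.1 : T) (mdist (p.1 : T) p.2).
rewrite (_ : (fun p => _) = (@powR R ^~ (-1)) \o h); last first.
  by apply/funext => p /=; rewrite powR_inv1// mulr_ge0 ?powR_ge0// vol_ge0.
apply: measurableT_comp; first exact: measurable_powR.
apply: measurable_funM; last exact: measurable_vol_mdist.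
exact: (measurableT_comp (measurable_powR theta) measurable_mdist).
Qed.

Lemma fractional_integrandE theta u (x y : T) :
  fractional_integrand mu theta u x y =
  (`|u x - u y| * (frac_kernel theta x y)%:E)%E.
Proof.
rewrite /fractional_integrand /frac_kernel; case: eqVneq => [->|xy].
  by rewrite mdistxx /vol (_ : ball y 0 = set0) ?outer_measure0 ?mulr0 ?invr0 ?mule0//
    -subset0 => z; rewrite ballEmdist /= ltNge mdist_ge0.
have d0 : 0 < mdist x y by rewrite mdist_gt0.
rewrite (volE hdbl) -EFinM inver gt_eqF// mulr_gt0 ?powR_gt0//.
exact: (vol_gt0 hdbl).
Qed.

End mms_measurability.

(** * Coarea *)

Section coarea.
Local Open Scope ereal_scope.
Context {R : realType}.
Let leb : {measure set (measurableTypeR R) -> \bar R} := @lebesgue_measure R.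

Definition cut {T : Type} (E : set T) (x y : T) : R := `|\1_E x - \1_E y|%R.

Lemma cut_ge0 T (E : set T) x y : (0 <= cut E x y)%R.
Proof. exact: normr_ge0. Qed.

Lemma cut_sym T (E : set T) x y : cut E x y = cut E y x.
Proof. by rewrite /cut distrC. Qed.

Lemma cut_in T (E : set T) x y : E x -> ~ E y -> cut E x y = 1%R.
Proof. by move=> Ex Ey; rewrite /cut !indicE mem_set// memNset// subr0 normr1. Qed.

Definition superlevel {T : Type} (u : T -> \bar R) (t : R) : set T :=
  [set x | t%:E < u x].

Lemma abse_distC (a b : \bar R) : `|a - b| = `|b - a|.
Proof. by case: a b => [a||] [b||] //=; rewrite distrC. Qed.

Lemma level_integral_le T (u : T -> \bar R) x y :
  \int[leb]_t (cut (superlevel u t) x y)%:E <= `|u x - u y|.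
Proof.
wlog xy : x y / u x <= u y.
  move=> H; have [/H//|/ltW/H] := leP (u x) (u y).
  by rewrite abse_distC; under eq_integral do rewrite cut_sym.
have [uxy|/eqP uxy] := eqVneq (u x) (u y).
  rewrite integral0_eq// => t _; rewrite /cut !indicE.
  rewrite (_ : (x \in superlevel u t) = (y \in superlevel u t)) ?subrr ?normr0//.
  by apply/idP/idP => /[!inE]; rewrite /superlevel /= uxy.
case: (leP +oo `|u x - u y|) => [|fin]; first by rewrite leye_eq => /eqP ->; rewrite leey.
have [a ax] : exists a, u x = a%:E.
  move: fin uxy xy; case: (u x) => [a||]; first by exists a.
    by rewrite leye_eq => _ /[swap] /eqP ->.
  by case: (u y).
have [b bx] : exists b, u y = b%:E.
  by move: fin uxy xy; rewrite ax; case: (u y) => [b||]//; exists b.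
rewrite ax bx lee_fin in xy; rewrite ax bx.
apply: (@le_trans _ _ (\int[leb]_t (\1_(`[a, b[%classic) t)%:E)).
  apply: ge0_le_integral_nomeas => t _; first by rewrite lee_fin cut_ge0.
  have inx : (x \in superlevel u t) = (t < a)%R.
    by apply/idP/idP => [/[!inE]|ta]; rewrite ?inE /superlevel /= ax lte_fin.
  have iny : (y \in superlevel u t) = (t < b)%R.
    by apply/idP/idP => [/[!inE]|tb]; rewrite ?inE /superlevel /= bx lte_fin.
  rewrite lee_fin /cut !indicE inx iny.
  rewrite (_ : (t \in `[a, b[%classic) = (a <= t < b)%R); last first.
    by apply/idP/idP => [/[!inE]|tab]; rewrite ?inE /= in_itv.
  have [tb|bt] := ltP t b; have [ta|at_] := ltP t a; rewrite /= ?subrr ?subr0 ?sub0r ?normrN ?normr1 ?normr0//.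
  by move: (le_lt_trans bt ta); rewrite ltNge xy.
rewrite integral_indic ?setIT//.
have -> : leb `[a, b[%classic = lebesgue_measure (`[a, b[%classic : set R) by [].
rewrite lebesgue_measure_itv /= lte_fin; case: ifPn => _; rewrite lee_fin ?normr_ge0//.
by rewrite distrC ler_norm.
Qed.

Context d (T : measurableType d) (m : {measure set T -> \bar R}).
Hypothesis sm : sigma_finite setT m.
Variables (w : T * T -> R) (u : T -> \bar R).
Hypotheses (mw : measurable_fun setT w) (w0 : forall z, (0 <= w z)%R).
Hypothesis mu_ : measurable_fun setT u.

Let R' : measurableType _ := measurableTypeR R.

Let mlevel : measurable [set z : T * R' | z.2%:E < u z.1].
Proof.
rewrite -[X in measurable X]setTI; apply: measurable_lte => //.
  by apply/measurable_EFinP; exact: measurable_snd.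
exact: (measurableT_comp mu_ measurable_fst).
Qed.

Lemma measurable_superlevel_set t : measurable (superlevel u t).
Proof.
by rewrite -[X in measurable X]setTI; apply: emeasurable_fun_o_infty.
Qed.

Lemma measurable_cut (E : set T) : measurable E ->
  measurable_fun setT (fun z : T * T => cut E z.1 z.2).
Proof.
move=> mE; have mi : measurable_fun setT (\1_E : T -> R) by exact: measurable_indic.
rewrite /cut; apply: measurableT_comp => //; apply: measurable_funB.
  exact: (measurableT_comp mi measurable_fst).
exact: (measurableT_comp mi measurable_snd).
Qed.

Let f (z : (T * R') * T) : \bar R :=
  (w (z.1.1, z.2) * cut (superlevel u z.1.2) z.1.1 z.2)%:E.

Let mf : measurable_fun setT f.
Proof.
apply/measurable_EFinP; apply: measurable_funM.
  apply: (measurableT_comp mw); apply/measurable_fun_pairP; split => /=.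
    exact: (measurableT_comp measurable_fst measurable_fst).
  exact: measurable_snd.
pose F := [set z : T * R' | z.2%:E < u z.1].
rewrite (_ : (fun z => _) = (fun z : (T * R') * T => `|\1_F z.1 - \1_F (z.2, z.1.2)|%R)); last first.
  by apply/funext => -[[x t] y]; rewrite /cut !indicE.
have mi : measurable_fun setT (\1_F : T * R' -> R) by exact: measurable_indic.
apply: measurableT_comp => //; apply: measurable_funB.
  exact: (measurableT_comp mi measurable_fst).
apply: (measurableT_comp mi).
apply/measurable_fun_pairP; split => /=; first exact: measurable_snd.
exact: (measurableT_comp measurable_snd measurable_fst).
Qed.

Let f0 z : 0 <= f z. Proof. by rewrite lee_fin mulr_ge0// cut_ge0. Qed.

Let sleb : sigma_finite setT leb. Proof. exact: sigma_finiteT. Qed.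

Let g (z : T * R') := \int[m]_y f (z, y).

Let mg : measurable_fun setT g.
Proof. exact: measurable_integral_section2. Qed.

Let g0 z : 0 <= g z. Proof. exact: integral_ge0. Qed.

Lemma measurable_level_energy :
  measurable_fun (setT : set R') (fun t => \int[m]_x \int[m]_y (w (x, y) * cut (superlevel u t) x y)%:E).
Proof.
have := @measurable_integral_section2 _ _ R' T _ m sm (fun z => g (z.2, z.1)).
apply => [|z]; last exact: g0.
apply: (measurableT_comp mg); apply/measurable_fun_pairP.
by split; [exact: measurable_snd|exact: measurable_fst].
Qed.

Lemma coarea_le :
  \int[leb]_t \int[m]_x \int[m]_y (w (x, y) * cut (superlevel u t) x y)%:E <=
  \int[m]_x \int[m]_y (`|u x - u y| * (w (x, y))%:E).
Proof.
have -> : \int[leb]_t \int[m]_x \int[m]_y (w (x, y) * cut (superlevel u t) x y)%:E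
    = \int[m]_x \int[leb]_t g (x, t).
  by rewrite (@tonelli_swap _ _ _ _ _ m leb sm sleb g).
apply: ge0_le_integral_nomeas => x _; first by apply: integral_ge0 => t _; exact: g0.
have mfx : measurable_fun setT (fun z : R' * T => f ((x, z.1), z.2)).
  apply: (measurableT_comp mf); apply/measurable_fun_pairP; split => /=; last exact: measurable_snd.
  by apply/measurable_fun_pairP; split => /=; [exact: measurable_cst|exact: measurable_fst].
rewrite (@tonelli_swap _ _ R' T _ leb m sleb sm (fun z => f ((x, z.1), z.2)))//.
apply: ge0_le_integral_nomeas => y _; first exact: integral_ge0.
rewrite /f /=; under eq_integral do rewrite EFinM.
rewrite ge0_integralZl//.
- rewrite muleC; apply: lee_wpmul2r; first by rewrite lee_fin.
  exact: level_integral_le.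
- apply/measurable_EFinP.
  pose F := [set z : T * R' | z.2%:E < u z.1].
  have mi : measurable_fun setT (\1_F : T * R' -> R) by exact: measurable_indic.
  have msec z : measurable_fun setT (fun t : R' => \1_F (z, t) : R).
    apply: (measurableT_comp mi); apply/measurable_fun_pairP.
    by split; [exact: measurable_cst|exact: measurable_id].
  rewrite (_ : (fun t => _) = (fun t : R' => `|\1_F (x, t) - \1_F (y, t)|%R)); last first.
    by apply/funext => t; rewrite /cut !indicE.
  by apply: measurableT_comp => //; exact: measurable_funB (msec x) (msec y).
- by move=> t _; rewrite lee_fin cut_ge0.
- by rewrite lee_fin.
Qed.

End coarea.

(** * Smoothing a set at a fixed scale *)

Section simple_masses.
Context {R : realType} {T : completeMetricType R}.
Variables (mu : {outer_measure set T -> \bar R}) (c : R).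
Hypotheses (hreg : borel_regular mu) (hdbl : doubling mu c).

Let Tc : measurableType _ := caratheodory_type mu.
Let m : {measure set Tc -> \bar R} := mu.

Definition mass (A : set T) : R := fine (mu A).

Definition finite_set_mu (A : set T) : Prop :=
  mu.-cara.-measurable A /\ (mu A < +oo)%E.

Lemma mass_ge0 A : 0 <= mass A.
Proof. by rewrite fine_ge0// outer_measure_ge0. Qed.

Lemma massE A : finite_set_mu A -> mu A = (mass A)%:E.
Proof. by move=> [_ Aoo]; rewrite /mass fineK// ge0_fin_numE// outer_measure_ge0. Qed.

Lemma finite_set_mu_sub A B : mu.-cara.-measurable A -> A `<=` B -> finite_set_mu B ->
  finite_set_mu A.
Proof.
by move=> mA AB [_ Boo]; split => //; apply: le_lt_trans Boo; exact: le_outer_measure.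
Qed.

Lemma finite_set_mu_ball x s : finite_set_mu (ball x s).
Proof. by split; [exact: (ball_cara hreg)|exact: (ball_lty hdbl)]. Qed.

Lemma finite_set_mu_setI A E : finite_set_mu A -> mu.-cara.-measurable E ->
  finite_set_mu (A `&` E).
Proof.
move=> fA mE; apply: (finite_set_mu_sub _ _ fA); last exact: subIsetl.
by apply: measurableI => //; exact: fA.1.
Qed.

Lemma finite_set_mu_setD A E : finite_set_mu A -> mu.-cara.-measurable E ->
  finite_set_mu (A `\` E).
Proof. by move=> fA mE; rewrite setDE; apply: finite_set_mu_setI => //; exact: measurableC. Qed.

Lemma mass_le A B : A `<=` B -> finite_set_mu B -> mass A <= mass B.
Proof. by move=> AB [_ Boo]; exact: fine_mu_le. Qed.

Lemma massID A E : finite_set_mu A -> mu.-cara.-measurable E ->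
  mass A = mass (A `&` E) + mass (A `\` E).
Proof.
move=> fA mE; have fI := finite_set_mu_setI fA mE; have fD := finite_set_mu_setD fA mE.
apply: EFin_inj; rewrite EFinD -(massE fA) -(massE fI) -(massE fD).
have [mA _] := fA; rewrite addeC; exact: (measureDI m mA mE).
Qed.

Lemma measurable_indicT (A : set Tc) : measurable A ->
  measurable_fun setT (\1_A : Tc -> R).
Proof. exact: measurable_indic. Qed.

Lemma integral_indic_sum (I : Type) (s : seq I) (k : I -> R) (A : I -> set T) :
  (forall i, 0 <= k i) -> (forall i, finite_set_mu (A i)) ->
  (\int[m]_x (\sum_(i <- s) k i * \1_(A i) x)%:E)%E = (\sum_(i <- s) k i * mass (A i))%:E.
Proof.
move=> k0 fA; under eq_integral do rewrite -sumEFin.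
rewrite ge0_integral_sum//; last 2 first.
- move=> i; apply/measurable_EFinP; apply: measurable_funM; first exact: measurable_cst.
  by apply: measurable_indicT; exact: (fA i).1.
- by move=> i x _; rewrite lee_fin mulr_ge0// indicE.
rewrite -sumEFin; apply: eq_bigr => i _; under eq_integral do rewrite EFinM.
rewrite ge0_integralZl//; last 2 first.
- by apply/measurable_EFinP; apply: measurable_indicT; exact: (fA i).1.
- by rewrite lee_fin.
by rewrite integral_indic ?setIT ?EFinM -?massE//; exact: (fA i).1.
Qed.

Lemma indic_sum_le (I J : Type) (s : seq I) (k : I -> R) (A : I -> set T)
    (t : seq J) (l : J -> R) (D : J -> set T) :
  (forall i, 0 <= k i) -> (forall i, finite_set_mu (A i)) ->
  (forall i, 0 <= l i) -> (forall i, finite_set_mu (D i)) ->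
  (forall x, \sum_(i <- s) k i * \1_(A i) x <= \sum_(j <- t) l j * \1_(D j) x) ->
  \sum_(i <- s) k i * mass (A i) <= \sum_(j <- t) l j * mass (D j).
Proof.
move=> k0 fA l0 fD H; rewrite -lee_fin -!integral_indic_sum//.
apply: ge0_le_integral_nomeas => x _; rewrite lee_fin//.
by apply: sumr_ge0 => i _; rewrite mulr_ge0// indicE.
Qed.

Section cells.
Variables (n : nat) (A : nat -> set T).
Hypothesis fA : forall i, finite_set_mu (A i).
Hypothesis tA : trivIset setT A.

Lemma cell_indic_eq (k : nat -> R) i x : (i < n)%N -> A i x ->
  \sum_(0 <= j < n) k j * \1_(A j) x = k i.
Proof.
move=> ilt Aix; rewrite big_mkord (bigD1 (Ordinal ilt))//= big1 ?addr0.
  by rewrite indicE mem_set// mulr1.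
move=> j /eqP ji; rewrite indicE memNset ?mulr0// => Ajx.
by apply: ji; apply/val_inj => /=; apply: tA => //; exists x.
Qed.

Lemma cell_indic_eq0 (k : nat -> R) x : (forall i, (i < n)%N -> ~ A i x) ->
  \sum_(0 <= j < n) k j * \1_(A j) x = 0.
Proof.
move=> H; rewrite big_nat big1// => j /andP[_ jn].
by rewrite indicE memNset ?mulr0//; exact: H.
Qed.

Lemma cell_sum_le (k : nat -> R) (D E : set T) : (forall i, 0 <= k i <= 1) ->
  mu.-cara.-measurable E -> finite_set_mu D ->
  (forall i, (i < n)%N -> 0 < k i -> A i `<=` D) ->
  \sum_(0 <= i < n) k i * mass (A i `&` E) <= mass (D `&` E).
Proof.
move=> k01 mE fD kA.
have := @indic_sum_le nat unit (index_iota 0 n) k (fun i => A i `&` E) [:: tt]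
  (fun=> 1) (fun=> D `&` E).
rewrite big_seq1 mul1r; apply => //.
- by move=> i; have /andP[] := k01 i.
- by move=> i; exact: finite_set_mu_setI.
- by move=> _; exact: finite_set_mu_setI.
move=> x; rewrite big_seq1 mul1r.
have [Ex|nEx] := pselect (E x); last first.
  by rewrite [leLHS]big1 ?indicE// => i _; rewrite indicE memNset ?mulr0// => -[].
under eq_bigr do rewrite indicI [X in _ * X]/= [X in _ * (_ * X)]indicE (mem_set Ex) mulr1.
have [[i [ilt Aix]]|nex] := pselect (exists i, (i < n)%N /\ A i x); last first.
  by rewrite cell_indic_eq0 ?indicE// => i ilt Aix; apply: nex; exists i.
rewrite (cell_indic_eq k ilt Aix); have /andP[+ ki1] := k01 i.
rewrite le_eqVlt => /predU1P[<-|ki]; first by rewrite indicE.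
by rewrite indicE mem_set//; split => //; exact: kA ki _ Aix.
Qed.

Lemma cell_sum_ge (k : nat -> R) (D E : set T) : (forall i, 0 <= k i) ->
  mu.-cara.-measurable E -> finite_set_mu D ->
  (forall x, D x -> exists2 i, (i < n)%N & A i x /\ 1 <= k i) ->
  mass (D `&` E) <= \sum_(0 <= i < n) k i * mass (A i `&` E).
Proof.
move=> k0 mE fD DA.
have := @indic_sum_le unit nat [:: tt] (fun=> 1) (fun=> D `&` E) (index_iota 0 n)
  k (fun i => A i `&` E).
rewrite big_seq1 mul1r; apply => //.
- by move=> _; exact: finite_set_mu_setI.
- by move=> i; exact: finite_set_mu_setI.
move=> x; rewrite big_seq1 mul1r.
have [[Dx Ex]|nDx] := pselect ((D `&` E) x); last first.
  by rewrite [leLHS]indicE memNset// sumr_ge0// => i _; rewrite mulr_ge0// indicE.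
have [i ilt [Aix ki]] := DA x Dx.
under eq_bigr do rewrite indicI [X in _ * X]/= [X in _ * (_ * X)]indicE (mem_set Ex) mulr1.
by rewrite (cell_indic_eq k ilt Aix) indicE mem_set.
Qed.

End cells.

End simple_masses.

Lemma clamp_lip (R : realFieldType) (a b : R) :
  `|Num.max 0 (Num.min 1 a) - Num.max 0 (Num.min 1 b)| <= `|a - b|.
Proof.
have H : - `|a - b| <= a - b <= `|a - b| by rewrite -ler_norml.
have := @ler01 R; have := normr_ge0 (a - b); rewrite ler_norml => nab h01.
case: (leP 1 a) => a1; case: (leP 1 b) => b1; rewrite ?(max_r ler01);
  case: (leP 0 a) => a0; case: (leP 0 b) => b0; rewrite ?(max_r ler01);
  move/andP: H => [H1 H2]; lra.
Qed.

Section smoothing.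
Context {R : realType} {T : completeMetricType R}.
Variables (mu : {outer_measure set T -> \bar R}) (c CP P : R).
Hypotheses (hreg : borel_regular mu) (hdbl : doubling mu c).
Hypotheses (c1 : 1 <= c) (CP1 : 1 <= CP) (P1 : 1 <= P).

Local Notation mass := (mass mu).
Local Notation V := (vol mu).

Lemma borel_sub_cara (A : set T) : borel_set A -> mu.-cara.-measurable A.
Proof. exact: hreg.1. Qed.

Lemma exists_cells (z : T) (r s : R) : 0 < s -> exists (n : nat) (x_ : nat -> T) (A : nat -> set T),
  [/\ forall i, borel_set (A i), trivIset setT A,
      forall i, A i `<=` ball (x_ i) s, forall i, A i `<=` ball z r &
      forall y, ball z r y -> exists2 i, (i < n)%N & A i y].
Proof.
move=> s0; have [w wcov] := finite_ball_cover hreg hdbl z r s0.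
pose F i := if (i < size w)%N then ball (nth z w i) s else set0.
have bF i : measurable (F i : set (g_sigma_algebraType (@open T))).
  rewrite /F; case: ifP => _; last exact: measurable0.
  exact: (borel_open (@open_ball_metric R T _ _)).
exists (size w), (nth z w), (fun i => ball z r `&` seqDU F i); split.
- move=> i; rewrite /borel_set.
  have : measurable (ball z r `&` seqDU F i : set (g_sigma_algebraType (@open T))).
    apply: measurableI; first exact: (borel_open (@open_ball_metric R T _ _)).
    by apply: measurableD => //; exact: bigsetU_measurable.
  by [].
- by apply: trivIset_setIl; exact: trivIset_seqDU.
- move=> i y [_] /(@subset_seqDU _ F); rewrite /F; case: ifP => //.
- by move=> i; exact: subIsetl.
move=> y zy; have [x xw xy] := wcov y zy.
have : (\bigcup_i F i) y.
  by exists (index x w) => //; rewrite /F index_mem xw nth_index.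
rewrite seqDU_bigcup_eq => -[i _ iy]; exists i => //.
by move/(@subset_seqDU _ F): iy; rewrite /F; case: ifP.
Qed.

Section fixed_scale.
Variables (E : set T) (z : T) (rho s : R).
Hypotheses (mE : mu.-cara.-measurable E) (s0 : 0 < s) (srho : s <= rho).
Variables (n : nat) (x_ : nat -> T) (A : nat -> set T).
Hypotheses (bA : forall i, borel_set (A i)) (tA : trivIset setT A).
Hypothesis As : forall i, A i `<=` ball (x_ i) s.
Hypothesis Az : forall i, A i `<=` ball z ((P + 2) * rho).
Hypothesis Acov : forall y, ball z ((P + 2) * rho) y -> exists2 i, (i < n)%N & A i y.

Let rho0 : 0 < rho. Proof. exact: lt_le_trans s0 srho. Qed.
Let c0 : 0 < c. Proof. exact: lt_le_trans ltr01 c1. Qed.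
Let P0 : 0 < P. Proof. exact: lt_le_trans ltr01 P1. Qed.

Let fA i : finite_set_mu mu (A i).
Proof.
by apply: (finite_set_mu_sub _ (@Az i) (finite_set_mu_ball hreg hdbl _ _)); exact: borel_sub_cara.
Qed.

Let mEC : mu.-cara.-measurable (~` E). Proof. exact: measurableC. Qed.

Definition bump (i : nat) (x : T) : R := Num.max 0 (Num.min 1 (3 - mdist x (x_ i) / s)).

Lemma bump_01 i x : 0 <= bump i x <= 1.
Proof. by rewrite /bump le_max lexx/= ge_max ler01 ge_min lexx. Qed.

Lemma bump_lip i x y : `|bump i x - bump i y| <= mdist x y / s.
Proof.
have H : `|(3 - mdist x (x_ i) / s) - (3 - mdist y (x_ i) / s)| <= mdist x y / s.
  rewrite (_ : _ - _ = (mdist y (x_ i) - mdist x (x_ i)) / s); last by rewrite mulrBl; have hs0 := s0; lra.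
  rewrite normrM (ger0_norm (_ : 0 <= s^-1)) ?invr_ge0 ?(ltW s0)//.
  rewrite ler_wpM2r ?invr_ge0 ?(ltW s0)// ler_norml.
  have := metric_triangle x y (x_ i); have := metric_triangle y x (x_ i).
  by rewrite (metric_sym y x); have hs0 := s0; lra.
apply: le_trans H; rewrite /bump.
exact: clamp_lip.
Qed.

Lemma bump1 i x : (mdist x (x_ i) : R) <= 2 * s -> bump i x = 1.
Proof.
move=> H; have : mdist x (x_ i) / s <= 2 by rewrite ler_pdivrMr.
move=> H2; rewrite /bump min_l ?max_r//; have hs0 := s0; lra.
Qed.

Lemma bump_gt0 i x : 0 < bump i x -> (mdist x (x_ i) : R) < 3 * s.
Proof.
move=> b0; rewrite ltNge; apply/negP => H; move: b0.
have H2 : 3 <= mdist x (x_ i) / s by rewrite ler_pdivlMr.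
by rewrite /bump max_l ?ltxx// ge_min; apply/orP; right; have hs0 := s0; lra.
Qed.

Definition smooth_mass (F : set T) (x : T) : R :=
  \sum_(0 <= i < n) bump i x * mass (A i `&` F).

Definition near_mass (F : set T) (x : T) : R := mass (ball x (5 * s) `&` F).

Lemma smooth_mass_ge0 F x : 0 <= smooth_mass F x.
Proof.
by apply: sumr_ge0 => i _; rewrite mulr_ge0// ?mass_ge0//; have /andP[] := bump_01 i x.
Qed.

Lemma smooth_mass_le F x : mu.-cara.-measurable F -> smooth_mass F x <= near_mass F x.
Proof.
move=> mF; apply: (cell_sum_le fA tA) => //.
- by move=> i; exact: bump_01.
- exact: (finite_set_mu_ball hreg hdbl).
move=> i ilt /bump_gt0 xi; apply: subset_trans (@As i) _.
by apply: ball_subset; have hs0 := s0; lra.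
Qed.

Lemma smooth_mass_lip_near F x y : mu.-cara.-measurable F -> (mdist x y : R) < s ->
  `|smooth_mass F x - smooth_mass F y| <= mdist x y / s * near_mass F x.
Proof.
move=> mF xy; rewrite /smooth_mass -sumrB.
apply: (le_trans (ler_norm_sum _ _ _)).
pose k i : R := ((mdist x (x_ i) : R) < 4 * s)%R%:R.
have : \sum_(0 <= i < n) k i * mass (A i `&` F) <= near_mass F x.
  apply: (cell_sum_le fA tA) => //.
  - by move=> i; rewrite /k ler0n /=; case: (_ < _); rewrite ?ler01.
  - exact: (finite_set_mu_ball hreg hdbl).
  move=> i ilt; rewrite /k; have [xi _|_] := ltP (mdist x (x_ i) : R) (4 * s); last by rewrite ltxx.
  by apply: subset_trans (@As i) _; apply: ball_subset; have hs0 := s0; lra.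
have ds : 0 <= mdist x y / s by rewrite divr_ge0 ?mdist_ge0// ltW.
move=> /(ler_wpM2l ds); apply: le_trans; rewrite mulr_sumr; apply: ler_sum => i _.
rewrite -mulrBl normrM (ger0_norm (mass_ge0 _ _)) mulrA ler_wpM2r ?mass_ge0//.
rewrite /k; have [_|xi] := ltP (mdist x (x_ i) : R) (4 * s); first by rewrite mulr1 bump_lip.
have bx : bump i x = 0.
  apply/eqP; rewrite eq_le (andP (bump_01 i x)).1 andbT leNgt; apply/negP => /bump_gt0 ?; have hs0 := s0; lra.
have by_ : bump i y = 0.
  apply/eqP; rewrite eq_le (andP (bump_01 i y)).1 andbT leNgt; apply/negP => /bump_gt0 hb0.
  by move: hb0; have := metric_triangle x y (x_ i); have hs0 := s0; lra.
by rewrite bx by_ subrr normr0 mulr0.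
Qed.

Lemma smooth_mass_lip F x y :
  `|smooth_mass F x - smooth_mass F y| <= mdist x y * ((\sum_(0 <= i < n) mass (A i `&` F)) / s).
Proof.
rewrite /smooth_mass -sumrB; apply: (le_trans (ler_norm_sum _ _ _)).
rewrite mulrA mulrAC mulr_sumr; apply: ler_sum => i _.
rewrite -mulrBl normrM (ger0_norm (mass_ge0 _ _)) ler_wpM2r ?mass_ge0//.
exact: bump_lip.
Qed.

Definition smooth_total (x : T) : R := smooth_mass E x + smooth_mass (~` E) x.

(* A locally Lipschitz substitute for \1_E at scale s. Both E and its complement
   enter, which makes its slope controlled by the products
   mu(cell meet E) mu(cell minus E), that is, by an energy of E. *)
Definition smooth_ratio (x : T) : R := smooth_mass E x / smooth_total x.

Lemma vol_le_smooth_total x : (mdist z x : R) + s <= (P + 2) * rho -> V x s <= smooth_total x.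
Proof.
move=> xz; rewrite /V /vol -/(mass (ball x s)) (massID (finite_set_mu_ball hreg hdbl x s) mE).
rewrite setDE; apply: lerD; apply: (cell_sum_ge fA tA) => //;
  (try by move=> i; have /andP[] := bump_01 i x);
  (try exact: (finite_set_mu_ball hreg hdbl));
  move=> y xy; have [i ilt Aiy] := Acov (ball_subset xz xy); exists i => //;
  split => //; rewrite bump1//; move/As: Aiy; move: xy; rewrite !ballEmdist /= => xy iy;
  have := metric_triangle x y (x_ i); rewrite (metric_sym y (x_ i)); have hs0 := s0; lra.
Qed.

Lemma smooth_ratio_01 x : 0 <= smooth_ratio x <= 1.
Proof.
have N0 := smooth_mass_ge0 E x; have M0 := smooth_mass_ge0 (~` E) x.
rewrite /smooth_ratio /smooth_total divr_ge0 ?addr_ge0//=.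
have [->|D0] := eqVneq (smooth_mass E x + smooth_mass (~` E) x) 0; first by rewrite invr0 mulr0.
by rewrite ler_pdivrMr ?mul1r ?lerDl// lt_neqAle eq_sym D0 addr_ge0.
Qed.

Let V_near x y : (mdist x y : R) < s -> V x s <= c * V y s.
Proof.
move=> xy; have := @vol_compare _ _ mu c hdbl 1%N y x s s s0; rewrite !expr1; apply.
by rewrite metric_sym; have hs0 := s0; lra.
Qed.

Lemma smooth_ratio_lip_near x y : ball z (P * rho) x -> (mdist x y : R) < s ->
  `|smooth_ratio x - smooth_ratio y| <=
  mdist x y * (2 * c / s * near_mass E x * near_mass (~` E) x / V x s ^+ 2).
Proof.
rewrite ballEmdist /= => zx xy.
have srho' := srho; have hs0 := s0; have hr0 := rho0.
have Dx : V x s <= smooth_total x.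
  by apply: vol_le_smooth_total; rewrite mulrDl; move: zx srho'; lra.
have Dy : V y s <= smooth_total y.
  apply: vol_le_smooth_total; rewrite mulrDl.
  by have := metric_triangle z x y; move: zx xy srho'; lra.
have Vx0 : 0 < V x s := vol_gt0 hdbl x s0.
have Vy0 : 0 < V y s := vol_gt0 hdbl y s0.
have D0 := lt_le_trans Vx0 Dx; have D'0 := lt_le_trans Vy0 Dy.
have N0 := smooth_mass_ge0 E x; have M0 := smooth_mass_ge0 (~` E) x.
have Nle := smooth_mass_le x mE; have Mle := smooth_mass_le x mEC.
have Nl := smooth_mass_lip_near mE xy; have Ml := smooth_mass_lip_near mEC xy.
rewrite /smooth_ratio; move: D0 D'0 Dx Dy; rewrite /smooth_total.
move: (smooth_mass E x) (smooth_mass (~` E) x) (smooth_mass E y) (smooth_mass (~` E) y)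
  (near_mass E x) (near_mass (~` E) x) N0 M0 Nle Mle Nl Ml => N M N' M' al be
  N0 M0 Nle Mle Nl Ml D0 D'0 Dx Dy.
have al0 : 0 <= al := le_trans N0 Nle; have be0 : 0 <= be := le_trans M0 Mle.
have -> : N / (N + M) - N' / (N' + M') = (N * (M' - M) + M * (N - N')) / ((N + M) * (N' + M')).
  by field; rewrite !gt_eqF.
pose e := mdist x y / s; have e0 : 0 <= e by rewrite divr_ge0 ?mdist_ge0// ltW.
have numle : `|N * (M' - M) + M * (N - N')| <= 2 * e * al * be.
  apply: (le_trans (ler_normD _ _)); rewrite !normrM (ger0_norm N0) (ger0_norm M0).
  have h1 : N * `|M' - M| <= al * (e * be) by rewrite ler_pM// distrC.
  have h2 : M * `|N - N'| <= be * (e * al) by rewrite ler_pM.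
  apply: (le_trans (lerD h1 h2)); rewrite le_eqVlt; apply/orP; left; apply/eqP; ring.
have den : V x s ^+ 2 / c <= (N + M) * (N' + M').
  rewrite expr2 -mulrA ler_pM ?(ltW Vx0)// ?divr_ge0 ?(ltW Vx0) ?(ltW c0)//.
  by apply: le_trans Dy; rewrite ler_pdivrMr// mulrC; exact: V_near.
have den0 : 0 < (N + M) * (N' + M') by rewrite mulr_gt0.
rewrite normrM (ger0_norm (_ : 0 <= _^-1)) ?invr_ge0 ?(ltW den0)//.
rewrite (_ : mdist x y * _ = 2 * e * al * be * (V x s ^+ 2 / c)^-1); last first.
  by rewrite /e; field; rewrite !gt_eqF.
have V2c : 0 < V x s ^+ 2 / c by rewrite divr_gt0 ?exprn_gt0.
rewrite ler_pM// ?invr_ge0 ?(ltW den0)//.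
by rewrite lef_pV2 ?posrE.
Qed.

Definition cell_mass (F : set T) (i : nat) : R := mass (ball (x_ i) (6 * s) `&` F).

Definition cell_slope (i : nat) : R :=
  2 * c ^+ 3 / s * cell_mass E i * cell_mass (~` E) i / V (x_ i) s ^+ 2.

Let near_le_cell F x i : mu.-cara.-measurable F -> A i x -> near_mass F x <= cell_mass F i.
Proof.
move=> mF /As; rewrite ballEmdist /= => xi; apply: mass_le; last first.
  by apply: finite_set_mu_setI => //; exact: (finite_set_mu_ball hreg hdbl).
by apply: setSI; apply: ball_subset; have hs0 := s0; move: xi; lra.
Qed.

Let V_cell x i : A i x -> V (x_ i) s <= c * V x s.
Proof. by move=> /As; rewrite ballEmdist /= => xi; exact: V_near. Qed.

Lemma cell_slope_ge0 i : 0 <= cell_slope i.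
Proof.
have c0' := ltW c0.
by rewrite /cell_slope !mulr_ge0 ?mass_ge0 ?invr_ge0 ?exprn_ge0 ?(ltW s0)// vol_ge0.
Qed.

Lemma smooth_ratio_cell x y i : ball z (P * rho) x -> (mdist x y : R) < s -> A i x ->
  `|smooth_ratio x - smooth_ratio y| <= mdist x y * cell_slope i.
Proof.
move=> zx xy Aix; apply: (le_trans (smooth_ratio_lip_near zx xy)).
rewrite ler_wpM2l ?mdist_ge0//.
have hE := near_le_cell mE Aix; have hEC := near_le_cell mEC Aix; have hV := V_cell Aix.
have Vx0 : 0 < V x s := vol_gt0 hdbl x s0.
have Vi0 : 0 < V (x_ i) s := vol_gt0 hdbl (x_ i) s0.
rewrite (_ : cell_slope i = 2 * c / s * (cell_mass E i * cell_mass (~` E) i) *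
   (c ^+ 2 / V (x_ i) s ^+ 2)); last by rewrite /cell_slope; field; rewrite !gt_eqF.
rewrite -(mulrA (2 * c / s)).
have cs : 0 <= 2 * c / s by rewrite !mulr_ge0 ?invr_ge0 ?(ltW s0) ?(ltW c0).
rewrite ler_pM// ?invr_ge0 ?exprn_ge0 ?(ltW Vx0)//.
- by rewrite mulr_ge0// mulr_ge0// mass_ge0.
- by rewrite ler_wpM2l// ler_pM ?mass_ge0.
rewrite -exprVn -expr_div_n lerXn2r ?nnegrE ?invr_ge0 ?divr_ge0 ?(ltW Vx0) ?(ltW Vi0) ?(ltW c0)//.
by rewrite ler_pdivlMr// mulrC ler_pdivrMr.
Qed.

(* The Poincare inequality only integrates the gradient over the ball of radius
   P * rho, so nothing has to be known about smooth_ratio elsewhere. *)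
Definition smooth_slope (x : T) : \bar R :=
  if x \in (ball z (P * rho) : set T) then (\sum_(0 <= i < n) cell_slope i * \1_(A i) x)%:E else +oo%E.

Lemma smooth_slope_ge0 x : (0 <= smooth_slope x)%E.
Proof.
rewrite /smooth_slope; case: ifP => _; last exact: leey.
by rewrite lee_fin sumr_ge0// => i _; rewrite mulr_ge0 ?cell_slope_ge0// indicE.
Qed.

Let PB_sub x : ball z (P * rho) x -> exists2 i, (i < n)%N & A i x.
Proof.
move=> zx; apply: Acov; apply: le_ball zx.
by rewrite ler_pM2r ?rho0// lerDl.
Qed.

Lemma smooth_ratio_slope x y : (mdist x y : R) < s ->
  (`|smooth_ratio x - smooth_ratio y|%:E <= (mdist x y)%:E * smooth_slope x)%E.
Proof.
move=> xy; rewrite /smooth_slope; case: ifPn => [/[!inE] zx|_]; last first.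
  have [->|nxy] := eqVneq x y; first by rewrite subrr normr0 mdistxx mul0e.
  by rewrite gt0_muley ?leey// lte_fin mdist_gt0.
have [i ilt Aix] := PB_sub zx.
by rewrite -EFinM lee_fin (cell_indic_eq tA cell_slope ilt Aix); exact: smooth_ratio_cell.
Qed.

Lemma borel_smooth_slope : borel_fun smooth_slope.
Proof.
pose B : set (g_sigma_algebraType (@open T)) := ball z (P * rho).
have mB : measurable B by exact: (borel_open (@open_ball_metric R T _ _)).
rewrite /borel_fun /smooth_slope.
apply: measurable_fun_ifT.
- apply: (measurable_fun_bool true).
  by rewrite setTI (_ : _ @^-1` _ = B)//; apply/seteqP; split => x; [move=> /set_mem|move=> /mem_set].
- apply/measurable_EFinP; apply: measurable_sum => i.
  by apply: measurable_funM; [exact: measurable_cst|apply: measurable_indic; exact: bA].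
- exact: measurable_cst.
Qed.

Lemma upper_gradient_smooth : upper_gradient smooth_slope (EFin \o smooth_ratio).
Proof.
exact: (upper_gradient_of_local s0 borel_smooth_slope smooth_slope_ge0 smooth_ratio_slope).
Qed.

Let Tc : measurableType _ := caratheodory_type mu.

Lemma measurable_lipschitz (f : T -> R) (K : R) :
  (forall x y, `|f x - f y| <= mdist x y * K) -> measurable_fun setT (f : Tc -> R).
Proof.
move=> fK; apply: measurable_superlevel => a; apply: (open_cara hreg).
rewrite openE => x /= ax; rewrite /interior -nbhs_ballE.
have K10 : 0 < `|K| + 1 by rewrite ltr_wpDl.
exists ((f x - a) / (`|K| + 1)); first by rewrite /= divr_gt0// subr_gt0.
move=> y; rewrite ballEmdist /= ltr_pdivlMr// => xy.
have : mdist x y * K <= mdist x y * (`|K| + 1).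
  by rewrite ler_wpM2l ?mdist_ge0// (le_trans (ler_norm _))// lerDl.
have := ler_norm (f x - f y); have := fK x y; move: xy ax; lra.
Qed.

Lemma measurable_smooth_ratio : measurable_fun setT (smooth_ratio : Tc -> R).
Proof.
rewrite (_ : smooth_ratio =
  smooth_mass E \* ((@powR R ^~ (-1)) \o smooth_total)); last first.
  by apply/funext => x /=; rewrite powR_inv1// addr_ge0// smooth_mass_ge0.
apply: measurable_funM.
  exact: measurable_lipschitz (smooth_mass_lip E).
apply: measurableT_comp; first exact: measurable_powR.
by apply: measurable_funD; exact: measurable_lipschitz (smooth_mass_lip _).
Qed.

Lemma L1loc_smooth : L1loc mu (EFin \o smooth_ratio).
Proof.
move=> U oU cU; apply: measurable_bounded_integrable.
- exact: open_cara.
- have [r Ur] := compact_subset_ball z cU.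
  by apply: (subset_ball_lty hdbl (x := z) (s := r)); apply: subset_trans Ur; exact: subset_closure.
- exact: measurable_funTS measurable_smooth_ratio.
exists 1; split; rewrite ?num_real// => M M1 x _ /=.
have /andP[u0 u1] := smooth_ratio_01 x.
by rewrite ger0_norm// (le_trans u1)// ltW.
Qed.

Hypothesis hP : poincare11 mu CP P.

Lemma smooth_poincare : exists a : R,
  (\int[mu : {measure set Tc -> \bar R}]_(x in ball z rho) `|smooth_ratio x - a|%:E <=
   (CP * rho * \sum_(0 <= i < n) cell_slope i * mass (A i))%:E)%E.
Proof.
have hr0 := rho0.
set m := (mu : {measure set Tc -> \bar R}).
have Vr0 : 0 < V z rho := vol_gt0 hdbl z rho0.
have VP0 : 0 < V z (P * rho) := vol_gt0 hdbl z (mulr_gt0 P0 rho0).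
have mB : measurable (ball z rho : set Tc) := ball_cara hreg _ _.
have intu : m.-integrable (ball z rho) (EFin \o smooth_ratio).
  apply: L1loc_smooth; [exact: open_ball_metric|exact: (compact_closure_ball hreg hdbl)].
have ufin := integrable_fin_num mB intu.
pose a := mean mu (ball z rho) (EFin \o smooth_ratio).
have aE : a = (fine a)%:E.
  rewrite fineK// /a /mean /mu_integral (volE hdbl) inver gt_eqF//.
  by apply: fin_numM; [by []|exact: ufin].
have : (mean mu (ball z rho) (fun x => `|(smooth_ratio x)%:E - a|) <=
    (CP * rho)%:E * mean mu (ball z (P * rho)) smooth_slope)%E.
  exact: (hP z rho0 L1loc_smooth upper_gradient_smooth).
rewrite aE => H; exists (fine a); move: H.
rewrite /mean /mu_integral (volE hdbl) (volE hdbl) !inver !gt_eqF//.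
rewrite lee_pdivrMl// => /le_trans; apply.
have S0 : 0 <= \sum_(0 <= i < n) cell_slope i * mass (A i).
  by rewrite sumr_ge0// => i _; rewrite mulr_ge0 ?cell_slope_ge0 ?mass_ge0.
have slopeE : (\int[m]_(x in ball z (P * rho)) smooth_slope x <=
    (\sum_(0 <= i < n) cell_slope i * mass (A i))%:E)%E.
  rewrite -(integral_indic_sum _ cell_slope_ge0 fA) integral_mkcond.
  apply: ge0_le_integral_nomeas => x _; rewrite /patch; case: ifPn => xPB //.
  - exact: smooth_slope_ge0.
  - by rewrite /smooth_slope xPB.
  - by rewrite lee_fin sumr_ge0// => i _; rewrite mulr_ge0 ?cell_slope_ge0// indicE.
have CPr0 : 0 <= CP * rho by rewrite mulr_ge0 ?(le_trans ler01 CP1)// ltW.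
apply: (@le_trans _ _ ((V z rho)%:E * ((CP * rho)%:E * ((V z (P * rho))^-1%:E *
    (\sum_(0 <= i < n) cell_slope i * mass (A i))%:E)))%E).
  by rewrite !lee_wpmul2l// lee_fin// ?invr_ge0 ltW.
rewrite -!EFinM lee_fin mulrCA ler_wpM2l// mulrA ler_piMl//.
rewrite ler_pdivrMr// mul1r; apply: (vol_le hdbl).
by rewrite mdistxx add0r ler_peMl// ltW.
Qed.

Lemma smooth_oscillation (a : R) :
  ((Num.min (mass (ball z rho `&` E)) (mass (ball z rho `\` E)))%:E <=
   \int[mu : {measure set Tc -> \bar R}]_(x in ball z rho) `|smooth_ratio x - a|%:E +
   (\sum_(0 <= i < n) c / V (x_ i) s *
     (cell_mass (~` E) i * mass (A i `&` E) + cell_mass E i * mass (A i `&` ~` E)))%:E)%E.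
Proof.
set m := (mu : {measure set Tc -> \bar R}); set B : set T := ball z rho.
have hr0 := rho0.
have mB : measurable (B : set Tc) := ball_cara hreg _ _.
have fB : finite_set_mu mu B := finite_set_mu_ball hreg hdbl _ _.
have cV i : 0 <= c / V (x_ i) s by rewrite divr_ge0 ?(ltW c0)// vol_ge0.
pose k (b : bool * nat) := c / V (x_ b.2) s * cell_mass (if b.1 then ~` E else E) b.2.
pose D (b : bool * nat) := A b.2 `&` (if b.1 then E else ~` E).
pose r := [seq (b, i) | b <- [:: true; false], i <- index_iota 0 n].
have k0 b : 0 <= k b by rewrite mulr_ge0 ?cV ?mass_ge0.
have fD b : finite_set_mu mu (D b).
  by apply: finite_set_mu_setI; [exact: fA|case: b.1].
have sumE (f : bool * nat -> R) : \sum_(b <- r) f b =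
    \sum_(0 <= i < n) (f (true, i) + f (false, i)).
  by rewrite /r big_allpairs_dep !big_cons big_nil /= addr0 big_split.
rewrite [X in (_ + X)%E](_ : _ = (\sum_(b <- r) k b * mass (D b))%:E); last first.
  by congr EFin; rewrite sumE; apply: eq_bigr => i _; rewrite /k /D /=; ring.
rewrite -(integral_indic_sum _ k0 fD).
pose H x := \sum_(b <- r) k b * \1_(D b) x.
have H0 x : 0 <= H x by rewrite sumr_ge0// => b _; rewrite mulr_ge0// indicE.
have mH : measurable_fun setT (H : Tc -> R).
  by apply: measurable_sum => b; apply: measurable_funM;
    [exact: measurable_cst|apply: measurable_indic; exact: (fD b).1].
have mua : measurable_fun setT (fun x : Tc => `|smooth_ratio x - a|).
  by apply: measurableT_comp => //; apply: measurable_funB => //; exact: measurable_smooth_ratio.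
apply: (@le_trans _ _ (\int[m]_(x in B) (`|smooth_ratio x - a|%:E + (H x)%:E)))%E; last first.
  rewrite ge0_integralD//; last 3 first.
  - by apply/measurable_EFinP; exact: measurable_funTS.
  - by move=> x _; rewrite lee_fin.
  - by apply/measurable_EFinP; exact: measurable_funTS.
  rewrite leeD2l// ge0_subset_integral//; first exact/measurable_EFinP.
  by move=> x _; rewrite lee_fin.
have one x : \1_(B `&` E) x * `|1 - a| + \1_(B `\` E) x * `|a| <=
    (if x \in B then `|smooth_ratio x - a| + H x else 0).
  case: ifPn => [/[!inE] Bx|/negP nB]; last first.
    by rewrite !indicE !memNset ?mul0r ?addr0// => -[/mem_set].
  have [i ilt Aix] : exists2 i, (i < n)%N & A i x.
    apply: PB_sub; apply: le_ball Bx; rewrite ler_peMl// ltW//.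
  have xr : (mdist z x : R) + s <= (P + 2) * rho.
    move: Bx; rewrite /B ballEmdist /= => Bx; rewrite mulrDl.
    have := srho; have : rho <= P * rho by rewrite ler_peMl// ltW.
    by move: hr0; lra.
  have Dx := vol_le_smooth_total xr.
  have Vx0 : 0 < V x s := vol_gt0 hdbl x s0.
  have Vi0 : 0 < V (x_ i) s := vol_gt0 hdbl (x_ i) s0.
  have Dx0 := lt_le_trans Vx0 Dx.
  have Dinv : (smooth_total x)^-1 <= c / V (x_ i) s.
    rewrite ler_pdivlMr// mulrC ler_pdivrMr//.
    by rewrite (le_trans (V_cell Aix))// ler_wpM2l// ltW.
  have bound F : mu.-cara.-measurable F ->
      smooth_mass F x / smooth_total x <= c / V (x_ i) s * cell_mass F i.
    move=> mF; rewrite mulrC ler_pM ?invr_ge0 ?(ltW Dx0) ?smooth_mass_ge0//.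
    exact: le_trans (smooth_mass_le x mF) (near_le_cell mF Aix).
  have Hx : H x = \sum_(0 <= j < n) (k (true, j) * \1_E x + k (false, j) * \1_(~` E) x) * \1_(A j) x.
    rewrite /H sumE; apply: eq_bigr => j _; rewrite /D /= !indicI /=; ring.
  rewrite Hx (cell_indic_eq tA (fun j => k (true, j) * \1_E x + k (false, j) * \1_(~` E) x) ilt Aix).
  rewrite setDE !indicI /= !indicE (mem_set Bx) in_setC !mul1r.
  have ratioC : 1 - smooth_ratio x = smooth_mass (~` E) x / smooth_total x.
    by rewrite /smooth_ratio /smooth_total in Dx0 *; field; rewrite gt_eqF.
  have u01 := smooth_ratio_01 x.
  case: (x \in E) => /=; rewrite ?mul0r ?mulr0 ?mul1r ?mulr1 ?addr0 ?add0r.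
    have := bound _ mEC; rewrite -ratioC -/(k (true, i)) => hk.
    rewrite (_ : 1 - a = (smooth_ratio x - a) + (1 - smooth_ratio x)); last by ring.
    apply: (le_trans (ler_normD _ _)); apply: lerD => //.
    by rewrite ger0_norm// subr_ge0; case/andP: u01.
  have := bound _ mE; rewrite -/(smooth_ratio x) -/(k (false, i)) => hk.
  have -> : `|a| = `|(smooth_ratio x - a) + - smooth_ratio x|.
    by rewrite -normrN; congr (`|_|); ring.
  apply: (le_trans (ler_normD _ _)); apply: lerD => //.
  by rewrite normrN ger0_norm//; case/andP: u01.
have fBE := finite_set_mu_setI fB mE; have fBD := finite_set_mu_setD fB mE.
pose kk (b : bool) := if b then `|1 - a| else `|a|.
pose DD (b : bool) := if b then B `&` E else B `\` E.
have := @integral_indic_sum _ _ mu bool [:: true; false] kk DD.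
rewrite big_cons big_seq1 /= => intE.
apply: (@le_trans _ _ (`|1 - a| * mass (B `&` E) + `|a| * mass (B `\` E))%:E).
  rewrite lee_fin.
  have : 1 <= `|1 - a| + `|a| by rewrite -{1}(normr1 R) -{1}(subrK a 1) ler_normD.
  have := mass_ge0 mu (B `&` E); have := mass_ge0 mu (B `\` E).
  have := normr_ge0 (1 - a); have := normr_ge0 a.
  move: `|1 - a| `|a| (mass (B `&` E)) (mass (B `\` E)) => p q y x' q0 p0 x0 y0 pq.
  have : Num.min y x' * 1 <= Num.min y x' * (p + q) by rewrite ler_wpM2l// le_min y0.
  have : p * Num.min y x' <= p * y by rewrite ler_wpM2l// ge_min lexx.
  have : q * Num.min y x' <= q * x' by rewrite ler_wpM2l// ge_min lexx orbT.
  lra.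
rewrite -intE; last 2 first.
- by case => /=; rewrite normr_ge0.
- by case => /=.
rewrite [leRHS]integral_mkcond; apply: ge0_le_integral_nomeas => x _.
  rewrite lee_fin sumr_ge0// => b _.
  by apply: mulr_ge0; [case: b => /=; rewrite normr_ge0|rewrite indicE].
have := one x; rewrite big_cons big_seq1 /patch /= mulrC (mulrC _ `|a|).
by case: ifP => _; rewrite -?EFinD lee_fin.
Qed.

End fixed_scale.

End smoothing.

(** * The local fractional isoperimetric inequality *)

Section rectangles.
Context {R : realType} {T : completeMetricType R}.
Variables (mu : {outer_measure set T -> \bar R}) (c CP P : R).
Hypotheses (hreg : borel_regular mu) (hdbl : doubling mu c).
Hypotheses (c1 : 1 <= c) (CP1 : 1 <= CP) (P1 : 1 <= P).
Hypothesis hP : poincare11 mu CP P.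

Local Notation mass := (mass mu).
Local Notation V := (vol mu).

Let Tc : measurableType _ := caratheodory_type mu.
Let m : {measure set Tc -> \bar R} := mu.

Definition energy (w : T * T -> R) (E : set T) : \bar R :=
  (\int[(mu : {measure set (caratheodory_type mu) -> \bar R})]_x
   \int[(mu : {measure set (caratheodory_type mu) -> \bar R})]_y
     (w (x, y) * cut E x y)%:E)%E.

Definition cross_mass (E A D : set T) : R :=
  mass (A `&` E) * mass (D `&` ~` E) + mass (A `&` ~` E) * mass (D `&` E).

Lemma rect_energy (I : Type) (s : seq I) (k : I -> R) (A D : I -> set T)
    (w : T * T -> R) (E : set T) :
  mu.-cara.-measurable E -> (forall i, 0 <= k i) ->
  (forall i, finite_set_mu mu (A i)) -> (forall i, finite_set_mu mu (D i)) ->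
  (forall x y, (\sum_(i <- s) k i * (\1_(A i) x * \1_(D i) y)) * cut E x y <=
               w (x, y) * cut E x y) ->
  ((\sum_(i <- s) k i * cross_mass E (A i) (D i))%:E <= energy w E)%E.
Proof.
move=> mE k0 fA fD H.
have mEC : mu.-cara.-measurable (~` E) by exact: measurableC.
pose F (b : bool) := if b then E else ~` E.
have mF b : mu.-cara.-measurable (F b) by case: b.
apply: (@le_trans _ _ (\int[m]_x \int[m]_y
   ((\sum_(i <- s) k i * (\1_(A i) x * \1_(D i) y)) * cut E x y)%:E)%E); last first.
  apply: ge0_le_integral_nomeas => x _; last first.
    apply: ge0_le_integral_nomeas => y _; rewrite lee_fin//.
    by rewrite mulr_ge0 ?cut_ge0// sumr_ge0// => i _; rewrite !mulr_ge0 ?indicE.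
  apply: integral_ge0 => y _; rewrite lee_fin.
  by rewrite mulr_ge0 ?cut_ge0// sumr_ge0// => i _; rewrite !mulr_ge0 ?indicE.
have inner x : (\int[m]_y
   ((\sum_(i <- s) k i * (\1_(A i) x * \1_(D i) y)) * cut E x y)%:E =
   (\sum_(i <- s) (k i * \1_(A i) x) * mass (D i `&` F (x \notin E)))%:E)%E.
  rewrite -integral_indic_sum; last 2 first.
  - by move=> i; rewrite mulr_ge0 ?indicE.
  - by move=> i; exact: finite_set_mu_setI.
  apply: eq_integral => y _; congr EFin; rewrite mulr_suml; apply: eq_bigr => i _.
  rewrite indicI /= -!mulrA; congr (_ * (_ * (_ * _))).
  rewrite /cut !indicE /F; case: (x \in E); rewrite /= ?in_setC;
  by case: (y \in E); rewrite /= ?subrr ?subr0 ?sub0r ?normrN ?normr1 ?normr0.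
under eq_integral do rewrite inner.
pose r := [seq (b, i) | b <- [:: true; false], i <- s].
have sumE (f : bool * I -> R) : \sum_(b <- r) f b =
    \sum_(i <- s) (f (true, i) + f (false, i)).
  by rewrite /r big_allpairs_dep !big_cons big_nil /= addr0 big_split.
pose kk (b : bool * I) := k b.2 * mass (D b.2 `&` F (~~ b.1)).
pose AA (b : bool * I) := A b.2 `&` F b.1.
rewrite (_ : \sum_(i <- s) _ = \sum_(b <- r) kk b * mass (AA b)); last first.
  by rewrite sumE; apply: eq_bigr => i _; rewrite /cross_mass /kk /AA /=; ring.
rewrite -integral_indic_sum; last 2 first.
- by move=> b; rewrite mulr_ge0 ?mass_ge0.
- by move=> b; exact: finite_set_mu_setI.
apply: ge0_le_integral_nomeas => x _; rewrite lee_fin.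
  by rewrite sumr_ge0// => b _; rewrite !mulr_ge0 ?mass_ge0 ?indicE.
rewrite sumE; apply: ler_sum => i _; rewrite /kk /AA /= !indicI /= !indicE in_setC.
by case: (x \in E) => /=; rewrite ?mulr1 ?mulr0 ?addr0 ?add0r mulrAC.
Qed.

Let c0 : 0 < c. Proof. exact: lt_le_trans ltr01 c1. Qed.
Let CP0 : 0 < CP. Proof. exact: lt_le_trans ltr01 CP1. Qed.

(* Rectangles are kept explicit so that several scales can be added up before the
   comparison with a single kernel in rect_energy. *)
Lemma one_scale (E : set T) (z : T) (rho s : R) :
  mu.-cara.-measurable E -> 0 < s -> s <= rho ->
  exists (r : seq (bool * nat)) (k : bool * nat -> R) (A D : bool * nat -> set T),
  [/\ forall i, 0 <= k i,
      forall i, finite_set_mu mu (A i) /\ finite_set_mu mu (D i),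
      Num.min (mass (ball z rho `&` E)) (mass (ball z rho `\` E)) <=
        \sum_(i <- r) k i * cross_mass E (A i) (D i) &
      forall x y, \sum_(i <- r) k i * (\1_(A i) x * \1_(D i) y) <=
        2 * CP * c ^+ 12 * (rho / s) *
        (\1_(ball z ((P + 9) * rho)) x * \1_(ball z ((P + 9) * rho)) y *
         ((mdist x y < 12 * s)%R%:R / V x s))].
Proof.
move=> mE s0 srho; have rho0 : 0 < rho := lt_le_trans s0 srho.
have [n [x_ [A [bA tA As Az Acov]]]] := exists_cells hreg hdbl z ((P + 2) * rho) s0.
have [a Ha] := smooth_poincare hreg hdbl c1 CP1 P1 mE s0 srho bA tA As Az Acov hP.
have Ho := smooth_oscillation hreg hdbl c1 P1 mE s0 srho bA tA As Az Acov a.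
have fA i : finite_set_mu mu (A i).
  apply: (finite_set_mu_sub _ (Az i) (finite_set_mu_ball hreg hdbl _ _)).
  exact: (borel_sub_cara hreg).
pose D i : set T := ball (x_ i) (6 * s).
have fD i : finite_set_mu mu (D i) := finite_set_mu_ball hreg hdbl _ _.
pose k (b : bool * nat) := if b.1 then c / V (x_ b.2) s
  else CP * rho * (c ^+ 3 / s * mass (A b.2) / V (x_ b.2) s ^+ 2).
pose AA (b : bool * nat) := if b.1 then A b.2 else D b.2.
pose DD (b : bool * nat) := D b.2.
pose r := [seq (b, i) | b <- [:: true; false], i <- index_iota 0 n].
have sumE (f : bool * nat -> R) : \sum_(b <- r) f b =
    \sum_(0 <= i < n) (f (true, i) + f (false, i)).
  by rewrite /r big_allpairs_dep !big_cons big_nil /= addr0 big_split.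
have V0 x : 0 < V x s := vol_gt0 hdbl x s0.
exists r, k, AA, DD; split.
- move=> [[] i]; rewrite /k /=; first by rewrite divr_ge0 ?(ltW c0) ?(ltW (V0 _)).
  by rewrite !mulr_ge0 ?mass_ge0 ?invr_ge0 ?exprn_ge0 ?(ltW c0) ?(ltW CP0) ?(ltW rho0) ?(ltW s0) ?(ltW (V0 _)).
- by move=> [[] i]; split; rewrite /AA /DD /=.
- rewrite -lee_fin; apply: (le_trans Ho); apply: (le_trans (leeD2r _ Ha)).
  rewrite -EFinD lee_fin sumE mulr_sumr -big_split /=; apply: ler_sum => i _.
  rewrite /k /AA /DD /cross_mass /cell_slope /cell_mass -/(D i) /=.
  rewrite le_eqVlt; apply/orP; left; apply/eqP; field.
  by rewrite !gt_eqF.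
move=> x y; rewrite sumE big_split /=.
set B' : set T := ball z ((P + 9) * rho).
set K := \1_B' x * \1_B' y * ((mdist x y < 12 * s)%R%:R / V x s).
have K0 : 0 <= K by rewrite !mulr_ge0 ?indicE ?invr_ge0 ?(ltW (V0 _)).
have cc (i j : nat) : (i <= j)%N -> c ^+ i <= c ^+ j by move=> ij; rewrite ler_weXn2l.
have K2 : 0 <= c ^+ 2 * K by apply: mulr_ge0 => //; exact: exprn_ge0 (ltW c0).
have rs1 : 1 <= rho / s by rewrite ler_pdivlMr// mul1r.
have KE : x \in B' -> y \in B' -> (mdist x y : R) < 12 * s -> K = (V x s)^-1.
  by move=> xB yB xy; rewrite /K !indicE xB yB xy !mul1r.
have DB i y' : A i !=set0 -> D i y' -> y' \in B'.
  move=> [p Aip] Diy; rewrite inE /B'.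
  have := As _ _ Aip; have := Az _ _ Aip; move: Diy; rewrite /D !ballEmdist /= => h1 h2 h3.
  have := metric_triangle z p y'; have := metric_triangle p (x_ i) y'.
  by rewrite (metric_sym p (x_ i)); move: srho h1 h2 h3; rewrite !mulrDl; lra.
have AD i : A i `<=` D i.
  by move=> p /(As _ _); apply: le_ball; move: s0; lra.
have first : \sum_(0 <= i < n) k (true, i) * (\1_(AA (true, i)) x * \1_(DD (true, i)) y) <=
    c ^+ 2 * K.
  have [[i [ilt Aix]]|nex] := pselect (exists i, (i < n)%N /\ A i x); last first.
    rewrite big_nat big1 ?K2// => i /andP[_ ilt].
    by rewrite /AA /= indicE memNset ?mul0r ?mulr0// => Aix; apply: nex; exists i.
  rewrite (eq_bigr (fun i => (k (true, i) * \1_(DD (true, i)) y) * \1_(A i) x)); last first.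
    by move=> j _; rewrite /AA /= mulrA mulrAC.
  rewrite (cell_indic_eq tA (fun i => k (true, i) * \1_(DD (true, i)) y) ilt Aix).
  have [Dy|nDy] := pselect (D i y); last first.
    by rewrite /DD /= indicE memNset// mulr0 K2.
  have xD := AD i _ Aix.
  rewrite KE; last 3 first.
  - by apply: DB xD; exists x.
  - by apply: DB Dy; exists x.
  - move: Dy xD; rewrite /D !ballEmdist /= => h1 h2.
    by have := metric_triangle x (x_ i) y; rewrite (metric_sym x (x_ i)); lra.
  rewrite /DD /= indicE mem_set// mulr1 /k /= expr2 -mulrA ler_wpM2l ?(ltW c0)//.
  rewrite ler_pdivlMr// mulrC ler_pdivrMr//.
  have := @vol_compare _ _ _ _ hdbl 1 (x_ i) x s s s0; rewrite !expr1; apply.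
  by move: (As _ _ Aix); rewrite ballEmdist /=; lra.
have second : \sum_(0 <= i < n) k (false, i) * (\1_(AA (false, i)) x * \1_(DD (false, i)) y) <=
    CP * c ^+ 12 * (rho / s) * K.
  have coef0 : 0 <= CP * c ^+ 12 * (rho / s).
    by rewrite !mulr_ge0 ?exprn_ge0 ?invr_ge0 ?(ltW c0) ?(ltW CP0) ?(ltW rho0) ?(ltW s0).
  have [xyB|nxyB] := boolP [&& x \in B', y \in B' & (mdist x y : R) < 12 * s]; last first.
    rewrite big1; first exact: mulr_ge0.
    move=> i _; rewrite /k /AA /DD /=.
    have [A0|/set0P An0] := eqVneq (A i) set0.
      by rewrite A0 /mass outer_measure0 /= !(mulr0, mul0r).
    have [Dx|nDx] := pselect (D i x); last by rewrite indicE memNset// !(mulr0, mul0r).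
    have [Dy|nDy] := pselect (D i y); last by rewrite [\1_(D i) y]indicE memNset// !(mulr0, mul0r).
    move/negP: nxyB; case; rewrite (DB i x)// (DB i y)//=.
    move: Dx Dy; rewrite /D !ballEmdist /= => h1 h2.
    by have := metric_triangle x (x_ i) y; rewrite (metric_sym x (x_ i)); lra.
  have /and3P[xB yB xy] := xyB; rewrite KE//.
  pose l i : R := (x \in D i)%:R.
  have l01 i : 0 <= l i <= 1 by rewrite /l; case: (x \in D i); rewrite ?lexx ?ler01.
  have suml : \sum_(0 <= i < n) l i * mass (A i) <= c ^+ 3 * V x s.
    have -> : \sum_(0 <= i < n) l i * mass (A i) = \sum_(0 <= i < n) l i * mass (A i `&` setT).
      by apply: eq_bigr => i _; rewrite setIT.
    apply: (le_trans (@cell_sum_le _ _ mu n A fA tA l (ball x (7 * s)) setT l01 measurableT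
      (finite_set_mu_ball hreg hdbl _ _) _)); last first.
      by rewrite setIT; apply: (vol_compare hdbl) => //; rewrite mdistxx !exprS expr0 mulr1; lra.
    move=> i ilt; rewrite /l; case: (boolP (x \in D i)) => [/[!inE] Dx _|_]; last by rewrite ltxx.
    apply: subset_trans (@As i) _; apply: ball_subset; rewrite metric_sym.
    by move: Dx; rewrite /D ballEmdist /=; lra.
  apply: (@le_trans _ _ (\sum_(0 <= i < n) CP * (rho / s) * c ^+ 9 / V x s ^+ 2 * (l i * mass (A i)))).
    apply: ler_sum => i _; rewrite /k /AA /DD /= /l indicE.
    have [Dx|nDx] := boolP (x \in D i); last by rewrite /= !(mulr0, mul0r).
    have Vx : V x s <= c ^+ 3 * V (x_ i) s.
      apply: (vol_compare hdbl) => //; move: Dx; rewrite inE /D ballEmdist /= => Dx.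
      by rewrite !exprS expr0 mulr1; lra.
    rewrite /= !mul1r.
    rewrite (_ : CP * rho * _ * _ = CP * (rho / s) * c ^+ 3 * (V (x_ i) s ^+ 2)^-1 * mass (A i) * \1_(D i) y);
      last by field; rewrite !gt_eqF.
    rewrite (_ : CP * (rho / s) * c ^+ 9 / V x s ^+ 2 * _ =
      CP * (rho / s) * c ^+ 3 * (c ^+ 6 / V x s ^+ 2) * mass (A i) * 1); last by field; rewrite !gt_eqF.
    have h0 : 0 <= CP * (rho / s) * c ^+ 3.
      by rewrite !mulr_ge0 ?exprn_ge0 ?invr_ge0 ?(ltW c0) ?(ltW CP0) ?(ltW rho0) ?(ltW s0).
    apply: ler_pM; rewrite ?indicE ?ler0n//; last by case: (y \in D i).
      by apply: mulr_ge0; [apply: mulr_ge0 => //; rewrite invr_ge0 exprn_ge0// ltW|exact: mass_ge0].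
    apply: ler_wpM2r; first exact: mass_ge0.
    apply: ler_wpM2l => //.
    have V2 : V x s ^+ 2 <= c ^+ 6 * V (x_ i) s ^+ 2.
      rewrite (exprM c 3 2) -exprMn lerXn2r ?nnegrE ?mulr_ge0 ?exprn_ge0 ?(ltW c0)//;
      by rewrite ltW.
    by rewrite ler_pdivlMr ?exprn_gt0// mulrC ler_pdivrMr ?exprn_gt0.
  rewrite -mulr_sumr.
  have h1 : 0 <= CP * (rho / s) * c ^+ 9 / V x s ^+ 2.
    by rewrite !mulr_ge0 ?exprn_ge0 ?invr_ge0 ?exprn_ge0 ?(ltW c0) ?(ltW CP0) ?(ltW rho0) ?(ltW s0) ?(ltW (V0 _)).
  apply: (le_trans (ler_wpM2l h1 suml)); rewrite le_eqVlt; apply/orP; left; apply/eqP.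
  by field; rewrite !gt_eqF.
apply: (le_trans (lerD first second)); rewrite -mulrDl ler_wpM2r//.
have : c ^+ 2 <= CP * c ^+ 12 * (rho / s).
  apply: (le_trans (cc 2 12 isT)); rewrite -[leLHS]mulr1 ler_pM ?exprn_ge0 ?(ltW c0)//.
  by rewrite ler_peMl// exprn_ge0// ltW.
by lra.
Qed.

End rectangles.

Section dyadic_scales.
Context {R : realType}.

Lemma geometric_sum_le (w : R) n : 4 <= 3 * w -> \sum_(0 <= j < n.+1) w ^+ j <= 4 * w ^+ n.
Proof.
move=> w43; elim: n => [|n IH]; first by rewrite big_nat1 expr0; lra.
rewrite big_nat_recr//= (le_trans (lerD IH (lexx _)))//.
have wn0 : 0 <= w ^+ n by rewrite exprn_ge0//; lra.
rewrite exprS; have : w ^+ n * 4 <= w ^+ n * (3 * w) by rewrite ler_wpM2l.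
by lra.
Qed.

Lemma two_powR_ge (theta : R) : 2^-1 <= theta -> 4 <= 3 * 2 `^ theta.
Proof.
move=> t2; have : 2 `^ (2^-1) <= 2 `^ theta :> R by rewrite ler_powR// ler1n.
have : 4 / 3 <= 2 `^ (2^-1) :> R.
  rewrite powR12_sqrt// (_ : 4 / 3 = Num.sqrt ((4 / 3) ^+ 2)).
    by rewrite ler_wsqrtr// expr2; lra.
  by rewrite sqrtr_sqr ger0_norm//; lra.
by lra.
Qed.

Lemma two_powR_oppr_ge (x : R) : 0 <= x -> 1 - x <= 2 `^ (- x).
Proof.
move=> x0; rewrite /powR pnatr_eq0 /=.
apply: le_trans (expR_ge1Dx _); rewrite lerD2l mulNr lerN2 ler_piMr//.
by have := @le_ln1Dx R 1; rewrite (_ : 1 + 1 = 2 :> R); [apply; lra|ring].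
Qed.

(* Source of the factor 1 - theta: for theta >= 1/2 about (1 - theta)^-1 scales
   carry comparable weights, while for theta < 1/2 a single scale suffices. *)
Lemma scales_exist (theta : R) : 0 < theta -> theta < 1 -> exists N : nat,
  1 <= 2 * (1 - theta) * \sum_(0 <= j < N) (2 `^ (theta - 1)) ^+ j /\
  forall rho d : R, 0 < rho -> 0 < d ->
    \sum_(0 <= j < N) (rho / 2 ^+ j) `^ (- theta) * (d < 12 * (rho / 2 ^+ j))%R%:R
      <= 48 * d `^ (- theta).
Proof.
move=> t0 t1.
have dle rho d : 0 < rho -> 0 < d -> d < 12 * rho -> rho `^ (- theta) <= 12 * d `^ (- theta).
  move=> r0 d0 dr; rewrite !powRN.
  have : d `^ theta <= 12 * rho `^ theta.
    have h : d `^ theta <= (12 * rho) `^ theta by rewrite ge0_ler_powR ?nnegrE ?(ltW t0) ?(ltW d0) ?mulr_ge0 ?(ltW r0) ?(ltW dr).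
    apply: (le_trans h); rewrite powRM ?(ltW r0)// ler_wpM2r ?powR_ge0//.
    by rewrite -[leRHS]powRr1// ler_powR ?ler1n ?(ltW t1).
  have d'0 : 0 < d `^ theta by rewrite powR_gt0.
  have r'0 : 0 < rho `^ theta by rewrite powR_gt0.
  by move=> h; rewrite ler_pdivlMr// mulrC ler_pdivrMr.
have [t2|t2] := ltP theta (2^-1).
  exists 1%N; split; first by rewrite big_nat1 expr0 mulr1; lra.
  move=> rho d r0 d0; rewrite big_nat1 expr0 divr1.
  have d'0 : 0 <= d `^ (- theta) by exact: powR_ge0.
  case: ltP => dr; last by rewrite mulr0 mulr_ge0.
  by have := dle _ _ r0 d0 dr; rewrite mulr1; lra.
pose p : R := 2 `^ (theta - 1).
pose N := (Num.truncn (1 - theta)^-1).+1.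
have u0 : 0 < 1 - theta by lra.
have NP : 1 <= (1 - theta) * N%:R.
  have i0 : 0 <= (1 - theta)^-1 by rewrite invr_ge0 ltW.
  have /andP[_ /ltW h] := truncn_itv i0.
  by rewrite mulrC -ler_pdivrMr// mul1r.
have p0 : 0 <= p by exact: powR_ge0.
have ptheta : theta <= p.
  by have := two_powR_oppr_ge (ltW u0); rewrite opprB; apply: le_trans; lra.
have pN : p ^+ N <= 2^-1.
  rewrite -powR_mulrn// /p -powRrM -powR_inv1// ler_powR ?ler1n//.
  by move: NP; lra.
exists N; split.
  have gs : (1 - p) * \sum_(0 <= j < N) p ^+ j = 1 - p ^+ N.
    rewrite big_mkord -[in RHS](expr1n _ N) subrXX; congr (_ * _).
    by apply: eq_bigr => i _; rewrite expr1n mul1r.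
  have s0 : 0 <= \sum_(0 <= j < N) p ^+ j by apply: sumr_ge0 => j _; exact: exprn_ge0.
  have : (1 - p) * \sum_(0 <= j < N) p ^+ j <= (1 - theta) * \sum_(0 <= j < N) p ^+ j.
    by rewrite ler_wpM2r// lerD2l lerN2.
  by rewrite gs -/p; move: pN; lra.
move=> rho d r0 d0; elim: N {NP pN} => [|N IH]; first by rewrite big_nil mulr_ge0 ?powR_ge0.
rewrite big_nat_recr//=; have [dr|_] := ltP d (12 * (rho / 2 ^+ N)); last by rewrite mulr0 addr0.
have rj j : 0 < rho / 2 ^+ j by rewrite divr_gt0 ?exprn_gt0.
have rjE j : (rho / 2 ^+ j) `^ (- theta) = rho `^ (- theta) * (2 `^ theta) ^+ j.
  rewrite powRM ?invr_ge0 ?exprn_ge0 ?(ltW r0)//; congr (_ * _).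
  by rewrite -powR_mulrn ?powR_ge0// -powRrM -(powR_inv1 (exprn_ge0 _ _))// -powR_mulrn// -!powRrM;
    congr (_ `^ _); ring.
apply: (@le_trans _ _ (\sum_(0 <= j < N.+1) (rho / 2 ^+ j) `^ (- theta))).
  rewrite big_nat_recr//= mulr1 lerD2r; apply: ler_sum => j _.
  by rewrite ler_piMr ?powR_ge0//; case: (_ < _).
under eq_bigr do rewrite rjE; rewrite -mulr_sumr.
apply: (le_trans (ler_wpM2l (powR_ge0 _ _) (geometric_sum_le _ (two_powR_ge t2)))).
rewrite mulrCA -rjE; have := dle _ _ (rj N) d0 dr; lra.
Qed.

End dyadic_scales.

Section local_isoperimetric.
Context {R : realType} {T : completeMetricType R}.
Variables (mu : {outer_measure set T -> \bar R}) (c CP P : R).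
Hypotheses (hreg : borel_regular mu) (hdbl : doubling mu c).
Hypotheses (c1 : 1 <= c) (CP1 : 1 <= CP) (P1 : 1 <= P).
Hypothesis hP : poincare11 mu CP P.

Local Notation mass := (mass mu).
Local Notation V := (vol mu).

Definition frac_weight (theta : R) (A : set T) (p : T * T) : R :=
  \1_A p.1 * \1_A p.2 * frac_kernel mu theta p.1 p.2.

Lemma frac_weight_ge0 theta A p : 0 <= frac_weight theta A p.
Proof. by rewrite /frac_weight !mulr_ge0 ?indicE// frac_kernel_ge0. Qed.

Lemma local_isoperimetric (theta : R) (E : set T) (z : T) (rho : R) :
  0 < theta -> theta < 1 -> mu.-cara.-measurable E -> 0 < rho ->
  ((Num.min (mass (ball z rho `&` E)) (mass (ball z rho `\` E)))%:E <=
   (192 * CP * c ^+ 16 * (1 - theta) * rho `^ theta)%:E *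
   energy mu (frac_weight theta (ball z ((P + 9) * rho))) E)%E.
Proof.
move=> t0 t1 mE rho0.
have c0 : 0 < c := lt_le_trans ltr01 c1.
have CP0 : 0 < CP := lt_le_trans ltr01 CP1.
have [N [sumN scaleN]] := scales_exist t0 t1.
set M := Num.min _ _.
have M0 : 0 <= M by rewrite le_min !mass_ge0.
pose s (j : nat) := rho / 2 ^+ j.
have s0 j : 0 < s j by rewrite divr_gt0 ?exprn_gt0.
have srho j : s j <= rho.
  by rewrite ler_pdivrMr ?exprn_gt0// ler_peMr ?(ltW rho0)// exprn_ege1// ler1n.
have /choice[r Hr] j := one_scale hreg hdbl c1 CP1 P1 hP z mE (s0 j) (srho j).
have /choice[k Hk] := Hr; have /choice[A HA] := Hk; have /choice[D HD] := HA => {Hr Hk HA}.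
pose K := 96 * CP * c ^+ 16.
have K0 : 0 < K by rewrite !mulr_gt0 ?exprn_gt0.
pose wt j := (s j) `^ (- theta) / 2 ^+ j / K.
have wt0 j : 0 <= wt j by rewrite !divr_ge0 ?powR_ge0 ?exprn_ge0 ?(ltW K0).
pose kk (i : nat * (bool * nat)) := wt i.1 * k i.1 i.2.
pose rr := [seq (j, b) | j <- index_iota 0 N, b <- r j].
have sumE (f : nat * (bool * nat) -> R) :
    \sum_(i <- rr) f i = \sum_(0 <= j < N) \sum_(b <- r j) f (j, b).
  by rewrite /rr big_allpairs_dep.
have H := @rect_energy _ _ mu _ rr kk (fun i => A i.1 i.2) (fun i => D i.1 i.2)
  (frac_weight theta (ball z ((P + 9) * rho))) E mE.
have wtE j : wt j = rho `^ (- theta) * (2 `^ (theta - 1)) ^+ j / K.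
  rewrite /wt /s; congr (_ / _).
  rewrite powRM ?invr_ge0 ?exprn_ge0 ?(ltW rho0)// -mulrA; congr (_ * _).
  rewrite -[in RHS]powR_mulrn ?powR_ge0// -powRrM.
  rewrite -(powR_inv1 (exprn_ge0 _ _))// -powR_mulrn// -!powRrM -powRD; last first.
    by rewrite pnatr_eq0 implybT.
  by congr (_ `^ _); ring.
apply: (@le_trans _ _ (192 * CP * c ^+ 16 * (1 - theta) * rho `^ theta *
    \sum_(i <- rr) kk i * cross_mass mu E (A i.1 i.2) (D i.1 i.2))%:E); last first.
  rewrite EFinM lee_wpmul2l//.
    rewrite lee_fin !mulr_ge0 ?exprn_ge0 ?powR_ge0 ?(ltW c0) ?(ltW CP0)//.
    by rewrite subr_ge0 ltW.
  apply: H => [[j b]|[j b]|[j b]|x y].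
  - by rewrite mulr_ge0//; have [] := HD j.
  - by have [_ /(_ b)[]] := HD j.
  - by have [_ /(_ b)[]] := HD j.
  have [->|xy] := eqVneq x y.
    by rewrite /cut subrr normr0 !mulr0.
  have d0 : 0 < mdist x y by rewrite mdist_gt0.
  rewrite ler_wpM2r ?cut_ge0// sumE.
  set B : set T := ball z ((P + 9) * rho).
  have Vd : 0 < V x (mdist x y) := vol_gt0 hdbl x d0.
  apply: (@le_trans _ _ (\sum_(0 <= j < N) (48^-1 * (\1_B x * \1_B y / V x (mdist x y))) *
      ((s j) `^ (- theta) * (mdist x y < 12 * s j)%R%:R))); last first.
    rewrite -mulr_sumr.
    have h : 0 <= 48^-1 * (\1_B x * \1_B y / V x (mdist x y)).
      by rewrite !mulr_ge0 ?invr_ge0 ?indicE ?(ltW Vd).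
    apply: (le_trans (ler_wpM2l h (scaleN _ _ rho0 d0))).
    rewrite /frac_weight /frac_kernel /= invfM -powRN le_eqVlt; apply/orP; left; apply/eqP.
    by field; rewrite gt_eqF.
  apply: ler_sum => j _.
  have [_ _ _ /(_ x y)] := HD j; rewrite -/B => hx.
  have -> : \sum_(b <- r j) kk (j, b) * (\1_(A j b) x * \1_(D j b) y) =
      wt j * \sum_(b <- r j) k j b * (\1_(A j b) x * \1_(D j b) y).
    by rewrite mulr_sumr; apply: eq_bigr => b _; rewrite /kk /= mulrA.
  apply: (le_trans (ler_wpM2l (wt0 j) hx)).
  have V0 : 0 < V x (s j) := vol_gt0 hdbl x (s0 j).
  have rs : rho / s j = 2 ^+ j by rewrite /s; field; rewrite !gt_eqF// exprn_gt0.
  rewrite rs /wt.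
  have [dlt|_] := ltP (mdist x y : R) (12 * s j); last by rewrite !(mul0r, mulr0).
  have Vle : V x (mdist x y) <= c ^+ 4 * V x (s j).
    apply: (vol_compare hdbl (s0 j)); rewrite mdistxx add0r !exprS expr0.
    by move: dlt; have := s0 j; lra.
  rewrite /= [leLHS](_ : _ = 48^-1 * (\1_B x * \1_B y) * (s j) `^ (- theta) * (c ^+ 4 * V x (s j))^-1); last first.
    by rewrite /K; field; rewrite !gt_eqF ?exprn_gt0.
  rewrite [leRHS](_ : _ = 48^-1 * (\1_B x * \1_B y) * (s j) `^ (- theta) * (V x (mdist x y))^-1); last first.
    by field; rewrite gt_eqF.
  rewrite ler_wpM2l ?mulr_ge0 ?powR_ge0 ?indicE ?invr_ge0//.
  by rewrite lef_pV2 ?posrE ?mulr_gt0 ?exprn_gt0.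
rewrite lee_fin sumE.
have low : \sum_(0 <= j < N) wt j * M <=
    \sum_(0 <= j < N) \sum_(b <- r j) kk (j, b) * cross_mass mu E (A j b) (D j b).
  apply: ler_sum => j _; rewrite (eq_bigr (fun b => wt j * (k j b * cross_mass mu E (A j b) (D j b)))); last first.
    by move=> b _; rewrite /kk /= mulrA.
  by rewrite -mulr_sumr ler_wpM2l//; have [] := HD j.
have C0 : 0 <= 192 * CP * c ^+ 16 * (1 - theta) * rho `^ theta.
  by rewrite !mulr_ge0 ?exprn_ge0 ?powR_ge0 ?(ltW c0) ?(ltW CP0)// subr_ge0 ltW.
apply: le_trans (ler_wpM2l C0 low).
rewrite -mulr_suml; under eq_bigr do rewrite wtE.
rewrite -mulr_suml -mulr_sumr.
rewrite [leRHS](_ : _ = M * (2 * (1 - theta) * \sum_(0 <= j < N) (2 `^ (theta - 1)) ^+ j)).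
  by rewrite ler_peMr.
rewrite powRN /K; field.
by rewrite !gt_eqF ?powR_gt0.
Qed.

End local_isoperimetric.

Lemma powR_sum_le (R : realType) (I : eqType) (s : seq I) (v : I -> R) (a : R) :
  0 < a -> a <= 1 -> (forall i, i \in s -> 0 <= v i) ->
  (\sum_(i <- s) v i) `^ a <= \sum_(i <- s) v i `^ a.
Proof.
move=> a0 a1 v0; set S := \sum_(i <- s) v i.
have S0 : 0 <= S by rewrite /S big_seq sumr_ge0.
have [SE|Sn0] := eqVneq S 0.
  by rewrite SE powR0 ?gt_eqF// sumr_ge0// => i _; exact: powR_ge0.
have {Sn0} Sgt0 : 0 < S by rewrite lt_neqAle eq_sym Sn0.
have vS i : i \in s -> v i / S <= (v i / S) `^ a.
  move=> si; have [->|vn0] := eqVneq (v i) 0; first by rewrite mul0r powR_ge0.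
  have vi0 : 0 < v i by rewrite lt_neqAle eq_sym vn0 v0.
  apply: ger1_powR => //; rewrite divr_gt0//= ler_pdivrMr// mul1r.
  by rewrite /S (big_rem i)//= lerDl big_seq sumr_ge0// => j /mem_rem; exact: v0.
have : 1 <= \sum_(i <- s) (v i / S) `^ a.
  rewrite (_ : 1 = \sum_(i <- s) v i / S).
    by rewrite big_seq [leRHS]big_seq; apply: ler_sum => i; exact: vS.
  by rewrite -mulr_suml -/S divff// gt_eqF.
have Sa0 := powR_ge0 S a.
move=> /(ler_wpM2l Sa0); rewrite mulr1 => /le_trans; apply.
rewrite mulr_sumr big_seq [leRHS]big_seq; apply: ler_sum => i si.
by rewrite -powRM ?divr_ge0 ?v0// mulrC divfK// gt_eqF.
Qed.

Section energy_theory.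
Context {R : realType} {T : completeMetricType R}.
Variables (mu : {outer_measure set T -> \bar R}) (c : R).
Hypotheses (hreg : borel_regular mu) (hdbl : doubling mu c).

Local Notation mass := (mass mu).
Let Tc : measurableType _ := caratheodory_type mu.
Let m : {measure set Tc -> \bar R} := mu.

Lemma energy_ge0 (w : T * T -> R) (E : set T) : (forall p, 0 <= w p) -> (0 <= energy mu w E)%E.
Proof.
move=> w0; apply: integral_ge0 => x _; apply: integral_ge0 => y _.
by rewrite lee_fin mulr_ge0 ?cut_ge0.
Qed.

Lemma le_frac_weight theta (A B : set T) p : A `<=` B ->
  frac_weight mu theta A p <= frac_weight mu theta B p.
Proof.
move=> AB; rewrite /frac_weight ler_wpM2r ?frac_kernel_ge0//.
have h x : \1_A x <= \1_B x :> R.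
  rewrite !indicE; have [/[!inE] /AB Bx|_] := boolP (x \in A); last by rewrite ler0n.
  by rewrite mem_set.
by rewrite ler_pM ?indicE//; have := h p.1; have := h p.2; rewrite !indicE.
Qed.

Lemma le_energy_frac theta (A B E : set T) : A `<=` B ->
  (energy mu (frac_weight mu theta A) E <= energy mu (frac_weight mu theta B) E)%E.
Proof.
move=> AB; apply: ge0_le_integral_nomeas => x _.
  by apply: integral_ge0 => y _; rewrite lee_fin mulr_ge0 ?cut_ge0 ?frac_weight_ge0.
apply: ge0_le_integral_nomeas => y _; rewrite lee_fin.
  by rewrite mulr_ge0 ?cut_ge0 ?frac_weight_ge0.
by rewrite ler_wpM2r ?cut_ge0// le_frac_weight.
Qed.

Lemma measurable_frac_weight theta (A : set T) : mu.-cara.-measurable A ->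
  measurable_fun setT (frac_weight mu theta A : Tc * Tc -> R).
Proof.
move=> mA; have mi : measurable_fun setT (\1_A : Tc -> R) by exact: measurable_indic.
apply: measurable_funM; last exact: (measurable_frac_kernel hreg hdbl).
apply: measurable_funM; first exact: (measurableT_comp mi measurable_fst).
exact: (measurableT_comp mi measurable_snd).
Qed.

Lemma energy_sum_le theta (I : eqType) (s : seq I) (A : I -> set T) (B E : set T) :
  mu.-cara.-measurable E -> (forall i, mu.-cara.-measurable (A i)) ->
  pairwise (disjoint_rel A) s -> (forall i, i \in s -> A i `<=` B) ->
  (\sum_(i <- s) energy mu (frac_weight mu theta (A i)) E <=
   energy mu (frac_weight mu theta B) E)%E.
Proof.
move=> mE mA pw AB.
have mf i : measurable_fun setT (fun p : Tc * Tc => (frac_weight mu theta (A i) p * cut E p.1 p.2)%:E).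
  apply/measurable_EFinP; apply: measurable_funM; first exact: measurable_frac_weight.
  exact: (measurable_cut mE).
have f0 i p : (0 <= (frac_weight mu theta (A i) p * cut E p.1 p.2)%:E)%E.
  by rewrite lee_fin mulr_ge0 ?cut_ge0 ?frac_weight_ge0.
have sm := sigma_finite_cara hreg hdbl.
have mF i := @measurable_integral_section2 _ _ Tc Tc R m sm _ (mf i) (f0 i).
rewrite -(@ge0_integral_sum _ _ _ m setT measurableT _
   (fun i x => \int[m]_y (frac_weight mu theta (A i) (x, y) * cut E x y)%:E)%E)//; last first.
  by move=> i x _; apply: integral_ge0 => y _; exact: (f0 i (x, y)).
apply: ge0_le_integral_nomeas => x _.
  by apply: sume_ge0 => i _; apply: integral_ge0 => y _; exact: (f0 i (x, y)).
rewrite -(@ge0_integral_sum _ _ _ m setT measurableT _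
   (fun i y => (frac_weight mu theta (A i) (x, y) * cut E x y)%:E))//; last first.
  by move=> i; apply: (measurableT_comp (mf i)); exact: measurable_pair1.
apply: ge0_le_integral_nomeas => y _.
  by apply: sume_ge0 => i _; exact: (f0 i (x, y)).
rewrite sumEFin lee_fin -mulr_suml ler_wpM2r ?cut_ge0//.
rewrite /frac_weight -mulr_suml ler_wpM2r ?frac_kernel_ge0//=.
have h z : \sum_(i <- s) (\1_(A i) z : R) <= \1_B z by exact: pairwise_disjoint_indic.
apply: (@le_trans _ _ (\sum_(i <- s) \1_(A i) x * \1_B y)).
  rewrite big_seq [leRHS]big_seq; apply: ler_sum => i si; rewrite ler_wpM2l ?indicE//.
  have [/[!inE] /(AB _ si) By|_] := boolP (y \in A i); last by rewrite ler0n.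
  by rewrite mem_set.
by rewrite -mulr_suml ler_wpM2r ?indicE//; have := h x; rewrite indicE.
Qed.

End energy_theory.

(** * Stopping balls *)

Section stopping.
Context {R : realType} {T : completeMetricType R}.
Variables (mu : {outer_measure set T -> \bar R}) (c CP P C0 Q : R).
Hypotheses (hreg : borel_regular mu) (hdbl : doubling mu c).
Hypotheses (c1 : 1 <= c) (CP1 : 1 <= CP) (P1 : 1 <= P).
Hypotheses (C01 : 1 <= C0) (Q1 : 1 < Q).
Hypothesis hP : poincare11 mu CP P.
Hypothesis hL : lower_mass_bound mu C0 Q.

Local Notation mass := (mass mu).
Local Notation V := (vol mu).
Let Tc : measurableType _ := caratheodory_type mu.
Let m : {measure set Tc -> \bar R} := mu.

Let c0 : 0 < c. Proof. exact: lt_le_trans ltr01 c1. Qed.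
Let CP0 : 0 < CP. Proof. exact: lt_le_trans ltr01 CP1. Qed.
Let C00 : 0 < C0. Proof. exact: lt_le_trans ltr01 C01. Qed.
Let Q0 : 0 < Q. Proof. exact: lt_trans ltr01 Q1. Qed.

Variables (theta : R) (E : set T) (x0 : T) (r : R).
Hypotheses (t0 : 0 < theta) (t1 : theta < 1).
Hypotheses (mE : mu.-cara.-measurable E) (r0 : 0 < r).

Let r20 : 0 < 2 * r. Proof. exact: mulr_gt0. Qed.

Definition stop_radius (j : nat) : R := 2 * r / 2 ^+ j.

Definition stops (x : T) (j : nat) : Prop :=
  2^-1 / c * V x (stop_radius j) < mass (ball x (stop_radius j) `&` E).

Let rad0 j : 0 < stop_radius j.
Proof. by rewrite divr_gt0 ?exprn_gt0 ?r20. Qed.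

Let radS j : stop_radius j = 2 * stop_radius j.+1.
Proof. by rewrite /stop_radius exprS; field; rewrite gt_eqF// exprn_gt0. Qed.

Let rad_le i j : (i <= j)%N -> stop_radius j <= stop_radius i.
Proof.
move=> ij; apply: ler_wpM2l; first exact: ltW r20.
by rewrite lef_pV2 ?posrE ?exprn_gt0// ler_weXn2l// ler1n.
Qed.

Lemma exists_stop_radius (M : R) : exists j, M <= (stop_radius j) `^ (- theta).
Proof.
have [n nP] := exists_exp2_ge (M * (2 * r) `^ theta).
pose j := (Num.truncn (n%:R / theta)).+1.
have jP : n%:R <= theta * j%:R.
  have h0 : 0 <= n%:R / theta by rewrite divr_ge0// ltW.
  have /andP[_ /ltW h] := truncn_itv h0.
  by rewrite mulrC -ler_pdivrMr.
have r2t : 0 < (2 * r) `^ theta by rewrite powR_gt0 ?r20.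
exists j; rewrite -ler_pdivlMr// in nP; apply: (le_trans nP).
have -> : stop_radius j `^ (- theta) = ((2 * r) `^ theta)^-1 * (2 ^+ j) `^ theta.
  rewrite /stop_radius powRM ?invr_ge0 ?exprn_ge0 ?(ltW r20)//; congr (_ * _).
    by rewrite powRN.
  by rewrite -(powR_inv1 (exprn_ge0 _ _))// -powRrM; congr (_ `^ _); ring.
rewrite [leLHS]mulrC; apply: ler_wpM2l; first by rewrite invr_ge0 ltW.
rewrite -!powR_mulrn// -!powRrM ler_powR ?ler1n//.
by move: jP; lra.
Qed.

(* A substitute for Lebesgue's density theorem: by infinite_section_null the points
   of E at which no radius is a stopping radius form a null set. *)
Lemma never_stops_infinite (A : set T) (x : T) (M : R) : E x -> A x ->
  ball x (2 * r) `<=` A -> (forall j, ~ stops x j) ->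
  (M%:E <= \int[m]_y (frac_weight mu theta A (x, y) * cut E x y)%:E)%E.
Proof.
move=> Ex Ax BA nst.
have [j jM] := exists_stop_radius (2 * M).
set rho := stop_radius j; have rho0 : 0 < rho := rad0 j.
have V0 : 0 < V x rho := vol_gt0 hdbl x rho0.
have fB := finite_set_mu_ball hreg hdbl x rho.
have fD := finite_set_mu_setD fB mE.
have half : V x rho <= 2 * mass (ball x rho `\` E).
  have := massID fB mE; rewrite -[mass (ball x rho)]/(V x rho).
  have /negP := nst j; rewrite -leNgt -/rho => h1 h2.
  have : 2^-1 / c * V x rho <= 2^-1 * V x rho.
    by rewrite ler_wpM2r ?(ltW V0)// ler_piMr// invf_le1.
  by move: h1 h2; lra.
pose k (_ : unit) : R := rho `^ (- theta) / V x rho.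
have k0 i : 0 <= k i by rewrite divr_ge0 ?powR_ge0 ?(ltW V0).
have := @integral_indic_sum _ _ mu unit [:: tt] k (fun=> ball x rho `\` E) k0 (fun=> fD).
rewrite big_seq1 => intE.
apply: (@le_trans _ _ (k tt * mass (ball x rho `\` E))%:E).
  rewrite lee_fin /k.
  have : 2 * M * (V x rho / V x rho) <= rho `^ (- theta) * (V x rho / V x rho).
    by rewrite ler_wpM2r ?divff ?gt_eqF.
  have : rho `^ (- theta) / V x rho * V x rho <= rho `^ (- theta) / V x rho * (2 * mass (ball x rho `\` E)).
    by rewrite ler_wpM2l// divr_ge0 ?powR_ge0 ?(ltW V0).
  rewrite divfK ?gt_eqF// divff ?gt_eqF//; lra.
rewrite -intE; apply: ge0_le_integral_nomeas => y _; rewrite big_seq1 lee_fin.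
  by rewrite mulr_ge0 ?indicE.
have [[xy Ey]|nB] := pselect ((ball x rho `\` E) y); last first.
  by rewrite indicE memNset// mulr0 mulr_ge0 ?cut_ge0 ?frac_weight_ge0.
rewrite indicE mem_set// mulr1 (cut_in Ex Ey) mulr1 /frac_weight /= !indicE (mem_set Ax).
rewrite mem_set ?mul1r; last first.
  apply: BA; apply: le_ball xy.
  have := @rad_le 0 j isT; rewrite -/rho /stop_radius expr0 divr1//.
have d0 : 0 < mdist x y by rewrite mdist_gt0; apply/eqP => exy; apply: Ey; rewrite -exy.
have Vd : 0 < V x (mdist x y) := vol_gt0 hdbl x d0.
move: xy; rewrite ballEmdist /= => /ltW xy.
rewrite /k /frac_kernel powRN -invfM lef_pV2 ?posrE ?mulr_gt0 ?powR_gt0//.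
rewrite ler_pM ?powR_ge0 ?(ltW Vd)//.
  by rewrite ge0_ler_powR ?nnegrE ?(ltW t0) ?(ltW d0) ?(ltW rho0).
by apply: (vol_le hdbl); rewrite mdistxx add0r.
Qed.

Lemma infinite_section_null (w : T * T -> R) (N : set T) :
  (forall p, 0 <= w p) -> finite_set_mu mu N -> (energy mu w E < +oo)%E ->
  (forall x M, N x -> (M%:E <= \int[m]_y (w (x, y) * cut E x y)%:E)%E) ->
  mass N = 0.
Proof.
move=> w0 fN eoo H; apply/eqP; rewrite eq_le mass_ge0 andbT leNgt; apply/negP => N0.
pose F := fine (energy mu w E).
have e0 := energy_ge0 mu E w0.
have FE : energy mu w E = F%:E by rewrite fineK// ge0_fin_numE.
have F0 : 0 <= F by rewrite -lee_fin -FE.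
pose k (_ : unit) : R := (F + 1) / mass N.
have k0 i : 0 <= k i by rewrite divr_ge0 ?addr_ge0 ?(ltW N0).
have := @integral_indic_sum _ _ mu unit [:: tt] k (fun=> N) k0 (fun=> fN).
rewrite big_seq1 divfK ?gt_eqF// => intE.
have : ((F + 1)%:E <= F%:E)%E.
  rewrite -intE -FE; apply: ge0_le_integral_nomeas => x _; rewrite big_seq1.
    by rewrite lee_fin mulr_ge0 ?indicE.
  have [Nx|nN] := pselect (N x); last first.
    by rewrite indicE memNset// mulr0; apply: integral_ge0 => y _; rewrite lee_fin mulr_ge0 ?cut_ge0.
  by rewrite indicE mem_set// mulr1; exact: H.
by rewrite lee_fin; lra.
Qed.

Let K1 : R := 192 * CP * c ^+ 16.

Lemma stop_estimate (x : T) (j : nat) (f : R) : ball x0 r x ->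
  stops x j.+1 -> ~ stops x j ->
  (energy mu (frac_weight mu theta (ball x ((P + 9) * stop_radius j.+1))) E <= f%:E)%E ->
  (V x (stop_radius j.+1) / V x0 r) `^ (1 - theta / Q) <=
    2 * c * C0 * K1 * (1 - theta) * r `^ theta / V x0 r * f.
Proof.
move=> xB st nst fle; set rho := stop_radius j.+1 in st fle *.
have rho0 : 0 < rho := rad0 _.
have V0 : 0 < V x rho := vol_gt0 hdbl x rho0.
have Vr0 : 0 < V x0 r := vol_gt0 hdbl x0 r0.
have fB := finite_set_mu_ball hreg hdbl x rho.
have f0 : 0 <= f.
  by rewrite -lee_fin (le_trans _ fle)// energy_ge0// => p; exact: frac_weight_ge0.
have rr : rho <= r.
  by have := @rad_le 1 j.+1 isT; rewrite -/rho /stop_radius expr1; lra.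
have upper : mass (ball x rho `&` E) <= 2^-1 * V x rho.
  have /negP := nst; rewrite -leNgt => h.
  apply: (@le_trans _ _ (mass (ball x (stop_radius j) `&` E))).
    apply: mass_le; last by apply: finite_set_mu_setI => //; exact: (finite_set_mu_ball hreg hdbl).
    by apply: setSI; apply: le_ball; exact: rad_le.
  apply: (le_trans h); rewrite radS -/rho -mulrA ler_wpM2l//.
  by rewrite [leLHS]mulrC ler_pdivrMr// [leRHS]mulrC; exact: (vol_double hdbl).
have low : 2^-1 / c * V x rho <= Num.min (mass (ball x rho `&` E)) (mass (ball x rho `\` E)).
  rewrite le_min (ltW st)/=.
  have := massID fB mE; rewrite -[mass (ball x rho)]/(V x rho) => h.
  have : 2^-1 / c * V x rho <= 2^-1 * V x rho.
    by rewrite ler_wpM2r ?(ltW V0)// ler_piMr// invf_le1.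
  by move: upper h; lra.
have := local_isoperimetric hreg hdbl c1 CP1 P1 hP x t0 t1 mE rho0.
rewrite -/K1 => iso.
have K10 : 0 < K1 by rewrite !mulr_gt0 ?exprn_gt0.
have u0 : 0 < 1 - theta by rewrite subr_gt0.
have main : 2^-1 / c * V x rho <= K1 * (1 - theta) * rho `^ theta * f.
  apply: (le_trans low); rewrite -lee_fin; apply: (le_trans iso).
  rewrite [leRHS]EFinM; apply: lee_wpmul2l fle.
  by rewrite lee_fin; apply: mulr_ge0 (powR_ge0 _ _); exact: mulr_ge0 (ltW K10) (ltW u0).
pose v := V x rho / V x0 r.
have v0 : 0 < v by rewrite divr_gt0.
have rhot : rho `^ theta <= r `^ theta * (C0 * v `^ (theta / Q)).
  have := hL rho0 rr xB; rewrite !(volE hdbl) inver gt_eqF// -EFinM lee_fin -/v => lmb.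
  have rr0 : 0 < rho / r by rewrite divr_gt0.
  have -> : rho = r * (rho / r) by rewrite mulrC divfK// gt_eqF.
  rewrite powRM ?(ltW r0) ?(ltW rr0)// ler_wpM2l ?powR_ge0//.
  have tQ : 0 < theta / Q by rewrite divr_gt0.
  have {lmb}lmb : (rho / r) `^ Q <= C0 * v 
    by have := ler_wpM2l (ltW C00) lmb; rewrite mulrA divff ?mul1r// gt_eqF.
  have -> : (rho / r) `^ theta = ((rho / r) `^ Q) `^ (theta / Q).
    by rewrite -powRrM; congr (_ `^ _); rewrite mulrC divfK// gt_eqF.
  apply: (@le_trans _ _ ((C0 * v) `^ (theta / Q))).
    apply: ge0_ler_powR; rewrite ?nnegrE ?powR_ge0 ?(ltW tQ)//.
    exact: mulr_ge0 (ltW C00) (ltW v0).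
  rewrite powRM ?(ltW C00) ?(ltW v0)// ler_wpM2r ?powR_ge0//.
  apply: ler1_powR => //; rewrite ler_pdivrMr// mul1r ltW//.
  exact: lt_trans t1 Q1.
have vt0 : 0 < v `^ (theta / Q) by rewrite powR_gt0.
have -> : v `^ (1 - theta / Q) = v / v `^ (theta / Q).
  rewrite (@powRD _ v 1 (- (theta / Q))); last by rewrite (gt_eqF v0) implybT.
  by rewrite powRr1 ?(ltW v0)// powRN.
rewrite ler_pdivrMr// {1}/v ler_pdivrMr//.
have h : 2^-1 / c * V x rho <= K1 * (1 - theta) * (r `^ theta * (C0 * v `^ (theta / Q))) * f.
  apply: (le_trans main); apply: ler_wpM2r => //.
  by apply: ler_wpM2l => //; exact: mulr_ge0 (ltW K10) (ltW u0).
have h2c : 0 <= 2 * c by rewrite mulr_ge0 ?(ltW c0).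
have := ler_wpM2l h2c h.
have -> : 2 * c * (2^-1 / c * V x rho) = V x rho by field; rewrite gt_eqF.
move=> /le_trans; apply; rewrite le_eqVlt; apply/orP; left; apply/eqP.
by field; rewrite gt_eqF.
Qed.

End stopping.

Section set_fractional.
Context {R : realType} {T : completeMetricType R}.
Variables (mu : {outer_measure set T -> \bar R}) (c CP P C0 Q : R).
Hypotheses (hreg : borel_regular mu) (hdbl : doubling mu c).
Hypotheses (c1 : 1 <= c) (CP1 : 1 <= CP) (P1 : 1 <= P).
Hypotheses (C01 : 1 <= C0) (Q1 : 1 < Q).
Hypothesis hP : poincare11 mu CP P.
Hypothesis hL : lower_mass_bound mu C0 Q.

Local Notation mass := (mass mu).
Local Notation V := (vol mu).
Let Tc : measurableType _ := caratheodory_type mu.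
Let m : {measure set Tc -> \bar R} := mu.

Let c0 : 0 < c. Proof. exact: lt_le_trans ltr01 c1. Qed.
Let CP0 : 0 < CP. Proof. exact: lt_le_trans ltr01 CP1. Qed.
Let P0 : 0 < P. Proof. exact: lt_le_trans ltr01 P1. Qed.
Let C00 : 0 < C0. Proof. exact: lt_le_trans ltr01 C01. Qed.
Let Q0 : 0 < Q. Proof. exact: lt_trans ltr01 Q1. Qed.

Variables (theta : R) (E : set T) (x0 : T) (r : R) (n0 : nat).
Hypotheses (t0 : 0 < theta) (t1 : theta < 1).
Hypotheses (mE : mu.-cara.-measurable E) (r0 : 0 < r).
Hypothesis hn0 : 2 * (P + 9) <= 2 ^+ n0.

Local Notation rad := (stop_radius r).
Local Notation stops := (stops mu c E r).

Let K1 : R := 192 * CP * c ^+ 16.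
Let A : set T := ball x0 (3 * (P + 9) * r).
Let en := energy mu (frac_weight mu theta A) E.
Let V0 : 0 < V x0 r. Proof. exact: (vol_gt0 hdbl x0 r0). Qed.
Let u0 : 0 < 1 - theta. Proof. by rewrite subr_gt0. Qed.
Let a : R := 1 - theta / Q.
Let X : R := 2 * c * C0 * K1 * (1 - theta) * r `^ theta / V x0 r.

Let a0 : 0 < a.
Proof. by rewrite subr_gt0 ltr_pdivrMr// mul1r (lt_trans t1). Qed.

Let a1 : a <= 1.
Proof. by rewrite gerBl divr_ge0 ?(ltW t0) ?(ltW Q0). Qed.

Let X0 : 0 < X.
Proof. by rewrite /X !mulr_gt0 ?invr_gt0 ?powR_gt0. Qed.

Let en0 : (0 <= en)%E.
Proof. by apply: energy_ge0 => p; exact: frac_weight_ge0. Qed.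

Let rad_gt0 j : 0 < rad j.
Proof. by rewrite divr_gt0 ?exprn_gt0 ?mulr_gt0. Qed.

Let rad_homo : {homo rad : i j / (i <= j)%N >-> j <= i}.
Proof.
move=> i j ij; apply: ler_wpM2l; first by rewrite mulr_ge0// ltW.
by rewrite lef_pV2 ?posrE ?exprn_gt0// ler_weXn2l// ler1n.
Qed.

Lemma exists_first_stop x : exists lev : nat, forall j, stops x j ->
  [/\ stops x lev, (lev <= j)%N & forall k, (k < lev)%N -> ~ stops x k].
Proof.
have [[i si]|nex] := pselect (exists j, stops x j); last first.
  by exists 0%N => j sj; exfalso; apply: nex; exists j.
have ex : exists j, `[< stops x j >] by exists i; apply/asboolP.
case: (ex_minnP ex) => lev /asboolP slev minl; exists lev => j sj; split => //.
  by apply: minl; apply/asboolP.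
move=> k klev sk; have := minl k; rewrite leqNgt klev => h.
by have /h : `[< stops x k >] by apply/asboolP.
Qed.

Lemma not_stops0 x : ball x0 r x ->
  mass (ball x0 (3 * r) `&` E) < 2^-1 / c * V x0 r -> ~ stops x 0.
Proof.
rewrite ballEmdist /= => xB small; rewrite /stops /stop_radius expr0 divr1 => /(lt_trans) st.
have h1 : mass (ball x (2 * r) `&` E) <= mass (ball x0 (3 * r) `&` E).
  apply: mass_le; last by apply: finite_set_mu_setI => //; exact: (finite_set_mu_ball hreg hdbl).
  by apply: setSI; apply: ball_subset; have hr := r0; lra.
have h2 : V x0 r <= V x (2 * r).
  by apply: (vol_le hdbl); rewrite metric_sym; have hr := r0; lra.
have h3 : 2^-1 / c * V x0 r <= 2^-1 / c * V x (2 * r).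
  by apply: ler_wpM2l => //; rewrite divr_ge0// ltW.
have := st _ (le_lt_trans h1 small); rewrite ltNge h3//.
Qed.

Let SJ (J : nat) : set T := [set x | [/\ ball x0 r x, E x & exists2 j, (j < J)%N & stops x j]].

Lemma measurable_stops j : mu.-cara.-measurable [set x | stops x j].
Proof.
pose f (x : Tc) : R := mass (ball x (rad j) `&` E) - 2^-1 / c * V x (rad j).
have mf : measurable_fun setT f.
  apply: measurable_funB.
    rewrite (_ : (fun x => _) = (fun x : Tc => fine (mu (E `&` ball (x : T) (rad j))))).
      exact: (measurable_mu_inter_ball hreg hdbl _ mE).
    by apply/funext => x; rewrite setIC.
  apply: measurable_funM; first exact: measurable_cst.
  rewrite (_ : (fun x => _) = (fun x : Tc => fine (mu (setT `&` ball (x : T) (rad j))))).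
    exact: (measurable_mu_inter_ball hreg hdbl _ measurableT).
  by apply/funext => x; rewrite setTI.
have := mf measurableT _ (measurable_itv `]0, +oo[); rewrite setTI.
congr (measurable _); apply/seteqP; split => x /=; rewrite in_itv /= andbT subr_gt0//.
Qed.

Let fSJ J : finite_set_mu mu (SJ J).
Proof.
apply: (finite_set_mu_sub _ _ (finite_set_mu_ball hreg hdbl x0 r)); last by move=> x [].
rewrite (_ : SJ J = ball x0 r `&` E `&` \bigcup_(j in [set j | (j < J)%N]) [set x | stops x j]).
  apply: measurableI; first by apply: measurableI => //; exact: (ball_cara hreg).
  by apply: bigcup_measurable => j _; exact: measurable_stops.
by apply/seteqP; split => x /=; [move=> [? ? [j ? ?]]; split => //; exists j|move=> [[? ?] [j ? ?]]; split => //; exists j].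
Qed.

Hypothesis small : mass (ball x0 (3 * r) `&` E) < 2^-1 / c * V x0 r.
Variable f : R.
Hypothesis enE : en = f%:E.

Lemma stopped_mass_le J : (mass (SJ J) / V x0 r) `^ a <= c ^+ n0 * (X * f).
Proof.
have /choice[lev levP] := exists_first_stop.
have lev_gt0 x : SJ J x -> (0 < lev x)%N /\ (lev x < J)%N.
  move=> [xB Ex [j jJ sj]]; have [slev levj _] := levP x j sj; split.
    by rewrite lt0n; apply/eqP => l0; apply: (not_stops0 xB small); rewrite -l0.
  exact: leq_ltn_trans levj jJ.
have P9 : 0 < P + 9 by rewrite addr_gt0.
pose g j := (P + 9) * rad j.
have g0 j : 0 < g j by rewrite mulr_gt0.
have gh : {homo g : i j / (i <= j)%N >-> j <= i}.
  by move=> i j ij; apply: ler_wpM2l (rad_homo ij); exact: ltW.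
have rad1 : rad 1 = r by rewrite /stop_radius expr1; field.
have SA x : SJ J x -> ball x (g (lev x)) `<=` A.
  move=> Sx; have [l0 _] := lev_gt0 x Sx; have [xB _ _] := Sx.
  apply: ball_subset; move: xB; rewrite ballEmdist /= => xB.
  have : g (lev x) <= (P + 9) * r by rewrite -rad1; exact: gh.
  have : 10 * r <= (P + 9) * r by apply: ler_wpM2r; [exact: ltW|have hp := P1; lra].
  by have hr := r0; move: xB; rewrite -mulrA; lra.
have [w [wS wd wcov]] := vitali_levels hreg hdbl J g0 gh SA.
have wSx x : x \in w -> SJ J x := wS x.
have masscov : mass (SJ J) <= \sum_(y <- w) V y (2 * g (lev y)).
  apply: (@le_trans _ _ (\sum_(y <- w) 1 * mass (ball y (2 * g (lev y))))); last first.
    by under eq_bigr do rewrite mul1r.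
  have := @indic_sum_le _ _ mu unit T [:: tt] (fun=> 1) (fun=> SJ J) w (fun=> 1)
    (fun y => ball y (2 * g (lev y))) (fun=> ler01) (fun=> fSJ J) (fun=> ler01)
    (fun y => finite_set_mu_ball hreg hdbl y _).
  rewrite big_seq1 mul1r; apply.
  move=> x; rewrite big_seq1 mul1r indicE; have [/[!inE] Sx|_] := boolP (x \in SJ J); last first.
    by rewrite sumr_ge0// => y _; rewrite mul1r indicE.
  have [_ lJ] := lev_gt0 x Sx; have [y yw yx] := wcov x Sx lJ.
  rewrite (big_rem y)//= mul1r indicE mem_set//= lerDl.
  by rewrite sumr_ge0// => y' _; rewrite mul1r indicE.
have [e eE] : exists e : T -> \bar R,
    forall y, e y = energy mu (frac_weight mu theta (ball y (g (lev y)))) E.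
  by eexists => y; reflexivity.
have e0 y : (0 <= e y)%E by rewrite eE; apply: energy_ge0 => p; exact: frac_weight_ge0.
have esum : (\sum_(y <- w) e y <= f%:E)%E.
  under eq_bigr do rewrite eE.
  rewrite -enE; apply: (energy_sum_le hreg hdbl) => //.
    by move=> y; exact: (ball_cara hreg).
  by move=> y /wSx; exact: SA.
have efin y : y \in w -> e y = (fine (e y))%:E.
  move=> yw; rewrite fineK// ge0_fin_numE//.
  apply: (@le_lt_trans _ _ f%:E); last exact: ltry.
  by rewrite -enE eE; apply: le_energy_frac; exact/SA/wSx.
have fsum : \sum_(y <- w) fine (e y) <= f.
  rewrite -lee_fin -sumEFin (le_trans _ esum)// big_seq [leRHS]big_seq.
  by apply: lee_sum => y /efin <-.
pose v y := V y (rad (lev y)) / V x0 r.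
have v0 y : 0 <= v y by rewrite divr_ge0 ?vol_ge0.
have est y : y \in w -> v y `^ a <= X * fine (e y).
  move=> yw; have Sy := wSx y yw; have [l0 _] := lev_gt0 y Sy.
  have [yB Ey [j jJ sj]] := Sy; have [slev _ nst] := levP y j sj.
  have ll : (lev y).-1.+1 = lev y by rewrite prednK.
  have := @stop_estimate _ _ mu c CP P C0 Q hreg hdbl c1 CP1 P1 C01 Q1 hP hL theta E x0 r t0 t1 mE r0
    y (lev y).-1 (fine (e y)) yB.
  rewrite ll; apply => //; first by apply: nst; rewrite -[ltnRHS]ll.
  by rewrite -/(g (lev y)) -eE -efin.
have vsum : (\sum_(y <- w) v y) `^ a <= X * f.
  apply: (le_trans (powR_sum_le a0 a1 (fun y _ => v0 y))).
  apply: (@le_trans _ _ (\sum_(y <- w) X * fine (e y))).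
    by rewrite big_seq [leRHS]big_seq; apply: ler_sum => y; exact: est.
  by rewrite -mulr_sumr; apply: ler_wpM2l fsum; exact: ltW.
have Sv : mass (SJ J) / V x0 r <= c ^+ n0 * \sum_(y <- w) v y.
  rewrite ler_pdivrMr//; apply: (le_trans masscov).
  rewrite -mulrA mulr_suml mulr_sumr; apply: ler_sum => y _.
  rewrite /v divfK ?gt_eqF//; apply: (vol_compare hdbl) => //.
  by rewrite mdistxx add0r /g mulrA ler_wpM2r// ltW.
have vs0 : 0 <= \sum_(y <- w) v y by apply: sumr_ge0.
have cn0 : 0 <= c ^+ n0 by rewrite exprn_ge0// ltW.
apply: (@le_trans _ _ ((c ^+ n0 * \sum_(y <- w) v y) `^ a)).
  apply: ge0_ler_powR Sv; first exact: ltW.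
    by rewrite nnegrE divr_ge0 ?mass_ge0// ltW.
  by rewrite nnegrE mulr_ge0.
rewrite powRM//; apply: ler_pM => //; rewrite ?powR_ge0//.
by apply: ler1_powR => //; exact: exprn_ege1.
Qed.

Lemma set_mass_le : (mass (ball x0 r `&` E) / V x0 r) `^ a <= c ^+ n0 * (X * f).
Proof.
set Y := c ^+ n0 * (X * f).
have f0 : 0 <= f by rewrite -lee_fin -enE.
have Y0 : 0 <= Y.
  apply: mulr_ge0; first exact: exprn_ge0 (ltW c0).
  exact: mulr_ge0 (ltW X0) f0.
pose S := \bigcup_J SJ J.
have fBE : finite_set_mu mu (ball x0 r `&` E).
  by apply: finite_set_mu_setI => //; exact: (finite_set_mu_ball hreg hdbl).
have mS : mu.-cara.-measurable S by apply: bigcup_measurable => J _; exact: (fSJ J).1.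
have SJle J : mass (SJ J) <= V x0 r * Y `^ a^-1.
  have := stopped_mass_le J; rewrite -/Y => h.
  have M0 : 0 <= mass (SJ J) / V x0 r by rewrite divr_ge0 ?mass_ge0// ltW.
  have : ((mass (SJ J) / V x0 r) `^ a) `^ a^-1 <= Y `^ a^-1.
    apply: ge0_ler_powR h; first by rewrite invr_ge0 ltW.
      by rewrite nnegrE powR_ge0.
    by rewrite nnegrE.
  rewrite -powRrM divff ?gt_eqF// powRr1// ler_pdivrMr// mulrC//.
have Sle : (mu S <= (V x0 r * Y `^ a^-1)%:E)%E.
  have cvgS : m \o SJ @ \oo --> m S.
    apply: nondecreasing_cvg_mu => //; first by move=> J; exact: (fSJ J).1.
    move=> i j ij; apply/subsetPset => x [xB Ex [k ki sk]]; split => //.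
    by exists k => //; exact: leq_trans ki ij.
  rewrite -[mu S]/(m S) -(cvg_lim _ cvgS)//; apply: lime_le; first by apply/cvg_ex; eexists; exact: cvgS.
  by apply: nearW => J /=; rewrite (massE (fSJ J)) lee_fin.
have SBE : ball x0 r `&` E `&` S = S.
  by apply/seteqP; split => x; [move=> []|move=> Sx; split => //; move: Sx => [J _ []]].
have N0 : mass ((ball x0 r `&` E) `\` S) = 0.
  apply: (@infinite_section_null _ _ mu E (frac_weight mu theta A)).
  - by move=> p; exact: frac_weight_ge0.
  - exact: finite_set_mu_setD.
  - by rewrite -/en enE ltry.
  move=> x M [[xB Ex] nS].
  have hP1 := P1; have hr := r0.
  have h10 : 10 * r <= (P + 9) * r by apply: ler_wpM2r; [exact: ltW|lra].
  apply: (never_stops_infinite hreg hdbl c1 t0 mE r0 _ Ex).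
  - apply: le_ball xB; move: h10; rewrite -mulrA; lra.
  - apply: ball_subset; move: xB; rewrite ballEmdist /= => xB.
    by move: h10; rewrite -mulrA; lra.
  - by move=> j sj; apply: nS; exists j.+1 => //; split => //; exists j.
have total : mass (ball x0 r `&` E) <= V x0 r * Y `^ a^-1.
  rewrite (massID fBE mS) SBE N0 addr0 -lee_fin -massE//.
  by apply: (finite_set_mu_sub _ _ fBE) => // x; rewrite -SBE => -[].
have : mass (ball x0 r `&` E) / V x0 r <= Y `^ a^-1 by rewrite ler_pdivrMr// mulrC.
move=> h; apply: (@le_trans _ _ ((Y `^ a^-1) `^ a)).
  apply: ge0_ler_powR h; first exact: ltW.
    by rewrite nnegrE divr_ge0 ?mass_ge0// ltW.
  by rewrite nnegrE powR_ge0.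
by rewrite -powRrM mulVf ?gt_eqF// powRr1.
Qed.

End set_fractional.

Section isoperimetric.
Context {R : realType} {T : completeMetricType R}.
Variables (mu : {outer_measure set T -> \bar R}) (c CP P C0 Q : R).
Hypotheses (hreg : borel_regular mu) (hdbl : doubling mu c).
Hypotheses (c1 : 1 <= c) (CP1 : 1 <= CP) (P1 : 1 <= P).
Hypotheses (C01 : 1 <= C0) (Q1 : 1 < Q).
Hypothesis hP : poincare11 mu CP P.
Hypothesis hL : lower_mass_bound mu C0 Q.

Local Notation mass := (mass mu).
Local Notation V := (vol mu).

Lemma set_fractional (theta q : R) (E : set T) (x0 : T) (r : R) (n0 : nat) :
  0 < theta -> theta < 1 -> 1 <= q -> q <= Q / (Q - theta) ->
  mu.-cara.-measurable E -> 0 < r -> 2 * (P + 9) <= 2 ^+ n0 ->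
  mass (ball x0 r `&` E) <= 2^-1 * V x0 r ->
  (((mass (ball x0 r `&` E) / V x0 r) `^ (q^-1))%:E <=
   (6 * c ^+ n0.+1 * C0 * (192 * CP * c ^+ 16) * (1 - theta) * r `^ theta / V x0 r)%:E *
   energy mu (frac_weight mu theta (ball x0 (3 * (P + 9) * r))) E)%E.
Proof.
move=> t0 t1 q1 qQ mE r0 hn0 half.
have c0 : 0 < c := lt_le_trans ltr01 c1.
have C00 : 0 < C0 := lt_le_trans ltr01 C01.
have Q0 : 0 < Q := lt_trans ltr01 Q1.
have [K1 K1E] : exists K, K = 192 * CP * c ^+ 16 by eexists; reflexivity.
have K10 : 0 < K1 by rewrite K1E !mulr_gt0 ?exprn_gt0// (lt_le_trans ltr01 CP1).
rewrite -K1E.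
have [en enE] : exists en, en = energy mu (frac_weight mu theta (ball x0 (3 * (P + 9) * r))) E.
  by eexists; reflexivity.
have en0 : (0 <= en)%E by rewrite enE; apply: energy_ge0 => p; exact: frac_weight_ge0.
rewrite -enE.
have V0 : 0 < V x0 r := vol_gt0 hdbl x0 r0.
have u0 : 0 < 1 - theta by rewrite subr_gt0.
have rt0 : 0 < r `^ theta by rewrite powR_gt0.
set M := mass (ball x0 r `&` E) in half *.
have M0 : 0 <= M / V x0 r by rewrite divr_ge0 ?mass_ge0// ltW.
have M1 : M / V x0 r <= 1.
  by rewrite ler_pdivrMr// mul1r (le_trans half)// ler_piMl ?(ltW V0)//; lra.
have q0 : 0 < q := lt_le_trans ltr01 q1.
have cn : 1 <= c ^+ n0 by exact: exprn_ege1.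
have fB s := finite_set_mu_ball hreg hdbl x0 s.
have coef0 : 0 < 6 * c ^+ n0.+1 * C0 * K1 * (1 - theta) * r `^ theta / V x0 r.
  by rewrite !mulr_gt0 ?invr_gt0 ?exprn_gt0.
have [big|small] := leP (2^-1 / c * V x0 r) (mass (ball x0 (3 * r) `&` E)).
  have r30 : 0 < 3 * r by rewrite mulr_gt0.
  have := local_isoperimetric hreg hdbl c1 CP1 P1 hP x0 t0 t1 mE r30.
  rewrite (_ : (P + 9) * (3 * r) = 3 * (P + 9) * r); last by ring.
  rewrite -enE -K1E => iso.
  have c2 : 2^-1 / c * V x0 r <= 2^-1 * V x0 r.
    by rewrite ler_wpM2r ?(ltW V0)// ler_piMr// invf_le1.
  have low : 2^-1 / c * V x0 r <= Num.min (mass (ball x0 (3 * r) `&` E)) (mass (ball x0 (3 * r) `\` E)).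
    rewrite le_min big/=.
    have : mass (ball x0 r `\` E) <= mass (ball x0 (3 * r) `\` E).
      apply: mass_le; last by apply: finite_set_mu_setD.
      by apply: setSD; apply: le_ball; lra.
    have := massID (fB r) mE; rewrite -[mass (ball x0 r)]/(V x0 r) -/M.
    by move: half c2; lra.
  have k0 : 0 <= 2 * c / V x0 r by rewrite !mulr_ge0 ?invr_ge0 ?(ltW c0) ?(ltW V0).
  apply: (@le_trans _ _ 1%:E).
    have qi0 : 0 <= q^-1 by rewrite invr_ge0 ltW.
    have := @ge0_ler_powR R _ qi0 (M / V x0 r) 1; rewrite !nnegrE M0 ler01 powR1 lee_fin.
    exact.
  apply: (@le_trans _ _ ((2 * c / V x0 r)%:E * (2^-1 / c * V x0 r)%:E)%E).
    by rewrite -EFinM (_ : _ * (_ * _) = 1)//; field; rewrite !gt_eqF.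
  apply: (@le_trans _ _ ((2 * c / V x0 r)%:E * ((K1 * (1 - theta) * (3 * r) `^ theta)%:E * en))%E).
    apply: lee_wpmul2l; first by rewrite lee_fin.
    by apply: le_trans iso; rewrite lee_fin.
  rewrite muleA -EFinM; apply: lee_wpmul2r => //; rewrite lee_fin.
  have r3 : (3 * r) `^ theta <= 3 * r `^ theta.
    by rewrite powRM ?(ltW r0)// ler_wpM2r ?powR_ge0// ler1_powR ?ler1n ?(ltW t1).
  rewrite (_ : _ * (_ * _) = 2 * c / V x0 r * K1 * (1 - theta) * (3 * r) `^ theta); last by ring.
  have k1 : 0 <= 2 * c / V x0 r * K1 * (1 - theta).
    by rewrite mulr_ge0 ?(ltW u0)// mulr_ge0 ?(ltW K10).
  apply: (le_trans (ler_wpM2l k1 r3)).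
  rewrite (_ : _ * (3 * _) = 6 * c * K1 * (1 - theta) * r `^ theta / V x0 r * 1); last by ring.
  rewrite (_ : 6 * c ^+ n0.+1 * _ * _ * _ * _ / _ = 6 * c * K1 * (1 - theta) * r `^ theta / V x0 r * (c ^+ n0 * C0)); last by rewrite exprS; ring.
  apply: ler_wpM2l; last by rewrite -[leLHS]mulr1 ler_pM.
  by rewrite !mulr_ge0 ?invr_ge0 ?(ltW c0) ?(ltW V0) ?(ltW K10) ?(ltW u0) ?(ltW rt0).
have [enoo|enfin] := eqVneq en +oo%E.
  by rewrite enoo gt0_muley ?leey// lte_fin.
have {enfin}[f fE] : exists f, en = f%:E.
  by exists (fine en); rewrite fineK// ge0_fin_numE// ltey.
have f0 : 0 <= f by rewrite -lee_fin -fE.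
have efE : energy mu (frac_weight mu theta (ball x0 (3 * (P + 9) * r))) E = f%:E by rewrite -enE.
have := set_mass_le hreg hdbl c1 CP1 P1 C01 Q1 hP hL t0 t1 mE r0 hn0 small efE.
rewrite -/M -K1E => h.
rewrite fE -EFinM lee_fin.
apply: (@le_trans _ _ ((M / V x0 r) `^ (1 - theta / Q))).
  have [->|Mn0] := eqVneq (M / V x0 r) 0; first by rewrite powR0 ?powR_ge0// invr_eq0 gt_eqF.
  have Mgt : 0 < M / V x0 r by rewrite lt_neqAle eq_sym Mn0.
  rewrite ger_powR ?Mgt//.
  have Qt : 0 < Q - theta by rewrite subr_gt0 (lt_trans t1).
  rewrite -[leRHS]mul1r ler_pdivlMr//.
  apply: (@le_trans _ _ ((1 - theta / Q) * (Q / (Q - theta)))).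
    by apply: ler_wpM2l qQ; rewrite subr_ge0 ler_pdivrMr// mul1r ltW// (lt_trans t1).
  rewrite le_eqVlt; apply/orP; left; apply/eqP; field; rewrite !gt_eqF//.
apply: (le_trans h).
have w0 : 0 <= 2 * c ^+ n0.+1 * C0 * K1 * (1 - theta) * r `^ theta / V x0 r * f.
  rewrite mulr_ge0//; apply: ltW; by rewrite !mulr_gt0 ?invr_gt0 ?exprn_gt0.
rewrite (_ : c ^+ n0 * _ = 2 * c ^+ n0.+1 * C0 * K1 * (1 - theta) * r `^ theta / V x0 r * f);
  last by rewrite exprS; ring.
rewrite (_ : 6 * _ * _ * _ * _ * _ / _ * _ = 3 * (2 * c ^+ n0.+1 * C0 * K1 * (1 - theta) * r `^ theta / V x0 r * f)); last by ring.
by move: w0; lra.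
Qed.

End isoperimetric.

(** * From level sets to functions *)

Definition dyadic_pt {R : realType} (h : R) (k : nat) : R :=
  if k is k'.+1 then 2 ^+ k' * h else 0.

Section dyadic_layers.
Context {R : realType}.
Variable h : R.
Hypothesis h0 : 0 < h.

Local Notation e := (dyadic_pt h).

Lemma dyadic_pt_gt0 k : 0 < e k.+1.
Proof. by rewrite mulr_gt0 ?exprn_gt0. Qed.

Lemma dyadic_pt_ge0 k : 0 <= e k.
Proof. by case: k => [//|k]; exact/ltW/dyadic_pt_gt0. Qed.

Lemma dyadic_pt_step k : e k.+1 <= 2 * (e k.+1 - e k).
Proof.
case: k => [|k]; first by rewrite /= expr0 mul1r; have hh := h0; lra.
by rewrite /= exprS le_eqVlt; apply/orP; left; apply/eqP; ring.
Qed.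

Lemma dyadic_pt_homo : {homo e : i j / (i <= j)%N >-> i <= j}.
Proof.
move=> [|i] [|j]//; first by move=> _; exact: dyadic_pt_ge0.
by rewrite ltnS => ij; rewrite ler_wpM2r ?(ltW h0)// ler_weXn2l// ler1n.
Qed.

Lemma dyadic_step_integral (phi : R -> R) (G : R -> \bar R) (a : R) (n : nat) :
  (forall s, 0 <= phi s) -> (forall s t : R, s <= t -> phi t <= phi s) ->
  (forall t, (0 <= G t)%E) -> (forall s : R, 0 < s -> ((phi s)%:E <= G (a + s)%R)%E) ->
  ((\sum_(0 <= k < n) (e k.+1 - e k) * phi (e k.+1))%:E <=
   \int[(@lebesgue_measure R : {measure set (measurableTypeR R) -> \bar R})]_t G t)%E.
Proof.
move=> phi0 phile G0 phiG.
pose leb : {measure set (measurableTypeR R) -> \bar R} := @lebesgue_measure R.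
pose I k : set (measurableTypeR R) := `]a + e k, a + e k.+1[%classic.
have mI k : measurable (I k) by exact: measurable_itv.
have sE : (\int[leb]_t (\sum_(0 <= k < n) ((phi (e k.+1))%:E * (\1_(I k) t)%:E)%E) =
    (\sum_(0 <= k < n) (e k.+1 - e k) * phi (e k.+1))%:E)%E.
  rewrite ge0_integral_sum//; last 2 first.
  - move=> k; apply/measurable_EFinP; apply: measurable_funM; first exact: measurable_cst.
    exact: measurable_indic.
  - by move=> k t _; rewrite -EFinM lee_fin mulr_ge0 ?indicE.
  rewrite -sumEFin; apply: eq_bigr => k _.
  rewrite ge0_integralZl//; last 2 first.
  - by apply/measurable_EFinP/measurable_indic.
  - by rewrite lee_fin.
  rewrite integral_indic// setIT.
  have -> : leb (I k) = (e k.+1 - e k)%:E.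
    transitivity (lebesgue_measure (I k)) => //.
    rewrite /I lebesgue_measure_itv /= lte_fin ltrD2l -EFinB.
    have -> : e k < e k.+1.
      by have := dyadic_pt_step k; have := dyadic_pt_gt0 k; lra.
    by congr EFin; ring.
  by rewrite -EFinM mulrC.
rewrite -sE; apply: ge0_le_integral_nomeas => t _.
  by apply: sume_ge0 => k _; rewrite -EFinM lee_fin mulr_ge0 ?indicE.
have [[j [jn Ij]]|nI] := pselect (exists j, (j < n)%N /\ I j t); last first.
  rewrite big_nat big1 ?G0// => i /andP[_ ilt].
  by rewrite indicE memNset ?mule0// => Ii; apply: nI; exists i.
have Ijx : a + e j < t < a + e j.+1 by move: Ij; rewrite /I /= in_itv.
rewrite big_mkord (bigD1 (Ordinal jn))//= big1 ?adde0; last first.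
  move=> i /eqP ij; rewrite indicE memNset ?mule0//.
  rewrite /I /= in_itv /= => /andP[ix xi].
  move: Ijx => /andP[jx xj].
  case: (ltnP i j) => [ltij|].
    by have := dyadic_pt_homo ltij; move: xi jx => /= xi jx; lra.
  rewrite leq_eqVlt => /orP[/eqP ji|ltji]; last first.
    by have := dyadic_pt_homo ltji; move: ix xj => /= ix xj; lra.
  by apply: ij; apply/val_inj.
rewrite indicE mem_set// mule1; move: Ijx => /andP[jx xj].
have tE : t = a + (t - a) by ring.
rewrite [in leRHS]tE; apply: le_trans (phiG _ _).
  by rewrite lee_fin; apply: phile; rewrite lerBlDr addrC ltW.
by have := dyadic_pt_ge0 j; move: jx; lra.
Qed.

Lemma powR_layer_le (q x : R) : 1 <= q ->
  ((Num.max 0 x `^ q)%:E <= (h `^ q)%:E +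
   \sum_(0 <= k <oo) ((2 * e k.+1) `^ q * (e k.+1 < x)%R%:R)%:E)%E.
Proof.
move=> q1; have q0 : 0 <= q := le_trans ler01 q1.
have s0 k : (0 <= ((2 * e k.+1) `^ q * (e k.+1 < x)%R%:R)%:E)%E.
  by rewrite lee_fin mulr_ge0 ?powR_ge0.
have [xh|hx] := leP x h.
  apply: (@le_trans _ _ (h `^ q)%:E); last first.
    by rewrite leeDl//; apply: nneseries_ge0 => k _ _; exact: s0.
  by rewrite lee_fin ge0_ler_powR// ?nnegrE ?le_max ?lexx ?ge_max ?(ltW h0)//=.
have [n nP] := exists_exp2_ge (x / h).
have ex : exists n, x <= 2 ^+ n * h by exists n; rewrite -ler_pdivrMr.
case: (ex_minnP ex) => -[|k] xk mink; first by move: xk; rewrite expr0 mul1r leNgt hx.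
have ek : e k.+1 < x.
  by rewrite ltNge; apply/negP => xe; have := mink k xe; rewrite ltnn.
have x0 : 0 <= x := ltW (lt_trans h0 hx).
apply: (@le_trans _ _ ((2 * e k.+1) `^ q)%:E).
  have e0 : 0 <= 2 * e k.+1 by rewrite mulr_ge0// dyadic_pt_ge0.
  by rewrite lee_fin max_r// ge0_ler_powR//= mulrA -exprS.
apply: (@le_trans _ _ (\sum_(0 <= i <oo) ((2 * e i.+1) `^ q * (e i.+1 < x)%R%:R)%:E)%E); last first.
  by rewrite leeDr// lee_fin powR_ge0.
apply: (le_trans _ (nneseries_lim_ge k.+1 (fun i _ _ => s0 i))).
rewrite big_nat_recr//= ek mulr1 leeDr//; apply: sume_ge0 => i _; exact: s0.
Qed.

End dyadic_layers.

Section strong_type.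
Local Open Scope ereal_scope.
Context d (T : measurableType d) (R : realType) (m : {measure set T -> \bar R}).
Variables (B : set T) (V : R) (v : T -> R) (a q Psi : R).
Hypotheses (mB : measurable B) (mBV : m B = V%:E) (V0 : (0 < V)%R).
Hypotheses (mv : measurable_fun setT v) (q1 : (1 <= q)%R) (Psi0 : (0 <= Psi)%R).

Definition tail_norm (s : R) : R := ((fine (m (B `&` [set x | (a + s < v x)%R])) / V) `^ (q^-1))%R.

Let q0 : (0 < q)%R. Proof. exact: lt_le_trans ltr01 q1. Qed.

Let mS s : measurable [set x | (a + s < v x)%R].
Proof.
have := mv measurableT (measurable_itv `](a + s)%R, +oo[); rewrite setTI.
by congr measurable; apply/seteqP; split => x /=; rewrite in_itv /= andbT.
Qed.

Let finS s : m (B `&` [set x | (a + s < v x)%R]) \is a fin_num.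
Proof.
rewrite ge0_fin_numE//; apply: (@le_lt_trans _ _ (m B)); last by rewrite mBV ltry.
by apply: le_measure; rewrite ?inE//; exact: measurableI.
Qed.

Lemma tail_norm_ge0 s : (0 <= tail_norm s)%R. Proof. exact: powR_ge0. Qed.

Lemma tail_norm_le s t : (s <= t)%R -> (tail_norm t <= tail_norm s)%R.
Proof.
move=> st; have V0' := ltW V0.
rewrite ge0_ler_powR ?nnegrE ?invr_ge0 ?(ltW q0)// ?divr_ge0 ?fine_ge0//.
rewrite ler_wpM2r ?invr_ge0// fine_le//.
apply: le_measure; rewrite ?inE; [exact: measurableI|exact: measurableI|].
by move=> x [Bx /= xt]; split => //=; apply: le_lt_trans xt; rewrite lerD2l.
Qed.

Lemma strong_type_of_layers :
  (forall (h : R) n, (0 < h)%R -> (\sum_(0 <= k < n) (dyadic_pt h k.+1 - dyadic_pt h k) *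
     tail_norm (dyadic_pt h k.+1) <= Psi)%R) ->
  \int[m]_(x in B) ((Num.max 0 (v x - a) `^ q)%R)%:E <= (V * (4 * Psi) `^ q)%:E.
Proof.
move=> H; have V0' := ltW V0; have q0' := ltW q0.
suff step (h : R) : (0 < h)%R ->
    \int[m]_(x in B) ((Num.max 0 (v x - a) `^ q)%R)%:E <=
    (V * h `^ q)%:E + (V * (4 * Psi) `^ q)%:E.
  apply/lee_addgt0Pr => eps eps0.
  have h0 : (0 < (eps / V) `^ q^-1)%R by rewrite powR_gt0// divr_gt0.
  apply: (le_trans (step _ h0)); rewrite addeC leeD2l// lee_fin.
  by rewrite -powRrM mulVf ?gt_eqF// powRr1 ?divr_ge0 ?(ltW eps0)// mulrC divfK// gt_eqF.
move=> h0; pose e := dyadic_pt h.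
have e0 k : (0 <= e k)%R by exact: dyadic_pt_ge0.
pose S k := [set x | (a + e k.+1 < v x)%R].
pose f k x : \bar R := ((2 * e k.+1) `^ q)%:E * (\1_(S k) x)%:E.
have f0 k x : 0 <= f k x by rewrite /f -EFinM lee_fin mulr_ge0 ?powR_ge0 ?indicE.
have mf k : measurable_fun B (f k).
  apply/measurable_EFinP; apply: measurable_funM; first exact: measurable_cst.
  by apply: measurable_indic; exact: mS.
apply: (@le_trans _ _ (\int[m]_(x in B) ((h `^ q)%:E + \sum_(0 <= k <oo) f k x))).
  apply: ge0_le_integral_nomeas => x Bx; first by rewrite lee_fin powR_ge0.
  apply: (le_trans (powR_layer_le h0 (v x - a) q1)); rewrite leeD2l//.
  apply: lee_nneseries => k _; first by rewrite lee_fin mulr_ge0 ?powR_ge0.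
  rewrite /f -EFinM indicE; suff -> : (x \in S k) = (e k.+1 < v x - a)%R by [].
  by rewrite ltrBrDl; apply/idP/idP => [/[!inE]|Sx]; rewrite ?inE.
have ms : measurable_fun B (fun x => \sum_(0 <= k <oo) f k x).
  by apply: (ge0_emeasurable_sum (P := xpredT)) => //= k x _ _; exact: f0.
rewrite ge0_integralD//; last 2 first.
- by move=> x _; rewrite lee_fin powR_ge0.
- by move=> x _; apply: nneseries_ge0 => k _ _; exact: f0.
rewrite integral_cst// mBV -EFinM mulrC leeD2l//.
rewrite integral_nneseries//.
apply: lime_le; first by apply: is_cvg_nneseries => k _ _; apply: integral_ge0 => x _; exact: f0.
apply: nearW => n.
have intf k : \int[m]_(x in B) f k x = (V * (2 * e k.+1 * tail_norm (e k.+1)) `^ q)%:E.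
  rewrite /f ge0_integralZl//; last 2 first.
  - by apply/measurable_EFinP; apply: measurable_indic; exact: mS.
  - by rewrite lee_fin powR_ge0.
  rewrite integral_indic//; last exact: mS.
  rewrite setIC /S -(fineK (finS _)) -EFinM; congr EFin.
  rewrite [in RHS]powRM ?tail_norm_ge0 ?(mulr_ge0 _ (e0 _))// /tail_norm -powRrM mulVf ?gt_eqF//.
  by rewrite powRr1 ?divr_ge0 ?fine_ge0//; field; rewrite gt_eqF.
under eq_bigr do rewrite intf; rewrite sumEFin lee_fin -mulr_sumr ler_wpM2l//.
set b := fun k => (2 * e k.+1 * tail_norm (e k.+1))%R.
have b0 k : (0 <= b k)%R by rewrite /b mulr_ge0 ?tail_norm_ge0// mulr_ge0.
have qi0 : (0 < q^-1)%R by rewrite invr_gt0.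
have qi1 : (q^-1 <= 1)%R by rewrite invf_le1.
have sub : (\sum_(0 <= k < n) b k `^ q <= (\sum_(0 <= k < n) b k) `^ q)%R.
  have := powR_sum_le qi0 qi1 (fun k (_ : k \in index_iota 0 n) => powR_ge0 (b k) q).
  rewrite [leRHS](eq_bigr b); last by move=> k _; rewrite -powRrM divff ?gt_eqF// powRr1.
  have s0 : (0 <= \sum_(0 <= k < n) b k `^ q)%R by apply: sumr_ge0 => k _; exact: powR_ge0.
  move=> le1; have := @ge0_ler_powR _ q q0' _ _ _ _ le1.
  rewrite !nnegrE powR_ge0 sumr_ge0// -powRrM mulVf ?gt_eqF// powRr1//; exact.
apply: (le_trans sub); apply: ge0_ler_powR => //; rewrite ?nnegrE ?sumr_ge0 ?mulr_ge0//.
apply: le_trans (ler_wpM2l (ler0n _ 4) (H h n h0)); rewrite mulr_sumr; apply: ler_sum => k _.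
rewrite /b [leRHS]mulrA ler_wpM2r ?tail_norm_ge0//.
by have := dyadic_pt_step h0 k; rewrite -/e; lra.
Qed.

End strong_type.

Section oscillation.
Local Open Scope ereal_scope.
Context d (T : measurableType d) (R : realType) (m : {measure set T -> \bar R}).
Variables (B : set T) (V : R) (v : T -> R).
Hypotheses (mB : measurable B) (mBV : m B = V%:E) (V0 : (0 < V)%R).
Hypotheses (mv : measurable_fun setT v) (iv : m.-integrable B (EFin \o v)).

Let mv_gt s : measurable [set x | (s < v x)%R].
Proof.
have := mv measurableT (measurable_itv `]s, +oo[); rewrite setTI.
by congr measurable; apply/seteqP; split => x /=; rewrite in_itv /= andbT.
Qed.

Let le_half A A' : measurable A -> measurable A' -> A `<=` A' -> m A' <= (V / 2)%:E -> m A <= (V / 2)%:E.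
Proof. by move=> mA mA' AA'; apply: le_trans; apply: le_measure; rewrite ?inE. Qed.

Let mBI A : measurable A -> exists2 s : R, m (B `&` A) = s%:E & m (B `&` ~` A) = (V - s)%:E.
Proof.
move=> mA; have fin : m (B `&` A) \is a fin_num.
  rewrite ge0_fin_numE//; apply: (@le_lt_trans _ _ (m B)); last by rewrite mBV ltry.
  by apply: le_measure; rewrite ?inE//; exact: measurableI.
exists (fine (m (B `&` A))); first by rewrite fineK.
have fB : m B < +oo by rewrite mBV ltry.
rewrite -setDE; transitivity (m B - m (B `&` A)); first exact: measureD.
by rewrite mBV -[m (B `&` A)]fineK.
Qed.

Let mv_abs (s : R) : measurable [set x | (s <= `|v x|)%R].
Proof.
have mn : measurable_fun setT (fun x => `|v x|%R) by exact: measurableT_comp.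
have := mn measurableT _ (measurable_itv `[s, +oo[); rewrite setTI.
by congr measurable; apply/seteqP; split => x /=; rewrite in_itv /= andbT.
Qed.

Lemma median_exists : exists b : R,
  (forall t, (b < t)%R -> m (B `&` [set x | (t < v x)%R]) <= (V / 2)%:E) /\
  (forall t, (t < b)%R -> m (B `&` [set x | (v x <= t)%R]) <= (V / 2)%:E).
Proof.
have V0' := V0.
have complE t : [set x | (v x <= t)%R] = ~` [set x | (t < v x)%R].
  by apply/seteqP; split => x /=; [move=> h; apply/negP; rewrite -leNgt|move/negP; rewrite -leNgt].
pose S := [set t : R | (V / 2)%:E < m (B `&` [set x | (t < v x)%R])].
have [t0 t00 tail] : exists2 t0 : R, (0 < t0)%R & m (B `&` [set x | (t0 <= `|v x|)%R]) < (V / 2)%:E.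
  have [/measurable_EFinP mvB fin] := integrableP _ _ _ iv.
  pose I := \int[m]_(x in B) `|(v x)%:E|.
  have I0 : 0 <= I by apply: integral_ge0.
  have If : I \is a fin_num by rewrite ge0_fin_numE.
  have I0' : (0 <= fine I)%R by rewrite fine_ge0.
  pose t0 := (2 * (fine I + 1) / V)%R.
  have t00 : (0 < t0)%R by rewrite /t0 divr_gt0// mulr_gt0//; lra.
  exists t0 => //.
  have /measurable_EFinP mvE := mvB.
  have := le_integral_abse m mB mvE t00; rewrite -/I -(fineK If).
  have -> : [set x | t0%:E <= `|(EFin \o v) x|] = [set x | (t0 <= `|v x|)%R].
    by apply/seteqP; split => x /=; rewrite lee_fin.
  have [s -> _] := mBI (mv_abs t0); rewrite -EFinM lee_fin lte_fin => le1.
  rewrite -(ltr_pM2l t00); apply: (le_lt_trans le1).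
  rewrite (_ : t0 * (V / 2) = fine I + 1)%R; first lra.
  by rewrite /t0; field; rewrite gt_eqF.
have Sub : ubound S t0.
  move=> t St; rewrite leNgt; apply/negP => tt; move: St; rewrite /S /= ltNge => /negP; apply.
  apply: le_half (ltW tail); [exact: measurableI|exact: measurableI|].
  move=> x [Bx /= tx]; split => //=; apply: le_trans (ler_norm _); lra.
have Sne : S (- t0 - 1)%R.
  rewrite /S /= ltNge; apply/negP.
  have [s -> sE] := mBI (mv_gt (- t0 - 1)%R); rewrite lee_fin => sV.
  have : (V - s)%:E < (V / 2)%:E.
    rewrite -sE; apply: le_lt_trans tail; apply: le_measure; rewrite ?inE.
    - by apply: measurableI => //; exact/measurableC/mv_gt.
    - exact: measurableI.
    move=> x [Bx /= /negP]; rewrite -leNgt => vx; split => //=.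
    by rewrite ler_normr; apply/orP; right; lra.
  by rewrite lte_fin; lra.
have hS : has_sup S by split; [exists (- t0 - 1)%R|exists t0].
exists (sup S); split => t.
  by move=> St; rewrite leNgt; apply/negP => tS; have := sup_upper_bound hS tS; rewrite leNgt St.
move=> tS; have e0 : (0 < sup S - t)%R by rewrite subr_gt0.
have [s Ss] := sup_adherent e0 hS; rewrite opprB addrCA subrr addr0 => ts.
apply: (@le_half _ (B `&` [set x | (v x <= s)%R])).
- by apply: measurableI => //; rewrite complE; exact/measurableC.
- by apply: measurableI => //; rewrite complE; exact/measurableC.
- by move=> x [Bx /= vt]; split => //=; apply: le_trans vt (ltW ts).
rewrite complE; have [a aE ->] := mBI (mv_gt s).
by move: Ss; rewrite /S /= aE lte_fin lee_fin; lra.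
Qed.

Let measurable_dist_pow (a p : R) : measurable_fun B (fun x => ((`|v x - a| `^ p)%R)%:E).
Proof.
apply/measurable_EFinP; apply: (measurableT_comp (measurable_powR p)).
apply: measurableT_comp => //; apply: measurable_funB => //.
by apply: measurable_funS mv.
Qed.

Lemma oscillation_le_of_tails (b q Psi : R) : (1 <= q)%R -> (0 <= Psi)%R ->
  (forall p, (1 <= p)%R -> (p <= q)%R ->
    \int[m]_(x in B) ((Num.max 0 (v x - b) `^ p)%R)%:E <= (V * (4 * Psi) `^ p)%:E /\
    \int[m]_(x in B) ((Num.max 0 (b - v x) `^ p)%R)%:E <= (V * (4 * Psi) `^ p)%:E) ->
  \int[m]_(x in B) ((`|v x - fine (\int[m]_(y in B) (v y)%:E) / V| `^ q)%R)%:E <=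
  (V * (32 * Psi) `^ q)%:E.
Proof.
move=> q1 Psi0 H; have V0' := V0.
have q0 : (0 <= q)%R := le_trans ler01 q1.
have mvB : measurable_fun B v by apply: measurable_funS mv.
have mmax p (f : T -> R) : measurable_fun B f ->
    measurable_fun B (fun x => ((Num.max 0 (f x) `^ p)%R)%:E).
  move=> mf; apply/measurable_EFinP; apply: (measurableT_comp (measurable_powR p)).
  exact: measurable_maxr.
have both p : (1 <= p)%R -> (p <= q)%R ->
    \int[m]_(x in B) ((`|v x - b| `^ p)%R)%:E <= (2 * V * (4 * Psi) `^ p)%:E.
  move=> p1 pq; have [H1 H2] := H p p1 pq.
  rewrite (_ : 2 * V * _ = V * (4 * Psi) `^ p + V * (4 * Psi) `^ p)%R; last by ring.
  rewrite EFinD; apply: le_trans (leeD H1 H2).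
  rewrite -ge0_integralD//; last 4 first.
  - by move=> x _; rewrite lee_fin powR_ge0.
  - by apply: mmax; apply: measurable_funB.
  - by move=> x _; rewrite lee_fin powR_ge0.
  - by apply: mmax; apply: measurable_funB.
  apply: ge0_le_integral_nomeas => x _; first by rewrite lee_fin powR_ge0.
  rewrite -EFinD lee_fin; have [vb|bv] := leP b (v x).
    by rewrite ger0_norm ?subr_ge0// (max_r (_ : 0 <= v x - b)%R) ?subr_ge0// lerDl powR_ge0.
  rewrite distrC gtr0_norm ?subr_gt0//.
  by rewrite [X in (_ <= _ + X `^ _)%R]max_r ?subr_ge0 ?(ltW bv)// lerDr powR_ge0.
set a := (fine _ / V)%R.
have Psi8 : (`|a - b| <= 8 * Psi)%R.
  have ib : m.-integrable B (EFin \o cst b).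
    apply/integrableP; split; first exact/measurable_EFinP.
    have -> : \int[m]_(x in B) `|(EFin \o cst b) x| = (`|b|%R)%:E * m B by rewrite -integral_cst.
    by rewrite mBV -EFinM ltry.
  have If := integrable_fin_num mB iv.
  have dE : \int[m]_(x in B) ((v x)%:E - b%:E) = (V * (a - b))%:E.
    rewrite (integralB_EFin mB iv ib).
    have -> : \int[m]_(x in B) (cst b x)%:E = b%:E * m B by rewrite -integral_cst.
    rewrite mBV.
    rewrite -[X in X - _]fineK// -EFinM -EFinB /a; congr EFin; field.
    by rewrite gt_eqF.
  have mE : measurable_fun B (fun x => (v x)%:E - b%:E).
    by apply/measurable_EFinP; apply: measurable_funB.
  have := le_abse_integral m mB mE; rewrite dE abse_EFin normrM gtr0_norm// => le1.
  have := both 1%R (lexx _) q1.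
  under eq_integral do rewrite powRr1//.
  move=> /(le_trans le1); rewrite powRr1 ?mulr_ge0// lee_fin.
  rewrite (_ : 2 * V * (4 * Psi) = V * (8 * Psi))%R; last by ring.
  by rewrite ler_pM2l.
have two_sum (x y : R) : (0 <= x)%R -> (0 <= y)%R -> ((x + y) `^ q <= 2 `^ q * (x `^ q + y `^ q))%R.
  move=> x0 y0; wlog xy : x y x0 y0 / (x <= y)%R.
    by move=> W; have [/W|/ltW/W] := leP x y; [exact|rewrite addrC [(y `^ q + _)%R]addrC; exact].
  apply: (@le_trans _ _ ((2 * y) `^ q)%R).
    by apply: ge0_ler_powR; rewrite ?nnegrE ?addr_ge0 ?mulr_ge0//; lra.
  by rewrite powRM// ler_wpM2l ?powR_ge0// lerDr powR_ge0.
apply: (@le_trans _ _ (\int[m]_(x in B)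
    ((2 `^ q)%R%:E * (((`|v x - b| `^ q)%R)%:E + ((8 * Psi) `^ q)%R%:E)))).
  apply: ge0_le_integral_nomeas => x _; first by rewrite lee_fin powR_ge0.
  rewrite -EFinD -EFinM lee_fin; apply: le_trans (two_sum _ _ _ _); rewrite ?mulr_ge0//.
  apply: ge0_ler_powR; rewrite ?nnegrE ?addr_ge0 ?mulr_ge0//.
  by apply: (le_trans (ler_distD b _ _)); rewrite lerD2l distrC.
have dp0 x : 0 <= ((`|v x - b| `^ q)%R)%:E by rewrite lee_fin powR_ge0.
rewrite ge0_integralZl//; last 2 first.
- by apply: emeasurable_funD => //; exact: measurable_dist_pow.
- by move=> x _; rewrite adde_ge0// lee_fin powR_ge0.
rewrite ge0_integralD//; last 1 first.
- by move=> x _; rewrite lee_fin powR_ge0.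
rewrite integral_cst// mBV.
apply: (@le_trans _ _ ((2 `^ q)%R%:E * ((2 * V * (4 * Psi) `^ q)%:E + ((8 * Psi) `^ q)%R%:E * V%:E))).
  by rewrite lee_wpmul2l ?lee_fin ?powR_ge0// leeD2r// both.
rewrite -EFinM -?EFinD -?EFinM lee_fin /=.
have E8 : (8 * Psi = 2 * (4 * Psi))%R by ring.
have E32 : (32 * Psi = 2 * (2 * (2 * (4 * Psi))))%R by ring.
have P40 : (0 <= 4 * Psi)%R by rewrite mulr_ge0.
have P80 : (0 <= 2 * (4 * Psi))%R by rewrite mulr_ge0.
rewrite E32 E8 (powRM q _ (_ : (0 <= 2 * (2 * (4 * Psi)))%R)) ?mulr_ge0//.
rewrite (powRM q _ P80)// (powRM q _ P40)//.
have h2 : (2 <= 2 `^ q :> R)%R by rewrite -[leLHS]powRr1// ler_powR// ler1n.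
have h4 : (0 <= V * (4 * Psi) `^ q)%R by rewrite mulr_ge0 ?powR_ge0// ltW.
rewrite [leRHS]mulrCA ler_wpM2l ?powR_ge0//; move: h2 h4.
move: (2 `^ q)%R ((4 * Psi) `^ q)%R => t z h2 h4.
have -> : (2 * V * z + t * z * V = (2 + t) * (V * z))%R by ring.
have -> : (V * (t * (t * z)) = (t * t) * (V * z))%R by ring.
by rewrite ler_wpM2r//; nra.
Qed.

End oscillation.

Lemma fine_dist_le (R : realType) (a b : \bar R) : ((`|fine a - fine b|)%:E <= `|a - b|)%E.
Proof. by case: a b => [a||] [b||] //=; rewrite leey. Qed.

Section fractional_poincare.
Context {R : realType} {T : completeMetricType R}.
Variables (mu : {outer_measure set T -> \bar R}) (c CP P C0 Q : R).
Hypotheses (hreg : borel_regular mu) (hdbl : doubling mu c).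
Hypotheses (c1 : 1 <= c) (CP1 : 1 <= CP) (P1 : 1 <= P).
Hypotheses (C01 : 1 <= C0) (Q1 : 1 < Q).
Hypothesis hP : poincare11 mu CP P.
Hypothesis hL : lower_mass_bound mu C0 Q.

Local Notation mass := (mass mu).
Local Notation V := (vol mu).
Let Tc : measurableType _ := caratheodory_type mu.
Let m : {measure set Tc -> \bar R} := mu.
Let leb : {measure set (measurableTypeR R) -> \bar R} := @lebesgue_measure R.

Lemma level_energy_le (theta : R) (A : set T) (v : Tc -> R) (u : T -> \bar R) :
  mu.-cara.-measurable A -> measurable_fun setT v ->
  (forall x y, A x -> A y -> ((`|v x - v y|)%:E <= `|u x - u y|)%E) ->
  (\int[leb]_t energy mu (frac_weight mu theta A) (superlevel (EFin \o v) t) <=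
   mu_integral mu A (fun x => mu_integral mu A (fun y => fractional_integrand mu theta u x y)))%E.
Proof.
move=> mA mv vu.
have sm := sigma_finite_cara hreg hdbl.
have mw := measurable_frac_weight hreg hdbl theta mA.
have mvE : measurable_fun setT (EFin \o v) by exact/measurable_EFinP.
apply: le_trans (coarea_le sm mw (frac_weight_ge0 mu theta A) mvE) _.
rewrite /mu_integral [leRHS]integral_mkcond; apply: ge0_le_integral_nomeas => x _.
  by apply: integral_ge0 => y _; rewrite -EFinM lee_fin mulr_ge0 ?frac_weight_ge0.
rewrite patchE; have [Ax|Ax] := boolP (x \in A); last first.
  by rewrite integral0_eq// => y _; rewrite /frac_weight /= indicE (negbTE Ax) !mul0r mule0.
rewrite [leRHS]integral_mkcond; apply: ge0_le_integral_nomeas => y _.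
  by rewrite -EFinM lee_fin mulr_ge0 ?frac_weight_ge0.
rewrite patchE; have [Ay|Ay] := boolP (y \in A); last first.
  by rewrite /frac_weight /= [\1_A y]indicE (negbTE Ay) mulr0 mul0r mule0.
rewrite (fractional_integrandE hdbl) /frac_weight /= !indicE Ax Ay !mul1r.
apply: lee_wpmul2r; first by rewrite lee_fin frac_kernel_ge0.
by apply: vu; rewrite -inE.
Qed.

Section one_ball.
Variables (theta q r : R) (x0 : T) (n0 : nat).
Hypotheses (t0 : 0 < theta) (t1 : theta < 1) (q1 : 1 <= q) (qQ : q <= Q / (Q - theta)).
Hypotheses (r0 : 0 < r) (hn0 : 2 * (P + 9) <= 2 ^+ n0).

Let B : set T := ball x0 r.
Let A : set T := ball x0 (3 * (P + 9) * r).
Let K : R := 6 * c ^+ n0.+1 * C0 * (192 * CP * c ^+ 16) * (1 - theta) * r `^ theta / V x0 r.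

Let K_ge0 : 0 <= K.
Proof.
have c0 : 0 <= c := le_trans ler01 c1; have CP0 : 0 <= CP := le_trans ler01 CP1.
have C00 : 0 <= C0 := le_trans ler01 C01.
rewrite /K mulr_ge0 ?invr_ge0 ?vol_ge0// mulr_ge0 ?powR_ge0// mulr_ge0 ?subr_ge0 ?(ltW t1)//.
have h1 : 0 <= 192 * CP * c ^+ 16 by rewrite mulr_ge0 ?exprn_ge0// mulr_ge0.
by rewrite mulr_ge0// mulr_ge0// mulr_ge0// exprn_ge0.
Qed.

Lemma upper_tail_le (v : Tc -> R) (b Psi : R) : measurable_fun setT v -> 0 <= Psi ->
  (forall t, b < t -> (mu (B `&` [set x | (t < v x)%R]) <= (V x0 r / 2)%:E)%E) ->
  (K%:E * \int[leb]_t energy mu (frac_weight mu theta A) (superlevel (EFin \o v) t) <= Psi%:E)%E ->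
  forall p, 1 <= p -> p <= q ->
  (\int[m]_(x in B) ((Num.max 0 (v x - b) `^ p)%R)%:E <= (V x0 r * (4 * Psi) `^ p)%:E)%E.
Proof.
move=> mv Psi0 half levels p p1 pq.
have sm := sigma_finite_cara hreg hdbl.
have mA : mu.-cara.-measurable A by exact: (ball_cara hreg).
have mB : mu.-cara.-measurable B by exact: (ball_cara hreg).
have mw := measurable_frac_weight hreg hdbl theta mA.
have mvE : measurable_fun setT (EFin \o v) by exact/measurable_EFinP.
have mBV : m B = (V x0 r)%:E by exact: (volE hdbl).
have V0 := vol_gt0 hdbl x0 r0.
have fB := finite_set_mu_ball hreg hdbl x0 r.
have superE t : superlevel (EFin \o v) t = [set x | t < v x].
  by apply/seteqP; split => x /=; rewrite /superlevel /= lte_fin.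
have mS t : mu.-cara.-measurable [set x | t < v x].
  by rewrite -superE; exact: (measurable_superlevel_set mvE).
pose en t := energy mu (frac_weight mu theta A) (superlevel (EFin \o v) t).
have en0 t : (0 <= en t)%E by apply: energy_ge0 => z; exact: frac_weight_ge0.
have menr : measurable_fun (setT : set (measurableTypeR R)) (en : measurableTypeR R -> \bar R).
  exact: (measurable_level_energy sm mw (frac_weight_ge0 mu theta A) mvE).
apply: (strong_type_of_layers mB mBV V0 mv p1 Psi0) => h n h0.
rewrite -lee_fin; apply: le_trans levels.
rewrite -(ge0_integralZl _ measurableT menr)//.
apply: (@dyadic_step_integral _ _ h0 _ _ b).
- by move=> s; exact: powR_ge0.
- by move=> s t; apply: tail_norm_le.
- by move=> t; rewrite mule_ge0// lee_fin.
move=> s s0; rewrite /en superE.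
have pQ : p <= Q / (Q - theta) := le_trans pq qQ.
have fI : finite_set_mu mu (B `&` [set x | b + s < v x]) by exact: finite_set_mu_setI.
apply: (set_fractional hreg hdbl c1 CP1 P1 C01 Q1 hP hL t0 t1 p1 pQ (mS _) r0 hn0).
by rewrite -lee_fin -massE// mulrC; apply: half; rewrite ltrDl.
Qed.

Lemma real_fractional_poincare (v : Tc -> R) (u : T -> \bar R) (Psi : R) :
  measurable_fun setT v -> m.-integrable B (EFin \o v) -> 0 <= Psi ->
  (forall x y, A x -> A y -> ((`|v x - v y|)%:E <= `|u x - u y|)%E) ->
  (K%:E * mu_integral mu A (fun x => mu_integral mu A (fun y => fractional_integrand mu theta u x y))
    <= Psi%:E)%E ->
  (\int[m]_(x in B) ((`|v x - fine (\int[m]_(y in B) (v y)%:E) / V x0 r| `^ q)%R)%:E <=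
   (V x0 r * (32 * Psi) `^ q)%:E)%E.
Proof.
move=> mv iv Psi0 vu levels.
have mA : mu.-cara.-measurable A by exact: (ball_cara hreg).
have mB : mu.-cara.-measurable B by exact: (ball_cara hreg).
have mBV : m B = (V x0 r)%:E by exact: (volE hdbl).
have V0 := vol_gt0 hdbl x0 r0.
have [b [up lo]] := median_exists mB mBV V0 mv iv.
have mNv : measurable_fun setT (fun x => - v x) by exact: measurableT_comp.
have Nvu x y : A x -> A y -> ((`|- v x - - v y|)%:E <= `|u x - u y|)%E.
  by move=> Ax Ay; rewrite -opprD normrN; exact: vu.
apply: (oscillation_le_of_tails mB mBV V0 mv iv q1 Psi0) => p p1 pq; split.
  apply: (upper_tail_le mv Psi0 up _ p1 pq); apply: le_trans levels.
  apply: lee_wpmul2l; first by rewrite lee_fin.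
  by apply: level_energy_le.
have bvE x : b - v x = - v x - - b by rewrite opprK addrC.
under eq_integral do rewrite bvE.
apply: (upper_tail_le (b := - b) mNv Psi0 _ _ p1 pq).
  move=> t bt; have -> : [set x | t < - v x] = [set x | v x < - t].
    by apply/seteqP; split => x /=; rewrite ltrNr.
  apply: le_trans (lo (- t) _); last by rewrite ltrNl.
  by apply: le_outer_measure; apply: setIS => x /= /ltW.
apply: le_trans levels.
by apply: lee_wpmul2l; [rewrite lee_fin|exact: level_energy_le].
Qed.

Lemma fractional_poincare_ball (u : T -> \bar R) (n1 : nat) :
  L1loc mu u -> 3 * (P + 9) <= 2 ^+ n1 ->
  ((mean mu B (fun x => `|u x - mean mu B u| `^ q)) `^ (q^-1)%R <=
   (32 * (6 * c ^+ n0.+1 * C0 * (192 * CP * c ^+ 16)) * c ^+ n1 * (1 - theta) * r `^ theta)%:E *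
   mean mu A (fun x => mu_integral mu A (fun y => fractional_integrand mu theta u x y)))%E.
Proof.
move=> hu hn1.
have mA : mu.-cara.-measurable A by exact: (ball_cara hreg).
have mB : mu.-cara.-measurable B by exact: (ball_cara hreg).
have mBV : m B = (V x0 r)%:E by exact: (volE hdbl).
have V0 := vol_gt0 hdbl x0 r0.
have P0 : 0 < 3 * (P + 9) by have := P1; lra.
have rA0 : 0 < 3 * (P + 9) * r by rewrite mulr_gt0.
have VA0 := vol_gt0 hdbl x0 rA0.
have BA : B `<=` A.
  by apply: le_ball; rewrite ler_peMl ?(ltW r0)//; have := P1; lra.
have iuA : m.-integrable A u.
  by apply: hu; [exact: open_ball_metric|exact: (compact_closure_ball hreg hdbl)].
have iuB : m.-integrable B u := integrableS mA mB BA iuA.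
have muA := measurable_int m iuA; have muB := measurable_int m iuB.
pose v : Tc -> R := fine \o (u \_ A).
have vE x : A x -> v x = fine (u x) by move=> Ax; rewrite /v /= patchE mem_set.
have mv : measurable_fun setT v.
  apply: (measurableT_comp (fine_measurable measurableT)).
  exact/(measurable_restrictT _ mA).1.
have mvB : measurable_fun (B : set Tc) (EFin \o v) by apply/measurable_EFinP; apply: measurable_funS mv.
have uv : ae_eq m B u (EFin \o v).
  apply: filterS (integrable_ae mB iuB) => x ux Bx.
  by rewrite /= vE ?fineK//; [exact: ux|exact: BA].
have iv : m.-integrable B (EFin \o v).
  apply/integrableP; split => //.
  have [_ fin] := integrableP _ _ _ iuB; apply: le_lt_trans fin.
  apply: ge0_le_integral_nomeas => x Bx //=.
  by rewrite (vE x (BA x Bx)); case: (u x) => [a||] //=; rewrite leey.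
pose a := fine (\int[m]_(x in B) (v x)%:E) / V x0 r.
have meanE : mean mu B u = a%:E.
  have -> : mean mu B u = ((mu B)^-1 * \int[m]_(x in B) (v x)%:E)%E.
    by congr (_ * _)%E; exact: ae_eq_integral.
  rewrite -[X in (_ * X)%E](fineK (integrable_fin_num mB iv)).
  by rewrite (volE hdbl) inver gt_eqF// -EFinM mulrC.
rewrite meanE.
have oscE : mu_integral mu B (fun x => `|u x - a%:E| `^ q)%E =
    (\int[m]_(x in B) ((`|v x - a| `^ q)%R)%:E)%E.
  apply: ge0_ae_eq_integral => //.
  - apply: (measurableT_comp (measurable_poweR q)); apply: measurableT_comp => //.
    by apply: emeasurable_funB => //; exact: measurable_cst.
  - apply/measurable_EFinP; apply: (measurableT_comp (measurable_powR q)).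
    apply: measurableT_comp => //; apply: measurable_funB; last exact: measurable_cst.
    by apply: measurable_funS mv.
  - by move=> x _; exact: poweR_ge0.
  by apply: (filterS _ uv) => x e Bx; rewrite (e Bx).
rewrite /mean oscE.
set F := mu_integral mu A _.
have F0 : (0 <= F)%E.
  apply: integral_ge0 => x _; apply: integral_ge0 => y _.
  by rewrite (fractional_integrandE hdbl) mule_ge0// lee_fin frac_kernel_ge0.
have q0 : 0 < q := lt_le_trans ltr01 q1.
have c0 : 0 < c := lt_le_trans ltr01 c1.
have [D [DE D0]] : exists D, D = 6 * c ^+ n0.+1 * C0 * (192 * CP * c ^+ 16) /\ 0 < D.
  eexists; split; first by reflexivity.
  have CP0 : 0 < CP := lt_le_trans ltr01 CP1; have C00 : 0 < C0 := lt_le_trans ltr01 C01.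
  have h1 : 0 < 192 * CP * c ^+ 16 by rewrite mulr_gt0 ?exprn_gt0// mulr_gt0.
  by rewrite mulr_gt0// mulr_gt0// mulr_gt0// exprn_gt0.
have KE : K = D * (1 - theta) * r `^ theta / V x0 r by rewrite /K -DE.
rewrite -DE.
have coef0 : 0 < 32 * D * c ^+ n1 * (1 - theta) * r `^ theta.
  by rewrite mulr_gt0 ?powR_gt0// mulr_gt0 ?subr_gt0// mulr_gt0 ?exprn_gt0// mulr_gt0.
have VAE : mu A = (V x0 (3 * (P + 9) * r))%:E by exact: (volE hdbl).
rewrite VAE inver gt_eqF//.
move: F0; case FE : F => [f| |]// F0; last first.
  by rewrite gt0_muley ?lte_fin ?invr_gt0// gt0_muley ?leey// lte_fin.
rewrite lee_fin in F0.
have Psi0 : 0 <= K * f by rewrite mulr_ge0.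
have FP : (K%:E * F <= (K * f)%:E)%E by rewrite FE.
have vu x y : A x -> A y -> ((`|v x - v y|)%:E <= `|u x - u y|)%E.
  by move=> Ax Ay; rewrite !vE//; exact: fine_dist_le.
have osc := real_fractional_poincare mv iv Psi0 vu FP; rewrite -/a in osc.
have osc0 : (0 <= \int[m]_(x in B) ((`|v x - a| `^ q)%R)%:E)%E.
  by apply: integral_ge0 => x _; rewrite lee_fin powR_ge0.
have -> : mu B = (V x0 r)%:E by [].
rewrite inver gt_eqF//.
have avg : ((V x0 r)^-1%:E * (\int[m]_(x in B) ((`|v x - a| `^ q)%R)%:E) <=
    ((32 * (K * f)) `^ q)%:E)%E.
  apply: (le_trans (lee_wpmul2l _ osc)); first by rewrite lee_fin invr_ge0 ltW.
  by rewrite -EFinM lee_fin mulKf// gt_eqF.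
have avg0 : (0 <= (V x0 r)^-1%:E * (\int[m]_(x in B) ((`|v x - a| `^ q)%R)%:E))%E.
  by rewrite mule_ge0// lee_fin invr_ge0 ltW.
have qi0 : 0 <= q^-1 by rewrite invr_ge0 ltW.
apply: (@le_trans _ _ (((32 * (K * f)) `^ q)%:E `^ q^-1)%E).
  by apply: (gt0_ler_poweR qi0); rewrite // in_itv /= ?avg0 ?lee_fin ?powR_ge0 leey.
rewrite poweR_EFin -powRrM divff ?gt_eqF// powRr1 ?(mulr_ge0 (ler0n _ 32) Psi0)//.
rewrite -!EFinM lee_fin KE.
have VB : V x0 (3 * (P + 9) * r) <= c ^+ n1 * V x0 r.
  by apply: (vol_compare hdbl r0); rewrite mdistxx add0r ler_wpM2r// ltW.
rewrite (_ : 32 * (_ * f) = (32 * D * (1 - theta) * r `^ theta) * ((V x0 r)^-1 * f)); last by ring.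
rewrite (_ : 32 * D * c ^+ n1 * (1 - theta) * r `^ theta * _ =
  (32 * D * (1 - theta) * r `^ theta) * (c ^+ n1 / V x0 (3 * (P + 9) * r) * f)); last by ring.
apply: ler_wpM2l.
  by rewrite mulr_ge0 ?powR_ge0// mulr_ge0 ?subr_ge0 ?(ltW t1)// mulr_ge0// ltW.
by apply: ler_wpM2r => //; rewrite ler_pdivlMr// ler_pdivrMl// [leRHS]mulrC.
Qed.

End one_ball.

End fractional_poincare.

(* C0 and Qd are the constant and the exponent of the relative lower mass
   bound, as functions of the doubling constant only. *)
Theorem theorem1p1 (R : realType) (C0 Qd : R -> R)
    (hC0 : forall c : R, 1 <= c -> 1 <= C0 c)
    (hQd : forall c : R, 1 <= c -> 1 < Qd c)
    (Cmu CP tauP : R) (hCmu : 1 <= Cmu) (hCP : 1 <= CP) (htauP : 1 <= tauP) :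
  exists C tau : R, [/\ 1 <= C, 1 <= tau &
    forall (X : completeMetricType R) (mu : {outer_measure set X -> \bar R}),
      borel_regular mu ->
      doubling mu Cmu ->
      lower_mass_bound mu (C0 Cmu) (Qd Cmu) ->
      poincare11 mu CP tauP ->
    forall theta q : R, 0 < theta -> theta < 1 ->
      1 <= q -> q <= Qd Cmu / (Qd Cmu - theta) ->
    forall (x0 : X) (r : R), 0 < r ->
    forall u : X -> \bar R, L1loc mu u ->
      let B := ball x0 r in
      let tauB := ball x0 (tau * r) in
      ((mean mu B (fun x => `|u x - mean mu B u| `^ q)) `^ (q^-1)%R <=
       (C * (1 - theta) * r `^ theta)%:E *
         mean mu tauB (fun x =>
           mu_integral mu tauB (fun y => fractional_integrand mu theta u x y)))%E].
Proof.
have [n0 hn0] := exists_exp2_ge (2 * (tauP + 9)).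
have [n1 hn1] := exists_exp2_ge (3 * (tauP + 9)).
exists (32 * (6 * Cmu ^+ n0.+1 * C0 Cmu * (192 * CP * Cmu ^+ 16)) * Cmu ^+ n1), (3 * (tauP + 9)).
have C01 := hC0 _ hCmu; have Q1 := hQd _ hCmu.
split; last 1 first.
- move=> X mu hreg hdbl hL hP theta q t0 t1 q1 qQ x0 r r0 u hu.
  exact: (fractional_poincare_ball hreg hdbl hCmu hCP htauP C01 Q1 hP hL x0 t0 t1 q1 qQ r0 hn0 hu hn1).
- have n (a : nat) : (0 < a)%N -> 1 <= a%:R :> R by rewrite ler1n.
  by rewrite !mulr_ege1 ?n ?exprn_ege1.
- lra.
Qed.
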